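(* Let $d\ge 3$ and let $E\subset\mathbb R^d$ be compact with $\dim_{\mathcal H}(E)>d-1+\frac1d$. Then for every $x^0\in\mathbb R^d$, the set $$V_d^{x^0}(E):=\left\{\left|\det\left[x^1-x^0,\,x^2-x^0,\dots,x^d-x^0\right]\right| : x^1,\dots,x^d\in E\right\}$$ has nonempty interior in $\mathbb R$.
   Context: $\dim_{\mathcal H}$ denotes Hausdorff dimension; $\det[v_1,\dots,v_d]$ is the determinant of the $d\times d$ matrix with columns $v_1,\dots,v_d$. *)

(* Defs.v *)
From HB Require Import structures.
From mathcomp Require Import all_boot all_order all_algebra.
From mathcomp Require Import all_classical all_reals all_analysis.
Set Implicit Arguments. Unset Strict Implicit. Unset Printing Implicit Defensive.
Import Order.TTheory GRing.Theory Num.Theory.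
Import numFieldNormedType.Exports.
Local Open Scope classical_set_scope.
Local Open Scope ring_scope.

Section Hausdorff.
Variables (R : realType) (d : nat).
Local Notation V := 'cV[R]_d.

Definition edist (x y : V) : R := Num.sqrt (\sum_(i < d) (x i 0 - y i 0) ^+ 2).

(* diameter (in the extended reals; -oo for the empty set, unused) *)
Definition ediam (U : set V) : \bar R :=
  ereal_sup [set r | exists x y, U x /\ U y /\ r = (edist x y)%:E].

Definition diam_pow (s : R) (U : set V) : \bar R :=
  if pselect (U = set0) then 0%E
  else match ediam U with
       | r%:E => (r `^ s)%:E
       | _ => +oo%E
       end.

Definition hcontent (s delta : R) (E : set V) : \bar R :=
  ereal_inf [set S | exists U : nat -> set V,
    [/\ E `<=` \bigcup_k U k, (forall k, (ediam (U k) <= delta%:E)%E)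
      & S = (\sum_(0 <= k <oo) diam_pow s (U k))%E]].

Definition hmeasure (s : R) (E : set V) : \bar R :=
  ereal_sup [set h | exists2 delta : R, 0 < delta & h = hcontent s delta E].

Definition hdim (E : set V) : \bar R :=
  ereal_inf [set s%:E | s in [set s : R | 0 <= s /\ hmeasure s E = 0%E]].

Definition vol_set (x0 : V) (E : set V) : set R :=
  [set r | exists x : 'I_d -> V, (forall j, E (x j)) /\
     r = `| \det (\matrix_(i < d, j < d) (x j i 0 - x0 i 0)) |].

End Hausdorff.

(* Main.v *)
(* Three is the essential dimension: for linearly independent x^1, ..., x^(d-3) in E, projecting
along their span sends E to a set of R^3 of dimension > 2, and determinants become multiples of
3 x 3 determinants.

In R^3, take Frostman measures mu at scale 2^-N and average over the linear forms
F = x1 + A x2 + B x3. Pairs of points at distance r interact through the average of a fourth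
difference of |F(x - y)|, which a C^{1,1} weight in (A, B) makes small like (eps/r)^3; since the
dimension exceeds 2, the Haar coefficients of the image of mu under F are summable in sup norm for
most (A, B) and most dyadic grids. So the image of mu at all finer scales charges every subinterval
of some interval around 0 of length independent of N. For most (A, B), moreover, the slice {F ~ 0}
carries mass and does not concentrate near a line through 0, so it contains x, y with
|x2 y3 - x3 y2| bounded below. As F(x) ~ F(y) ~ 0, det(x, y, z) is approximately
(x2 y3 - x3 y2) F(z), so |det| comes 2^-N-close to each point of a fixed interval [0, ell].
Compactness removes the approximation. *)

Require Import Defs.
From HB Require Import structures.
From mathcomp Require Import all_boot all_order all_algebra.
From mathcomp Require Import ring lra zify.
Set Implicit Arguments. Unset Strict Implicit. Unset Printing Implicit Defensive.
Import Order.TTheory GRing.Theory Num.Theory.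
Local Open Scope ring_scope.

(** * Progressions, weights and tents *)

(** One Haar coefficient is controlled only by the square sum over its whole level, and on a cell of
    length 2^-n a mass difference is a density jump 2^n times as large. So the square sum at level n
    has to be smaller than 4^-n by a summable factor. Write 2^-s = chi^3 / 4 with s > 2: the
    averaged square sum is at most a constant times (chi^3 / 4)^n; one of the three powers of chi
    pays for the sum over n, the other two make the jumps at most a constant times chi^n. This needs
    interactions that decay faster than (eps/r)^s. Two powers of eps/r come from the second
    difference of the weight, the third from the small proportion of slopes with F(x - y) of size
    eps; chi >= 9/10 keeps s below 3.

    Integrals over slopes are sums over a lattice with L steps per unit. The rounding error does not
    decay in r, so L exceeds the cube of the largest distance.

    Mass of the slice, a pair off a common line and small Haar tails are needed for the same slopes
    and the same grid. One inequality between averages, with suitable coefficients, gives the three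
    at once. *)

Section LatticeSums.
Variable R : archiRealFieldType.
Implicit Types (c e r x Z : R).

Lemma count_progression_pos n c Z r : 0 < Z -> 0 <= r ->
  \sum_(i < n) (`|c + i%:R * Z| <= r)%R%:R <= 2 * r / Z + 1.
Proof.
move=> Z0 r0.
(* The induction removes the last term; if it is a hit, all other hits lie at least [Z] lower. So
   the upper end [v] of the window has to vary. *)
suff H : forall v, - r <= v ->
    (forall i : 'I_n, `|c + i%:R * Z| <= r -> c + i%:R * Z <= v) ->
    \sum_(i < n) (`|c + i%:R * Z| <= r)%R%:R <= (v + r) / Z + 1.
  have -> : 2 * r = r + r by ring.
  apply: H; first by lra.
  by move=> i; rewrite ler_norml => /andP[].
elim: n => [|n IH] v rv hv.
  rewrite big_ord0 addr_ge0 // divr_ge0 //; lra.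
rewrite big_ord_recr /=.
case: (leP `|c + n%:R * Z| r) => hn; last first.
  by rewrite addr0; apply: IH => // i; exact: (hv (widen_ord (leqnSn n) i)).
have hnv : c + n%:R * Z <= v by exact: (hv ord_max).
have hi (i : 'I_n) : c + i%:R * Z <= c + n%:R * Z - Z.
  have : i%:R + 1 <= n%:R :> R by rewrite natr1 ler_nat ltn_ord.
  nra.
case: (leP (- r) (c + n%:R * Z - Z)) => hr.
  have := IH _ hr (fun i _ => hi i).
  have : (c + n%:R * Z - Z + r) / Z + 1 <= (v + r) / Z.
    by rewrite -[X in _ + X](divff (lt0r_neq0 Z0)) -mulrDl ler_pM2r ?invr_gt0 //; lra.
  rewrite /=; lra.
rewrite big1 ?add0r; last first.
  move=> i _; apply/eqP; rewrite pnatr_eq0 eqb0; apply/negP.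
  rewrite ler_norml => /andP[h _]; have := hi i; lra.
rewrite lerDr divr_ge0 //; lra.
Qed.

Lemma count_progression n c Z r : Z != 0 -> 0 <= r ->
  \sum_(i < n) (`|c + i%:R * Z| <= r)%R%:R <= 2 * r / `|Z| + 1.
Proof.
move=> Z0 r0; case: (ltgtP Z 0) Z0 => // Zs _.
  rewrite ltr0_norm //.
  have := @count_progression_pos n (- c) (- Z) r; rewrite oppr_gt0 => /(_ Zs r0).
  by under eq_bigr => i _ do rewrite mulrN -opprD normrN.
by rewrite gtr0_norm //; exact: count_progression_pos.
Qed.

Lemma sum_ge_block (n i0 k : nat) (m : R) (F : nat -> R) :
  (i0 + k <= n)%N -> (forall i, 0 <= F i) ->
  (forall i, (i0 <= i < i0 + k)%N -> m <= F i) ->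
  k%:R * m <= \sum_(i < n) F i.
Proof.
move=> le F0 Fm; rewrite -(big_mkord predT F).
rewrite (big_cat_nat (n := i0)) //=; last by lia.
rewrite (big_cat_nat (n := i0 + k) (m := i0)) //=; last by lia.
rewrite addrCA -[leLHS]addr0 lerD //; last by rewrite addr_ge0 // sumr_ge0.
rewrite mulr_natl -[X in m *+ X](addKn i0 k) -sumr_const_nat.
by rewrite !big_nat; apply: ler_sum.
Qed.

(** The square makes the derivative Lipschitz across the ends 4 and -4 of the support, hence second
    differences of order h^2. *)
Definition weight (a : R) : R := Num.max 0 (16 - a ^+ 2) ^+ 2.

Lemma weight_ge0 a : 0 <= weight a. Proof. exact: sqr_ge0. Qed.

Lemma weight_le a : weight a <= 256.
Proof.
rewrite /weight; have := sqr_ge0 a; case: (leP 0 (16 - a ^+ 2)) => h; nra.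
Qed.

Lemma weight_eq0 a : 4 <= `|a| -> weight a = 0.
Proof.
move=> ha; rewrite /weight max_l ?expr0n //.
have : 4 ^+ 2 <= `|a| ^+ 2 by rewrite lerXn2r // nnegrE.
rewrite real_normK ?num_real //; lra.
Qed.

(** The derivative 2 y_+ of y_+^2 is Lipschitz with constant 2, which bounds the remainder by
    k^2. *)
Lemma sqr_pospart_taylor (y k : R) :
  `|Num.max 0 (y + k) ^+ 2 - Num.max 0 y ^+ 2 - 2 * Num.max 0 y * k| <= k ^+ 2.
Proof.
rewrite ler_norml.
by case: (leP 0 (y + k)) => h1; case: (leP 0 y) => h2; apply/andP; split; nra.
Qed.

(** 306 = 121 + 121 + 64: two Taylor remainders ((2a - h) h)^2 and ((2a + h) h)^2 with factors of
    modulus at most 11, and the first-order terms, which add up to -4 y h^2 with y <= 16. For |a| >=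
    5 all three values vanish. *)
Lemma weight_second_diff a h : 0 <= h <= 1 ->
  `|weight (a + h) + weight (a - h) - 2 * weight a| <= 306 * h ^+ 2.
Proof.
move=> /andP[h0 h1]; case: (leP 5 `|a|) => ha.
  rewrite !weight_eq0 ?mulr0 ?addr0 ?subr0 ?normr0; last 3 first.
  - by lra.
  - have := lerB_normD a (- h); rewrite normrN (ger0_norm h0); lra.
  - have := lerB_normD a h; rewrite (ger0_norm h0); lra.
  by rewrite mulr_ge0 ?sqr_ge0 //; lra.
move: ha; rewrite ltr_norml => /andP[a1 a2].
have := sqr_pospart_taylor (16 - a ^+ 2) (- 2 * a * h - h ^+ 2).
have := sqr_pospart_taylor (16 - a ^+ 2) (2 * a * h - h ^+ 2).
rewrite /weight.
have -> : 16 - a ^+ 2 + (2 * a * h - h ^+ 2) = 16 - (a - h) ^+ 2 by ring.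
have -> : 16 - a ^+ 2 + (- 2 * a * h - h ^+ 2) = 16 - (a + h) ^+ 2 by ring.
have ym : 0 <= Num.max 0 (16 - a ^+ 2) <= 16.
  by have := sqr_ge0 a; case: (leP 0 (16 - a ^+ 2)) => ? ?; apply/andP; split; lra.
move: (Num.max 0 (16 - a ^+ 2)) ym => y /andP[y0 y1].
move: (Num.max 0 (16 - (a - h) ^+ 2)) (Num.max 0 (16 - (a + h) ^+ 2)) => u v.
rewrite !ler_norml => /andP[A1 A2] /andP[B1 B2].
have K1 : (2 * a * h - h ^+ 2) ^+ 2 <= 121 * h ^+ 2.
  have -> : (2 * a * h - h ^+ 2) ^+ 2 = (2 * a - h) ^+ 2 * h ^+ 2 by ring.
  by rewrite ler_wpM2r ?sqr_ge0 //; nra.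
have K2 : (- 2 * a * h - h ^+ 2) ^+ 2 <= 121 * h ^+ 2.
  have -> : (- 2 * a * h - h ^+ 2) ^+ 2 = (2 * a + h) ^+ 2 * h ^+ 2 by ring.
  by rewrite ler_wpM2r ?sqr_ge0 //; nra.
have : 0 <= y * h ^+ 2 <= 16 * h ^+ 2.
  by rewrite mulr_ge0 ?sqr_ge0 // ler_wpM2r ?sqr_ge0.
move=> /andP[Y1 Y2].
by apply/andP; split; lra.
Qed.

(** Each unit of shift loses a value of [F] below -4L and gains one above 5L; both are zero. *)
Lemma sum_shift (L q : nat) (F : R -> R) : (q <= L)%N ->
  (forall z, z <= - 4 * L%:R -> F z = 0) -> (forall z, 5 * L%:R <= z -> F z = 0) ->
  \sum_(i < (10 * L).+1) F (i%:R - 5 * L%:R + q%:R) =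
  \sum_(i < (10 * L).+1) F (i%:R - 5 * L%:R).
Proof.
elim: q => [|q IH] qL F1 F2; first by under eq_bigr do rewrite addr0.
rewrite -IH //; last by lia.
have qL' : q%:R + 1 <= L%:R :> R by rewrite natr1 ler_nat.
have q0 : 0 <= q%:R :> R by [].
rewrite big_ord_recr [RHS]big_ord_recl /= F2 ?addr0; last first.
  by rewrite natrM -natr1; lra.
rewrite F1 ?add0r; last by lra.
apply: eq_bigr => i _; congr F; rewrite /bump /= add1n -!natr1; ring.
Qed.

Definition tri e (v : R) : R := Num.max 0 (e - `|v|).
(* Autocorrelation of the Haar function 1_[0,e) - 1_[e,2e); it is a fourth difference of |v|. *)
Definition lam e (v : R) : R := 2 * tri e v - tri e (v - e) - tri e (v + e).

Lemma tri_ge0 e v : 0 <= tri e v. Proof. by rewrite /tri le_max lexx. Qed.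

Lemma tri_le e v : 0 <= e -> tri e v <= e.
Proof. by move=> e0; rewrite /tri ge_max e0 lerBlDr lerDl normr_ge0. Qed.

Lemma tri_eq0 e v : e <= `|v| -> tri e v = 0.
Proof. by move=> h; rewrite /tri max_l // subr_le0. Qed.

Lemma triN e v : tri e (- v) = tri e v. Proof. by rewrite /tri normrN. Qed.

Lemma lamN e v : lam e (- v) = lam e v.
Proof.
rewrite /lam triN -(triN e (- v - e)) -(triN e (- v + e)).
by rewrite !opprD !opprK; ring.
Qed.

Lemma tri_lip e v u : `|tri e v - tri e u| <= `|v - u|.
Proof.
have h1 := lerB_dist v u; have h2 := lerB_dist u v; rewrite distrC in h2.
have h0 := normr_ge0 (v - u).
by rewrite /tri ler_norml; case: (leP 0 (e - `|v|)) => ?; case: (leP 0 (e - `|u|)) => ?;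
  apply/andP; split; lra.
Qed.

Lemma lam_le e v : 0 <= e -> `|lam e v| <= 2 * e.
Proof.
move=> e0; rewrite /lam.
have := tri_ge0 e v; have := tri_ge0 e (v - e); have := tri_ge0 e (v + e).
have := tri_le v e0; have := tri_le (v - e) e0; have := tri_le (v + e) e0.
by rewrite ler_norml => *; apply/andP; split; lra.
Qed.

Lemma lam_eq0 e v : 0 <= e -> 2 * e <= `|v| -> lam e v = 0.
Proof.
move=> e0 h; rewrite /lam !tri_eq0 ?mulr0 ?subr0 //.
- have := lerB_normD v e; rewrite (ger0_norm e0); lra.
- have := lerB_normD v (- e); rewrite normrN (ger0_norm e0); lra.
- lra.
Qed.

End LatticeSums.

(** * Averaging the fourth difference of the absolute value *)

Section Oscillation.
Variable R : archiRealFieldType.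
Implicit Types (c e Z : R) (L : nat).

(* The index i < 10 L + 1 stands for the integer i - 5 L, at which the weight of i / L vanishes
   near both ends. *)
Definition node L (i : nat) : R := i%:R - 5 * L%:R.

Lemma node_bound L (i : 'I_(10 * L).+1) : `|node L i| <= 5 * L%:R.
Proof.
have : i%:R <= 10 * L%:R :> R by rewrite -natrM ler_nat -ltnS ltn_ord.
by rewrite /node ler_norml => h; have := ler0n R (nat_of_ord i); move=> h0; apply/andP; split; lra.
Qed.

(** The step [e] need not be a multiple of [Z]. Moving by [q] nodes instead costs at most [Z] per
    node, the tent being 1-Lipschitz, and only the nodes within 3e of the zero matter: 256 Z (6e/Z +
    1) <= 1792 e. *)
Lemma weighted_shift L (q : nat) (e Z c s : R) : (0 < L)%N -> 0 < Z -> Z <= e ->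
  q%:R * Z <= e -> e <= q%:R * Z + Z -> `|s| = 1 ->
  `|\sum_(i < (10 * L).+1) weight (node L i / L%:R) * tri e (c + node L i * Z + s * e) -
    \sum_(i < (10 * L).+1) weight (node L i / L%:R) *
      tri e (c + (node L i + s * q%:R) * Z)| <= 1792 * e.
Proof.
move=> L0 Z0 Ze q1 q2 s1; rewrite -sumrB.
apply: le_trans (ler_norm_sum _ _ _) _.
have hc := @count_progression_pos R (10 * L).+1 (c - 5 * L%:R * Z) Z (3 * e) Z0.
have {hc} hc := hc ltac:(lra).
apply: (@le_trans _ _ (\sum_(i < (10 * L).+1)
    256 * Z * (`|c - 5 * L%:R * Z + i%:R * Z| <= 3 * e)%R%:R)).
  apply: ler_sum => i _; rewrite -mulrBr.
  have -> : c - 5 * L%:R * Z + i%:R * Z = c + node L i * Z by rewrite /node; ring.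
  case: (leP `|c + node L i * Z| (3 * e)) => h; last first.
    rewrite !tri_eq0 ?subrr ?mulr0 ?normr0 //.
    - rewrite mulrDl addrA; have := lerB_normD (c + node L i * Z) (s * q%:R * Z).
      rewrite !normrM s1 mul1r normr_nat (gtr0_norm Z0); lra.
    - have := lerB_normD (c + node L i * Z) (s * e).
      rewrite !normrM s1 mul1r (ger0_norm (_ : 0 <= e)); lra.
  rewrite mulr1 normrM ger0_norm ?weight_ge0 // ler_pM ?weight_ge0 ?weight_le //.
  apply: le_trans (tri_lip _ _ _) _.
  have -> : c + node L i * Z + s * e - (c + (node L i + s * q%:R) * Z) =
    s * (e - q%:R * Z) by ring.
  rewrite normrM s1 mul1r ler_norml; apply/andP; split; lra.
rewrite -mulr_sumr; apply: le_trans (ler_wpM2l _ hc) _; first by lra.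
have -> : 256 * Z * (2 * (3 * e) / Z + 1) = 1536 * e + 256 * Z.
  by field; rewrite (lt0r_neq0 Z0).
lra.
Qed.

(* [lam e] is a second difference of step e of [tri e], and c + node * Z moves by e (up to Z)
   when the node moves by q = floor (e / Z). Shifting the nodes transfers the second difference
   to the weight, which gains (q / L)^2. *)
Lemma lam_line_sum_pos L e Z c : (0 < L)%N -> 0 < Z -> Z <= e -> e <= L%:R * Z ->
  `|\sum_(i < (10 * L).+1) weight (node L i / L%:R) * lam e (c + node L i * Z)|
    <= 918 * (e / (L%:R * Z)) ^+ 2 * (e ^+ 2 / Z) + 3584 * e.
Proof.
move=> L0 Z0 Ze eL.
have e0 : 0 < e by apply: lt_le_trans Ze.
have LR : 0 < L%:R :> R by rewrite ltr0n.
have LZ : 0 < L%:R * Z by rewrite mulr_gt0.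
pose q := Num.trunc (e / Z).
have /andP[q1 q2] : q%:R <= e / Z < q.+1%:R.
  by apply: truncn_itv; rewrite divr_ge0 // ltW.
rewrite ler_pdivlMr // in q1; rewrite ltr_pdivrMr // -natr1 mulrDl mul1r in q2.
have qL : (q <= L)%N.
  rewrite -(ler_nat R) -(ler_pM2r Z0); lra.
have h1 := @weighted_shift L q e Z c 1 L0 Z0 Ze q1 (ltW q2) (normr1 _).
have h2 := @weighted_shift L q e Z c (-1) L0 Z0 Ze q1 (ltW q2)
  (etrans (normrN1 _) erefl).
have s1 : \sum_(i < (10 * L).+1) weight (node L i / L%:R) *
      tri e (c + (node L i + 1 * q%:R) * Z) =
   \sum_(i < (10 * L).+1) weight ((node L i - q%:R) / L%:R) *
      tri e (c + node L i * Z).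
  have := @sum_shift R L q (fun z => weight ((z - q%:R) / L%:R) * tri e (c + z * Z)) qL.
  move=> <-; first by apply: eq_bigr => i _; rewrite /node addrK mul1r.
  - move=> z hz; rewrite weight_eq0 ?mul0r // ler_normr.
    apply/orP; right; rewrite -mulNr ler_pdivlMr //; have := ler0n R q; lra.
  - move=> z hz; rewrite weight_eq0 ?mul0r // ler_normr.
    apply/orP; left; rewrite ler_pdivlMr //; move: qL; rewrite -(ler_nat R); lra.
have s2 : \sum_(i < (10 * L).+1) weight (node L i / L%:R) *
      tri e (c + (node L i + -1 * q%:R) * Z) =
   \sum_(i < (10 * L).+1) weight ((node L i + q%:R) / L%:R) *
      tri e (c + node L i * Z).
  have := @sum_shift R L q (fun z => weight (z / L%:R) * tri e (c + (z - q%:R) * Z)) qL.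
  move=> h; rewrite [LHS](_ : _ = \sum_(i < (10 * L).+1)
    weight (node L i / L%:R) * tri e (c + (node L i - q%:R) * Z)); last first.
    by apply: eq_bigr => i _; rewrite mulN1r.
  rewrite -h; first by apply: eq_bigr => i _; rewrite /node addrK.
  - move=> z hz; rewrite weight_eq0 ?mul0r // ler_normr.
    apply/orP; right; rewrite -mulNr ler_pdivlMr //; lra.
  - move=> z hz; rewrite weight_eq0 ?mul0r // ler_normr.
    apply/orP; left; rewrite ler_pdivlMr //; lra.
rewrite s1 in h1; rewrite s2 in h2.
set T := \sum_(i < (10 * L).+1) (2 * weight (node L i / L%:R) -
   weight ((node L i - q%:R) / L%:R) - weight ((node L i + q%:R) / L%:R)) *
   tri e (c + node L i * Z).
have hT : `|T| <= 918 * (e / (L%:R * Z)) ^+ 2 * (e ^+ 2 / Z).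
  apply: le_trans (ler_norm_sum _ _ _) _.
  apply: (@le_trans _ _ (\sum_(i < (10 * L).+1)
    306 * (e / (L%:R * Z)) ^+ 2 * e *
      (`|c - 5 * L%:R * Z + i%:R * Z| <= e)%R%:R)).
    apply: ler_sum => i _.
    have -> : c - 5 * L%:R * Z + i%:R * Z = c + node L i * Z by rewrite /node; ring.
    case: (leP `|c + node L i * Z| e) => h; last by rewrite tri_eq0 ?mulr0 ?normr0 // ltW.
    rewrite mulr1 normrM ler_pM //; last by rewrite ger0_norm ?tri_ge0 ?tri_le // ltW.
    rewrite -normrN.
    have -> : - (2 * weight (node L i / L%:R) - weight ((node L i - q%:R) / L%:R) -
       weight ((node L i + q%:R) / L%:R)) =
       weight (node L i / L%:R + q%:R / L%:R) + weight (node L i / L%:R - q%:R / L%:R)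
        - 2 * weight (node L i / L%:R) by rewrite -mulrDl -mulrBl; ring.
    apply: le_trans (weight_second_diff _ _) _.
      by rewrite divr_ge0 ?ler0n //= ler_pdivrMr // mul1r ler_nat.
    rewrite ler_pM2l; last by lra.
    rewrite lerXn2r ?nnegrE ?divr_ge0 ?ler0n ?(ltW e0) ?(ltW LZ) //.
    have -> : q%:R / L%:R = q%:R * Z / (L%:R * Z) by field; rewrite !lt0r_neq0.
    by rewrite ler_pM2r ?invr_gt0.
  rewrite -mulr_sumr.
  have := @count_progression_pos R (10 * L).+1 (c - 5 * L%:R * Z) Z e Z0 (ltW e0).
  move=> hc; apply: le_trans (ler_wpM2l _ hc) _.
    by rewrite mulr_ge0 ?(ltW e0) // mulr_ge0 ?sqr_ge0.
  (* 918 = 3 * 306, because the number 2e/Z + 1 of nodes is at most 3e/Z. *)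
  have -> : 918 * (e / (L%:R * Z)) ^+ 2 * (e ^+ 2 / Z) =
     306 * (e / (L%:R * Z)) ^+ 2 * e * (3 * e / Z).
    by field; rewrite !lt0r_neq0.
  rewrite ler_wpM2l //; first by rewrite mulr_ge0 ?(ltW e0) // mulr_ge0 ?sqr_ge0.
  have : 1 <= e / Z by rewrite ler_pdivlMr // mul1r.
  rewrite -!mulrA; lra.
have -> : \sum_(i < (10 * L).+1) weight (node L i / L%:R) * lam e (c + node L i * Z) =
   T - (\sum_(i < (10 * L).+1) weight (node L i / L%:R) * tri e (c + node L i * Z + 1 * e) -
    \sum_(i < (10 * L).+1) weight ((node L i - q%:R) / L%:R) * tri e (c + node L i * Z))
   - (\sum_(i < (10 * L).+1) weight (node L i / L%:R) * tri e (c + node L i * Z + -1 * e) -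
    \sum_(i < (10 * L).+1) weight ((node L i + q%:R) / L%:R) * tri e (c + node L i * Z)).
  rewrite /T -!sumrB; apply: eq_bigr => i _; rewrite /lam mul1r mulN1r; ring.
apply: le_trans (ler_normB _ _) _; apply: le_trans (lerD (ler_normB _ _) (lexx _)) _.
lra.
Qed.

End Oscillation.

(** * Averages over both slopes *)

Section Oscillation2.
Variable R : archiRealFieldType.
Implicit Types (c e ep Z zeta : R) (L : nat).

Lemma lam_line_sum L e Z c : (0 < L)%N -> 0 < `|Z| -> `|Z| <= e -> e <= L%:R * `|Z| ->
  `|\sum_(i < (10 * L).+1) weight (node R L i / L%:R) * lam e (c + node R L i * Z)|
    <= 918 * (e / (L%:R * `|Z|)) ^+ 2 * (e ^+ 2 / `|Z|) + 3584 * e.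
Proof.
move=> L0; case: (ger0P Z) => Z0; first by move=> h1 h2 h3; have := lam_line_sum_pos c L0 h1 h2 h3.
move=> h1 h2 h3; have := lam_line_sum_pos (- c) L0 h1 h2 h3.
suff -> : \sum_(i < (10 * L).+1) weight (node R L i / L%:R) * lam e (- c + node R L i * - Z)
  = \sum_(i < (10 * L).+1) weight (node R L i / L%:R) * lam e (c + node R L i * Z) by [].
by apply: eq_bigr => i _; rewrite mulrN -opprD lamN.
Qed.

(* Locked: unification would otherwise unfold the numerals in unary. *)
Definition wtot : R := locked 2816.

Lemma wtot_gt0 : 0 < wtot. Proof. by rewrite /wtot -lock. Qed.

Lemma weight_sum_le L : (0 < L)%N ->
  \sum_(i < (10 * L).+1) weight (node R L i / L%:R) <= wtot * L%:R.
Proof.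
(* 2816 = 11 * 256, with 10 L + 1 <= 11 L nodes. *)
rewrite /wtot -lock => L0; apply: (@le_trans _ _ (\sum_(i < (10 * L).+1) 256)).
  by apply: ler_sum => i _; exact: weight_le.
rewrite sumr_const card_ord -[leLHS]mulr_natr -[(10 * L).+1%:R]natr1 natrM.
have : 1 <= L%:R :> R by rewrite ler1n.
lra.
Qed.

(** Interaction of two points with difference (Z1, Z2, Z3), summed over the forms x1 + A x2 + B x3.
    Everything is multiplied by [L], so that integer points have integer values. *)
Definition lam_plane_sum L e Z1 Z2 Z3 : R :=
  \sum_(a < (10 * L).+1) \sum_(b < (10 * L).+1)
    weight (node R L a / L%:R) * weight (node R L b / L%:R) *
    lam e (L%:R * Z1 + node R L a * Z2 + node R L b * Z3).

Lemma lam_plane_sumC L e Z1 Z2 Z3 : lam_plane_sum L e Z1 Z2 Z3 = lam_plane_sum L e Z1 Z3 Z2.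
Proof.
rewrite /lam_plane_sum exchange_big /=; apply: eq_bigr => a _; apply: eq_bigr => b _.
by rewrite (mulrC (weight _)) addrAC.
Qed.

Lemma lam_plane_sum_trivial L e Z1 Z2 Z3 : (0 < L)%N -> 0 <= e ->
  `|lam_plane_sum L e Z1 Z2 Z3| <= wtot ^+ 2 * L%:R ^+ 2 * (2 * e).
Proof.
move=> L0 e0.
have -> : wtot ^+ 2 * L%:R ^+ 2 * (2 * e) = (wtot * L%:R) * (wtot * L%:R) * (2 * e) by ring.
have H := weight_sum_le L0.
apply: (@le_trans _ _ ((\sum_(i < (10 * L).+1) weight (node R L i / L%:R)) *
   (\sum_(i < (10 * L).+1) weight (node R L i / L%:R)) * (2 * e))); last first.
  apply: ler_wpM2r; first by rewrite mulr_ge0.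
  by apply: ler_pM => //; apply: sumr_ge0 => i _; exact: weight_ge0.
rewrite mulr_suml mulr_suml; apply: le_trans (ler_norm_sum _ _ _) _.
apply: ler_sum => a _; rewrite mulr_sumr mulr_suml; apply: le_trans (ler_norm_sum _ _ _) _.
apply: ler_sum => b _; rewrite normrM ler_pM ?lam_le //.
by rewrite ger0_norm // mulr_ge0 ?weight_ge0.
Qed.

(** Constant for the average over one slope; 20^3 is the loss in replacing [|Z2|] by
    [zeta <= 20 * |Z2|] in a third power. *)
Definition osc_in : R := locked (918 * 20 ^+ 3 + 3584).

Lemma osc_in_gt0 : 0 < osc_in.
Proof. by rewrite /osc_in -lock addr_gt0 // mulr_gt0 // exprn_gt0. Qed.

Definition osc_const : R := wtot * (2 * wtot + osc_in).

Lemma osc_const_ge0 : 0 <= osc_const. Proof.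
have h1 := wtot_gt0; have h2 := osc_in_gt0.
exact: (mulr_ge0 (ltW h1) (addr_ge0 (mulr_ge0 (ler0n R 2) (ltW h1)) (ltW h2))).
Qed.

Lemma scaled_bound (p q k e t X : R) : 0 <= p -> 0 <= k -> 0 <= e ->
  t <= q * X -> 1 <= X -> p * e * t + k * e <= (p * q + k) * e * X.
Proof.
move=> p0 k0 e0 tX X1.
have -> : (p * q + k) * e * X = p * e * (q * X) + k * e * X by ring.
by rewrite lerD // ?ler_wpM2l ?mulr_ge0 // ler_peMr ?mulr_ge0.
Qed.

(** The slope that multiplies [Z2] alone gives the decay; the other is summed trivially. The
    assumption [zeta ^+ 3 <= L%:R] says that [X] >= 1, which absorbs the rounding term of
    [lam_line_sum]. *)
Lemma lam_plane_sum_dominant L ep Z1 Z2 Z3 zeta : (0 < L)%N -> 1 <= ep -> zeta ^+ 3 <= L%:R ->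
  20 * ep < zeta -> `|Z2| <= zeta -> zeta <= 20 * `|Z2| ->
  `|lam_plane_sum L (L%:R * ep) Z1 Z2 Z3|
    <= osc_const * L%:R ^+ 2 * (L%:R * ep) * (ep / zeta) ^+ 3.
Proof.
move=> L0 ep1 zL epz Zz zZ.
have LR : 0 < L%:R :> R by rewrite ltr0n.
have z0 : 0 < zeta by lra.
have Z0 : 0 < `|Z2| by lra.
have zL1 : zeta <= L%:R.
  apply: le_trans zL; rewrite exprS -[leLHS]mulr1 ler_pM2l // exprn_ege1 //; lra.
set X := L%:R * (ep / zeta) ^+ 3.
have X1 : 1 <= X.
  rewrite /X expr_div_n mulrA ler_pdivlMr ?exprn_gt0 // mul1r.
  apply: le_trans zL _; rewrite ler_peMr ?(ltW LR) // exprn_ege1 //.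
have e0 : 0 < L%:R * ep by rewrite mulr_gt0 //; lra.
have inner c : `|\sum_(i < (10 * L).+1) weight (node R L i / L%:R) *
     lam (L%:R * ep) (c + node R L i * Z2)| <=
     osc_in * (L%:R * ep) * X.
  apply: le_trans (lam_line_sum _ _ _ _ _) _ => //.
  - apply: le_trans Zz _; apply: le_trans zL1 _; rewrite ler_peMr //; lra.
  - by rewrite ler_pM2l //; lra.
  have -> : 918 * (L%:R * ep / (L%:R * `|Z2|)) ^+ 2 * ((L%:R * ep) ^+ 2 / `|Z2|) =
     918 * (L%:R * ep) * (L%:R * (ep / `|Z2|) ^+ 3).
    by field; rewrite !lt0r_neq0.
  have h : L%:R * (ep / `|Z2|) ^+ 3 <= 20 ^+ 3 * X.
    rewrite /X [leRHS]mulrCA ler_pM2l // -exprMn lerXn2r ?nnegrE //.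
    - by rewrite divr_ge0 //; lra.
    - by rewrite mulr_ge0 // divr_ge0 //; lra.
    - rewrite ler_pdivrMr //.
      have -> : 20 * (ep / zeta) * `|Z2| = ep * (20 * `|Z2| / zeta) by ring.
      by rewrite -[leLHS]mulr1 ler_pM2l ?ler_pdivlMr ?mul1r //; lra.
  by rewrite /osc_in -lock; apply: scaled_bound => //; exact: ltW.
rewrite /lam_plane_sum exchange_big /=.
apply: le_trans (ler_norm_sum _ _ _) _.
apply: (@le_trans _ _ (\sum_(b < (10 * L).+1) weight (node R L b / L%:R) *
   (osc_in * (L%:R * ep) * X))).
  apply: ler_sum => b _.
  have -> : \sum_(a < (10 * L).+1) weight (node R L a / L%:R) *
     weight (node R L b / L%:R) *
     lam (L%:R * ep) (L%:R * Z1 + node R L a * Z2 + node R L b * Z3) =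
     weight (node R L b / L%:R) * \sum_(a < (10 * L).+1) weight (node R L a / L%:R) *
     lam (L%:R * ep) ((L%:R * Z1 + node R L b * Z3) + node R L a * Z2).
    rewrite mulr_sumr; apply: eq_bigr => a _.
    by rewrite mulrA (mulrC (weight _)) addrAC.
  by rewrite normrM (ger0_norm (weight_ge0 _)) ler_wpM2l ?weight_ge0.
rewrite -mulr_suml.
apply: (@le_trans _ _ (wtot * osc_in * L%:R ^+ 2 * (L%:R * ep) * (ep / zeta) ^+ 3)).
  have -> : wtot * osc_in * L%:R ^+ 2 * (L%:R * ep) * (ep / zeta) ^+ 3 =
    wtot * L%:R * (osc_in * (L%:R * ep) * X) by rewrite /X; ring.
  rewrite ler_wpM2r ?weight_sum_le // mulr_ge0 //; last by lra.
  by rewrite mulr_ge0 ?(ltW osc_in_gt0) // ltW.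
have W0 := wtot_gt0.
have r0 : 0 <= (ep / zeta) ^+ 3 by rewrite exprn_ge0 // divr_ge0 ?(ltW z0) //; lra.
apply: (ler_wpM2r r0).
rewrite ler_wpM2r ?(ltW e0) // ler_wpM2r ?sqr_ge0 //.
by rewrite /osc_const ler_pM2l // lerDr mulr_ge0 // ltW.
Qed.

(** If neither [Z2] nor [Z3] reaches zeta/20, then [Z1] carries the maximum. Slopes are at most 5 in
    modulus, so every form is at least L zeta / 2 > 10 L ep, outside the support of [lam], and the
    sum vanishes. *)
Lemma lam_plane_sum_decay L ep Z1 Z2 Z3 zeta : (0 < L)%N -> 1 <= ep -> zeta ^+ 3 <= L%:R ->
  20 * ep < zeta -> `|Z2| <= zeta -> `|Z3| <= zeta ->
  [\/ zeta = `|Z1|, zeta = `|Z2| | zeta = `|Z3|] ->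
  `|lam_plane_sum L (L%:R * ep) Z1 Z2 Z3|
    <= osc_const * L%:R ^+ 2 * (L%:R * ep) * (ep / zeta) ^+ 3.
Proof.
move=> L0 ep1 zL epz Z2z Z3z hz.
case: (lerP zeta (20 * `|Z2|)) => h2; first exact: lam_plane_sum_dominant.
case: (lerP zeta (20 * `|Z3|)) => h3; first by rewrite lam_plane_sumC; exact: lam_plane_sum_dominant.
have LR : 0 < L%:R :> R by rewrite ltr0n.
have Z1z : zeta = `|Z1|.
  by have := normr_ge0 Z2; have := normr_ge0 Z3; case: hz => //; lra.
rewrite /lam_plane_sum big1 ?normr0; last first.
  move=> a _; apply: big1 => b _; rewrite lam_eq0 ?mulr0 //; first by rewrite mulr_ge0 //; lra.
  have ha := node_bound R a; have hb := node_bound R b.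
  have k2 : `|node R L a * Z2| <= 5 * L%:R * `|Z2| by rewrite normrM ler_wpM2r.
  have k3 : `|node R L b * Z3| <= 5 * L%:R * `|Z3| by rewrite normrM ler_wpM2r.
  have := lerB_normD (L%:R * Z1 + node R L a * Z2) (node R L b * Z3).
  have := lerB_normD (L%:R * Z1) (node R L a * Z2).
  rewrite normrM (gtr0_norm LR) -Z1z.
  have p1 : L%:R * (20 * ep) <= L%:R * zeta by rewrite ler_pM2l // ltW.
  have p2 : L%:R * (20 * `|Z2|) <= L%:R * zeta by rewrite ler_pM2l // ltW.
  have p3 : L%:R * (20 * `|Z3|) <= L%:R * zeta by rewrite ler_pM2l // ltW.
  have p4 : 0 <= L%:R * ep by rewrite mulr_ge0 //; lra.
  lra.
apply: mulr_ge0; last by rewrite exprn_ge0 // divr_ge0 //; lra.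
apply: mulr_ge0; last by rewrite mulr_ge0 //; lra.
by rewrite mulr_ge0 ?osc_const_ge0 ?sqr_ge0.
Qed.

Lemma dyadic_shell (y : R) (J : nat) : 20 < y -> y <= 20 * 2 ^+ J ->
  exists2 j : nat, (j <= J)%N & y <= 20 * 2 ^+ j /\ (1 / y) ^+ 3 <= (1 / 8) ^+ j.
Proof.
move=> y20; elim: J => [|J IH] hJ; first by move: hJ; rewrite expr0; lra.
case: (lerP y (20 * 2 ^+ J)) => h.
  by have [j jJ ?] := IH h; exists j => //; exact: leqW.
exists J.+1 => //; split => //.
have : (1 / y) <= 1 / 2 ^+ J.+1.
  rewrite !mul1r lef_pV2 ?posrE ?exprn_gt0 //; last by lra.
  rewrite exprS; have : 0 < 2 ^+ J :> R by rewrite exprn_gt0. 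
  move=> h2; lra.
move=> k.
have -> : (1 / 8) ^+ J.+1 = (1 / 2 ^+ J.+1) ^+ 3 :> R.
  have -> : 1 / 8 = (1 / 2) ^+ 3 :> R by field.
  by rewrite -exprM mulnC exprM expr_div_n expr1n.
have y0 : 0 <= 1 / y by rewrite divr_ge0 //; lra.
have p0 : 0 <= 1 / 2 ^+ J.+1 :> R by rewrite divr_ge0 // exprn_ge0.
by rewrite lerXn2r // nnegrE.
Qed.

(** The decay (ep/zeta)^3 is rewritten as indicators of balls of radius 20 * 2^j * ep with
    coefficients 8^-j, the form to which a bound on masses of balls applies. *)
Lemma lam_plane_sum_shells L ep Z1 Z2 Z3 zeta (J : nat) : (0 < L)%N -> 1 <= ep ->
  zeta ^+ 3 <= L%:R -> zeta <= 20 * (2 ^+ J * ep) ->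
  `|Z1| <= zeta -> `|Z2| <= zeta -> `|Z3| <= zeta ->
  [\/ zeta = `|Z1|, zeta = `|Z2| | zeta = `|Z3|] ->
  `|lam_plane_sum L (L%:R * ep) Z1 Z2 Z3|
    <= osc_const * L%:R ^+ 2 * (L%:R * ep) *
       \sum_(j < J.+1) (1 / 8) ^+ j * (zeta <= 20 * (2 ^+ j * ep))%R%:R.
Proof.
move=> L0 ep1 zL zJ Z1z Z2z Z3z hz.
have LR : 0 < L%:R :> R by rewrite ltr0n.
have ep0 : 0 < ep by lra.
have e0 : 0 <= L%:R * ep by rewrite mulr_ge0 ?ltW.
have c0 : 0 <= osc_const * L%:R ^+ 2 * (L%:R * ep).
  by rewrite mulr_ge0 // mulr_ge0 ?osc_const_ge0 ?sqr_ge0.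
have term0 (i : 'I_J.+1) : 0 <= (1 / 8) ^+ i * (zeta <= 20 * (2 ^+ i * ep))%R%:R :> R.
  by rewrite mulr_ge0 // exprn_ge0 // divr_ge0.
case: (lerP zeta (20 * ep)) => hs.
  apply: le_trans (lam_plane_sum_trivial _ _ _ L0 e0) _.
  have hs0 : zeta <= 20 * (2 ^+ 0 * ep) by rewrite expr0 mul1r.
  rewrite big_ord_recl hs0 expr0 mul1r.
  rewrite mulrDr mulr1 -[leLHS]addr0 lerD //; last first.
    by rewrite mulr_ge0 // sumr_ge0 // => i _; rewrite mulr_ge0 // exprn_ge0 // divr_ge0.
  have W0 := wtot_gt0.
  have -> : wtot ^+ 2 * L%:R ^+ 2 * (2 * (L%:R * ep)) =
     wtot * (2 * wtot) * L%:R ^+ 2 * (L%:R * ep) by ring.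
  apply: (ler_wpM2r e0); apply: (ler_wpM2r (sqr_ge0 _)).
  exact: (ler_wpM2l (ltW W0) (ltW (ltr_pwDr osc_in_gt0 (lexx _)))).
apply: le_trans (lam_plane_sum_decay _ _ _ _ _ _ hz) _ => //.
apply: ler_wpM2l => //.
have y20 : 20 < zeta / ep by rewrite ltr_pdivlMr.
have [j jJ []] := @dyadic_shell (zeta / ep) J y20 ltac:(rewrite ler_pdivrMr //; lra).
rewrite ler_pdivrMr // => h1 h2.
rewrite (bigD1 (Ordinal (jJ : (j < J.+1)%N))) //= mulrA h1 mulr1.
rewrite -[leLHS]addr0 lerD //; last by apply: sumr_ge0.
by move: h2; rewrite mul1r invf_div.
Qed.

End Oscillation2.

(** * Haar coefficients on the integers *)

Section HaarEnergy.
Variable R : archiRealFieldType.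

Definition box (e v t : nat) : R := ((t <= v) && (v < t + e))%N%:R.
(** The Haar function of [t, t + 2e) at [v], provided e <= v: the subtraction is truncated. Hence
    the lower bounds on [v] in [haar_corr] and the large offset in [vcode]. *)
Definition haar (e v t : nat) : R := box e v t - box e (v - e) t.

Lemma sum_nat_interval (T lo hi : nat) : (hi <= T)%N ->
  \sum_(t < T) ((lo <= t) && (t < hi))%N%:R = (hi - lo)%N%:R :> R.
Proof.
elim: T hi => [|T IH] hi hT.
  by rewrite big_ord0; move: hT; rewrite leqn0 => /eqP ->.
rewrite big_ord_recr /=; case: (ltnP T hi) => h.
  have -> : hi = T.+1 by lia.
  case: (leqP lo T) => hl.
    rewrite subSn // -natr1 -(IH T) //; congr (_ + _).
    by apply: eq_bigr => i _; rewrite !ltn_ord (ltn_trans (ltn_ord i)).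
  rewrite addr0 big1; first by have -> : (T.+1 - lo = 0)%N by lia.
  move=> i _; have -> // : (lo <= i)%N = false by apply/negbTE; have := ltn_ord i; lia.
by rewrite IH // andbF addr0.
Qed.

Lemma box_corr (T e v v' : nat) : (v < T)%N -> (v' < T)%N -> (e <= v)%N -> (e <= v')%N ->
  \sum_(t < T) box e v t * box e v' t = tri e%:R (v%:R - v'%:R) :> R.
Proof.
wlog le : v v' / (v <= v')%N.
  move=> H vT vT' ev ev'; case/orP: (leq_total v v') => h; first exact: H.
  rewrite -(opprB v'%:R) triN -H //.
  by apply: eq_bigr => t _; rewrite mulrC.
move=> vT vT' ev ev'.
transitivity (\sum_(t < T) (((v'.+1 - e)%N <= t) && (t < v.+1))%N%:R : R).
  apply: eq_bigr => t _; rewrite /box -natrM mulnb; congr (nat_of_bool _)%:R.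
  by apply/idP/idP; lia.
rewrite sum_nat_interval // /tri distrC ger0_norm ?subr_ge0 ?ler_nat //.
case: (leqP (v' - v) e) => h.
  rewrite max_r; last by rewrite subr_ge0 -natrB // ler_nat.
  by rewrite -!natrB //; congr (_%:R); lia.
rewrite max_l; last by rewrite subr_le0 -natrB // ler_nat ltnW.
by have -> : (v.+1 - (v'.+1 - e) = 0)%N by lia.
Qed.

(** Summed over all positions [t], the product depends only on [v - v']; for values of a linear form
    this is the form at the difference of two points. *)
Lemma haar_corr (T e v v' : nat) : (v < T)%N -> (v' < T)%N ->
  (2 * e <= v)%N -> (2 * e <= v')%N ->
  \sum_(t < T) haar e v t * haar e v' t = lam e%:R (v%:R - v'%:R) :> R.
Proof.
move=> vT vT' ev ev'.
have -> : \sum_(t < T) haar e v t * haar e v' t =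
  \sum_(t < T) box e v t * box e v' t + \sum_(t < T) box e (v - e) t * box e (v' - e) t
  - \sum_(t < T) box e (v - e) t * box e v' t - \sum_(t < T) box e v t * box e (v' - e) t.
  by rewrite -big_split -!sumrB; apply: eq_bigr => t _; rewrite /haar /=; ring.
rewrite !box_corr ?natrB; try lia.
rewrite /lam.
have -> : v%:R - e%:R - (v'%:R - e%:R) = v%:R - v'%:R :> R by ring.
have -> : v%:R - e%:R - v'%:R = v%:R - v'%:R - e%:R :> R by ring.
have -> : v%:R - (v'%:R - e%:R) = v%:R - v'%:R + e%:R :> R by ring.
ring.
Qed.

Lemma sum_block (m p : nat) (F : nat -> R) :
  \sum_(q < m) \sum_(s < p) F (q * p + s)%N = \sum_(t < m * p) F t.
Proof.
elim: m => [|m IH]; first by rewrite mul0n !big_ord0.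
rewrite big_ord_recr /= IH mulSn addnC big_split_ord /=; congr (_ + _).
Qed.

Lemma sum_reindex_le (Q k n : nat) (G : nat -> R) : (Q + k <= n)%N ->
  (forall q, 0 <= G q) -> \sum_(q < Q) G (q + k)%N <= \sum_(q < n) G q.
Proof.
move=> le G0; rewrite -(big_mkord predT (fun q => G (q + k)%N)) -(big_mkord predT G).
rewrite -[in leLHS](addnK k Q) -(big_addn 0 (Q + k)%N k predT G) add0n.
rewrite [leRHS](big_cat_nat (n := k)) //=; last by lia.
rewrite [X in _ <= _ + X](big_cat_nat (n := (Q + k)%N)) //=; last by lia.
by rewrite addrCA -[leLHS]addr0 lerD // addr_ge0 // sumr_ge0.
Qed.

(* Averaging over the offset tau replaces the points of a grid of step p by all integers. *)
Lemma sum_shifted_blocks (m p Q : nat) (F : nat -> R) : (forall t, 0 <= F t) ->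
  \sum_(tau < m * p) \sum_(q < Q) F (q * p + tau)%N
    <= m%:R * \sum_(t < (Q + m) * p) F t.
Proof.
move=> F0.
rewrite -(sum_block m p (fun tau => \sum_(q < Q) F (q * p + tau)%N)).
rewrite mulr_natl -[X in _ *+ X](card_ord m) -sumr_const.
apply: ler_sum => k _; rewrite exchange_big /= -sum_block.
have kmQ : (Q + k <= Q + m)%N by rewrite leq_add2l ltnW.
have G0 q : 0 <= \sum_(s < p) F (q * p + s)%N by apply: sumr_ge0.
apply: le_trans (sum_reindex_le kmQ G0).
apply: ler_sum => q _; apply: ler_sum => s _.
by rewrite addnA mulnDl.
Qed.

End HaarEnergy.

(** * Weighted points of Z^3 against a family of planes *)

Lemma le_of_eq (R : numDomainType) (x y : R) : x = y -> x <= y.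
Proof. by move=> ->. Qed.

Lemma geometric_tail_le (R : archiRealFieldType) (x : R) (m n : nat) : 0 <= x -> x < 1 ->
  \sum_(m <= k < n) x ^+ k <= x ^+ m / (1 - x).
Proof.
move=> x0 x1.
have y0 : 0 < 1 - x by rewrite subr_gt0.
rewrite ler_pdivlMr // mulrC.
case: (leqP m n) => mn; last by rewrite big_geq ?mulr0 ?exprn_ge0 // ltnW.
suff -> : (1 - x) * (\sum_(m <= k < n) x ^+ k) = - x ^+ n + x ^+ m.
  by rewrite gerDr oppr_le0 exprn_ge0.
rewrite mulr_sumr -[x ^+ m]opprK -(telescope_sumr (fun k => - x ^+ k) mn).
by apply: eq_bigr => k _; rewrite exprS; ring.
Qed.

(** [2 ^+ n * m n q] is a density. A child differs from its parent by 2^n times the difference of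
    the two sibling masses, and these jumps are added from level [N] up to the ancestor at level
    [n1]. *)
Lemma cell_density_descent (R : archiRealFieldType) (m : nat -> nat -> R) (n1 N : nat)
    (chi T : R) : (n1 <= N)%N ->
  (forall n q, (n < N)%N -> m n q = m n.+1 (2 * q)%N + m n.+1 (2 * q).+1) ->
  (forall n q, (n1 <= n < N)%N -> (q < 64 * 2 ^ n)%N ->
     2 ^+ n * `|m n.+1 (2 * q)%N - m n.+1 (2 * q).+1| <= chi ^+ n * T) ->
  forall q, (q < 64 * 2 ^ N)%N ->
  `|2 ^+ N * m N q - 2 ^+ n1 * m n1 (q %/ 2 ^ (N - n1))%N| <=
    (\sum_(n1 <= n < N) chi ^+ n) * T.
Proof.
move=> nN; have [k kE] : exists k, (N - n1 = k)%N by exists (N - n1)%N.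
elim: k N nN kE => [|k IH] N nN kE mS mD q qN.
  have -> : N = n1 by lia.
  by rewrite subnn expn0 divn1 subrr normr0 big_geq // mul0r.
case: N nN kE mS mD qN => [|N] nN kE mS mD qN; first by lia.
have nN' : (n1 <= N)%N by lia.
have q2 : (q %/ 2 < 64 * 2 ^ N)%N by rewrite ltn_divLR // -mulnA -expnSr.
have := IH N nN' ltac:(lia) (fun n q h => mS n q (ltnW h))
  (fun n q h => mD n q ltac:(lia)) (q %/ 2)%N q2.
have e : (q %/ 2 %/ 2 ^ (N - n1) = q %/ 2 ^ (N.+1 - n1))%N.
  by rewrite -divnMA -expnS; congr (_ %/ 2 ^ _)%N; lia.
rewrite e big_nat_recr //= mulrDl => h.
have h2 : `|2 ^+ N.+1 * m N.+1 q - 2 ^+ N * m N (q %/ 2)%N| <= chi ^+ N * T.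
  apply: le_trans (mD N (q %/ 2)%N ltac:(lia) q2).
  rewrite (mS N _ (ltnSn N)) exprS.
  rewrite -[X in _ <= X * _](gtr0_norm (_ : 0 < 2 ^+ N)) ?exprn_gt0 // -normrM.
  have := divn_eq q 2; rewrite modn2 mulnC; case: (odd q) => /= qE.
    rewrite [in m N.+1 q]qE addn1 -normrN; apply: le_of_eq; congr `|_|; ring.
  by rewrite [in m N.+1 q]qE addn0; apply: le_of_eq; congr `|_|; ring.
rewrite [leRHS]addrC; apply: le_trans (lerD h2 h).
by apply: le_trans (ler_normD _ _); rewrite addrA subrK.
Qed.

Lemma pos_of_close (R : realFieldType) (w z p : R) :
  `|w - z| <= p / 4 -> `|p - z| <= p / 4 -> 0 < p -> 0 < w.
Proof. by rewrite !ler_norml => /andP[? ?] /andP[? ?] ?; lra. Qed.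

Lemma summands_lt (R : realFieldType) (x y z p : R) :
  0 < x -> 0 <= y -> 0 <= z -> x + y + z < p -> [/\ x < p, y < p & z < p].
Proof. by move=> *; split; lra. Qed.

Section Core.
Variables (R : archiRealFieldType) (I : finType) (mu : I -> R) (X1 X2 X3 : I -> int).
Variables (chi : R) (Cb : nat -> R) (N : nat).
Hypotheses (chi_ge : 9 / 10 <= chi) (chi_lt1 : chi < 1).
Hypothesis mu_ge0 : forall i, 0 <= mu i.
Hypothesis Xb : forall i,
  [/\ (`|X1 i| <= 2 ^ N)%N, (`|X2 i| <= 2 ^ N)%N & (`|X3 i| <= 2 ^ N)%N].
(* The Frostman condition with exponent s, where 2^-s = chi^3 / 4 < 1 / 4, at scales 2^h <= 2^N. *)
Hypothesis ball : forall (r h : nat) (c1 c2 c3 : R), (h <= N)%N ->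
  \sum_(i | [&& `|(X1 i)%:~R - c1| <= r%:R * 2 ^+ h, `|(X2 i)%:~R - c2| <= r%:R * 2 ^+ h
      & `|(X3 i)%:~R - c3| <= r%:R * 2 ^+ h]) mu i <= Cb r * (chi ^+ 3 / 4) ^+ (N - h).

(** [L] = 2^(3N+4) exceeds the cube of the largest gap 2 * 2^N and is at least 16. Forms have size
    at most 11 * 2^H, so adding [off] = 32 * 2^H keeps codes above 2^H. *)
Local Notation l := (3 * N + 4)%N.
Local Notation H := (N + l)%N.
Local Notation L := (2 ^ l)%N.
Local Notation off := (2 ^ (5 + H))%N.
Local Notation bet := (chi ^+ 3 / 4).

Let x1 i : R := (X1 i)%:~R.
Let x2 i : R := (X2 i)%:~R.
Let x3 i : R := (X3 i)%:~R.

Definition form (a b : nat) i : R := L%:R * x1 i + node R L a * x2 i + node R L b * x3 i.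

(* The value of [form a b], shifted by [off] to be a natural number. *)
Definition vcode (a b : nat) (i : I) : nat :=
  absz (L%:Z * X1 i + (a%:Z - 5 * L%:Z) * X2 i + (b%:Z - 5 * L%:Z) * X3 i + off%:Z)%R.

Lemma int_abs_le (z : int) : (`|z| <= 2 ^ N)%N -> `|z%:~R| <= 2 ^+ N :> R.
Proof. by move=> h; rewrite -intr_norm -abszE -pmulrn -natrX ler_nat. Qed.

Lemma x1_le i : `|x1 i| <= 2 ^+ N. Proof. by case: (Xb i) => h _ _; exact: int_abs_le. Qed.
Lemma x2_le i : `|x2 i| <= 2 ^+ N. Proof. by case: (Xb i) => _ h _; exact: int_abs_le. Qed.
Lemma x3_le i : `|x3 i| <= 2 ^+ N. Proof. by case: (Xb i) => _ _ h; exact: int_abs_le. Qed.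

Lemma L_gt0 : 0 < L%:R :> R. Proof. by rewrite ltr0n expn_gt0. Qed.
Lemma pow2_gt0 n : 0 < 2 ^+ n :> R. Proof. by rewrite exprn_gt0. Qed.

Lemma pow2H : L%:R * 2 ^+ N = 2 ^+ H :> R.
Proof. by rewrite natrX -exprD addnC. Qed.

Lemma offE : off%:R = 32 * 2 ^+ H :> R.
Proof. by rewrite natrX [LHS]exprD; congr (_ * _); ring. Qed.

Lemma form_le (a b : 'I_(10 * L).+1) i : `|form a b i| <= 11 * 2 ^+ H.
Proof.
have L0 := L_gt0.
have ha := node_bound R a; have hb := node_bound R b.
have k1 : `|L%:R * x1 i| <= L%:R * 2 ^+ N by rewrite normrM gtr0_norm // ler_pM2l // x1_le.
have k2 : `|node R L a * x2 i| <= 5 * L%:R * 2 ^+ N by rewrite normrM ler_pM // x2_le.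
have k3 : `|node R L b * x3 i| <= 5 * L%:R * 2 ^+ N by rewrite normrM ler_pM // x3_le.
rewrite /form; apply: le_trans (ler_normD _ _) _; apply: le_trans (lerD (ler_normD _ _) (lexx _)) _.
rewrite -pow2H; lra.
Qed.

Lemma vcodeE (a b : 'I_(10 * L).+1) i : (vcode a b i)%:R = form a b i + off%:R :> R.
Proof.
have E : form a b i + off%:R = (L%:Z * X1 i + (a%:Z - 5 * L%:Z) * X2 i +
   (b%:Z - 5 * L%:Z) * X3 i + off%:Z)%:~R.
  by rewrite !(intrD, intrM, intrN, rmorphB) /= -!pmulrn.
have : 0 <= form a b i + off%:R.
  have := form_le a b i; rewrite ler_norml offE => /andP[h _].
  have := pow2_gt0 H; lra.
by rewrite E ler0z => h; rewrite [LHS]pmulrn /vcode gez0_abs.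
Qed.

Lemma vcode_bounds (a b : 'I_(10 * L).+1) i :
  (2 ^ H <= vcode a b i)%N /\ (vcode a b i < 65 * 2 ^ H)%N.
Proof.
have p := pow2_gt0 H; have h := form_le a b i; rewrite ler_norml in h.
split.
  by rewrite -(ler_nat R) vcodeE offE natrX; lra.
by rewrite -(ltr_nat R) vcodeE offE natrM natrX; lra.
Qed.

Definition wt (a : nat) : R := weight (node R L a / L%:R).

Lemma wt_ge0 a : 0 <= wt a. Proof. exact: weight_ge0. Qed.

Definition cellmass (a b e tau q : nat) : R :=
  \sum_i mu i * ((q * e + tau <= vcode a b i) && (vcode a b i < (q.+1) * e + tau))%N%:R.

Lemma cellmass_split a b e tau q : cellmass a b (2 * e) tau q =
  cellmass a b e tau (2 * q) + cellmass a b e tau (2 * q).+1.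
Proof.
rewrite -big_split /=; apply: eq_bigr => i _; rewrite -mulrDr -natrD; congr (_ * _%:R).
move: (vcode a b i) => v; case: (leqP (q * (2 * e) + tau) v) => h1;
case: (ltnP v (q.+1 * (2 * e) + tau)) => h2; case: (ltnP v ((2 * q).+1 * e + tau)) => h3;
rewrite ?andbT ?andbF /=; lia.
Qed.

Lemma cellmass_haar (a b : 'I_(10 * L).+1) e tau q : (2 * e <= 2 ^ H)%N ->
  cellmass a b e tau (2 * q) - cellmass a b e tau (2 * q).+1 =
  \sum_i mu i * haar R e (vcode a b i) (q * (2 * e) + tau).
Proof.
move=> eH; rewrite -sumrB; apply: eq_bigr => i _; rewrite -mulrBr; congr (_ * _).
have [h _] := vcode_bounds a b i.
move: (vcode a b i) h eH => v h eH; rewrite /haar /box; congr (_%:R - _%:R); congr nat_of_bool; apply/idP/idP.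
all: by move=> *; lia.
Qed.

(** * Haar energy of the image measure *)

Definition gap i j : R :=
  Num.max `|x1 i - x1 j| (Num.max `|x2 i - x2 j| `|x3 i - x3 j|).

(** Over all offsets [tau] < 2^H = 2^n * 2e, each position is visited at most 2^n times. Once the
    sum runs over all positions, expanding the square gives correlations of Haar functions, hence
    pair interactions [lam]. *)
Lemma energy_le_osc n e : (n < N)%N -> e = (2 ^ (H - n.+1))%N ->
  \sum_(a < (10 * L).+1) \sum_(b < (10 * L).+1) wt a * wt b *
    (\sum_(tau < 2 ^ H) \sum_(q < 64 * 2 ^ n)
       (cellmass a b e tau (2 * q) - cellmass a b e tau (2 * q).+1) ^+ 2)
  <= 2 ^+ n * \sum_i \sum_j mu i * mu j *
       lam_plane_sum L e%:R (x1 i - x1 j) (x2 i - x2 j) (x3 i - x3 j).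
Proof.
move=> nN ee.
have e2 : (2 * e = 2 ^ (H - n))%N by rewrite ee -expnS; congr (2 ^ _)%N; lia.
have eH : (2 ^ H = 2 ^ n * (2 * e))%N by rewrite e2 -expnD; congr (2 ^ _)%N; lia.
have eH' : (2 * e <= 2 ^ H)%N by rewrite eH leq_pmull // expn_gt0.
set T := (65 * 2 ^ H)%N.
apply: (@le_trans _ _ (\sum_(a < (10 * L).+1) \sum_(b < (10 * L).+1) wt a * wt b *
    (2 ^+ n * \sum_(t < T) (\sum_i mu i * haar R e (vcode a b i) t) ^+ 2))).
  apply: ler_sum => a _; apply: ler_sum => b _.
  apply: (ler_wpM2l (mulr_ge0 (wt_ge0 a) (wt_ge0 b))).
  have := @sum_shifted_blocks R (2 ^ n) (2 * e) (64 * 2 ^ n)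
    (fun t => (\sum_i mu i * haar R e (vcode a b i) t) ^+ 2) (fun t => sqr_ge0 _).
  rewrite -eH natrX (_ : ((64 * 2 ^ n + 2 ^ n) * (2 * e) = T)%N); last first.
    by rewrite /T eH; lia.
  apply: le_trans; apply: ler_sum => tau _; apply: ler_sum => q _.
  by rewrite cellmass_haar.
apply: le_of_eq.
under eq_bigr => a _ do under eq_bigr => b _ do rewrite mulrCA.
under eq_bigr => a _ do rewrite -mulr_sumr.
rewrite -mulr_sumr; congr (_ * _).
have sq (a b : 'I_(10 * L).+1) : \sum_(t < T) (\sum_i mu i * haar R e (vcode a b i) t) ^+ 2
   = \sum_i \sum_j mu i * mu j * lam e%:R (L%:R * (x1 i - x1 j) +
       node R L a * (x2 i - x2 j) + node R L b * (x3 i - x3 j)).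
  under eq_bigr => t _ do rewrite expr2 mulr_suml.
  rewrite exchange_big /=; apply: eq_bigr => i _.
  under eq_bigr => t _ do rewrite mulr_sumr.
  rewrite exchange_big /=; apply: eq_bigr => j _.
  have [hi Hi] := vcode_bounds a b i; have [hj Hj] := vcode_bounds a b j.
  rewrite (_ : _ + _ = (vcode a b i)%:R - (vcode a b j)%:R); last first.
    by rewrite !vcodeE /form; ring.
  rewrite -(@haar_corr R T) //; try lia.
  by rewrite mulr_sumr; apply: eq_bigr => t _; ring.
under eq_bigr => a _ do under eq_bigr => b _ do rewrite sq mulr_sumr.
under eq_bigr => a _ do rewrite exchange_big /=.
rewrite exchange_big /=; apply: eq_bigr => i _.
under eq_bigr => a _ do under eq_bigr => b _ do rewrite mulr_sumr.
under eq_bigr => a _ do rewrite exchange_big /=.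
rewrite exchange_big /=; apply: eq_bigr => j _.
rewrite /lam_plane_sum mulr_sumr; apply: eq_bigr => a _.
by rewrite mulr_sumr; apply: eq_bigr => b _; rewrite mulrCA mulrA.
Qed.

Lemma bet_gt0 : 0 < bet.
Proof. by rewrite divr_gt0 // exprn_gt0 //; have := chi_ge; lra. Qed.

Lemma bet_le4 : bet <= 1 / 4.
Proof.
rewrite ler_pM2r ?invr_gt0 // -(expr1n _ 3) lerXn2r ?nnegrE //; last by have := chi_lt1; lra.
by have := chi_ge; lra.
Qed.

(** From chi >= 9/10: the decay 1/8 per shell beats the growth 1/[bet] of the mass of balls, with
    ratio 7/10. *)
Lemma eighth_le_bet : 1 / 8 <= 7 / 10 * bet.
Proof.
have h : (9 / 10) ^+ 3 <= chi ^+ 3.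
  rewrite lerXn2r ?nnegrE //; first by lra.
  by have := chi_ge; lra.
have e : (9 / 10) ^+ 3 = 729 / 1000 :> R by field.
rewrite e in h; lra.
Qed.

Lemma mass_le : \sum_i mu i <= Cb 1.
Proof.
have := @ball 1 N 0 0 0 (leqnn _); rewrite subnn expr0 mulr1; apply: le_trans.
rewrite [leRHS]big_mkcond /=; apply: ler_sum => i _.
by rewrite !subr0 !mul1r; have := x1_le i; have := x2_le i; have := x3_le i;
   rewrite /x1 /x2 /x3 => -> -> ->.
Qed.

Lemma Cb_ge0 r : 0 <= Cb r.
Proof.
have := @ball r N 0 0 0 (leqnn _); rewrite subnn expr0 mulr1; apply: le_trans.
exact: sumr_ge0.
Qed.

Lemma gap_le_mass i (r h : nat) : (h <= N)%N ->
  \sum_j mu j * (gap i j <= r%:R * 2 ^+ h)%R%:R <= Cb r * bet ^+ (N - h).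
Proof.
move=> hN; apply: le_trans (@ball r h (x1 i) (x2 i) (x3 i) hN).
rewrite [leRHS]big_mkcond; apply: ler_sum => j _ /=.
rewrite /gap !ge_max (distrC (x1 i)) (distrC (x2 i)) (distrC (x3 i)).
by case: ifP => _; rewrite ?mulr1 ?mulr0.
Qed.

Lemma gap_le i j : gap i j <= 2 * 2 ^+ N.
Proof.
have D (y : I -> R) : (forall i, `|y i| <= 2 ^+ N) -> `|y i - y j| <= 2 * 2 ^+ N.
  by move=> h; apply: le_trans (ler_normB _ _) _; have := h i; have := h j; lra.
by rewrite /gap !ge_max !D //; [exact: x3_le | exact: x2_le | exact: x1_le].
Qed.

(** Shell k contributes 8^-k bet^(n+1-k) <= (7/10)^k bet^(n+1), so near pairs dominate. The
    geometric sum is at most 4, and 4 * [bet] <= 1 turns bet^(n+1) into bet^n. *)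
Lemma shells_mass i n : (n < N)%N ->
  \sum_j mu j * (\sum_(k < n.+2) (1 / 8) ^+ k *
     (gap i j <= 20 * (2 ^+ k * 2 ^+ (N - n.+1)))%R%:R) <= Cb 20 * bet ^+ n.
Proof.
move=> nN; have b0 := bet_gt0; have b4 := bet_le4; have b8 := eighth_le_bet.
have C0 := Cb_ge0 20.
under eq_bigr => j _ do rewrite mulr_sumr.
rewrite exchange_big /=.
apply: (@le_trans _ _ (\sum_(k < n.+2) Cb 20 * bet ^+ n.+1 * (7 / 10) ^+ k)).
  apply: ler_sum => k _.
  have kn : (k <= n.+1)%N by rewrite -ltnS ltn_ord.
  have := @gap_le_mass i 20 (k + (N - n.+1)) ltac:(lia).
  have -> : (N - (k + (N - n.+1)) = n.+1 - k)%N by lia.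
  rewrite exprD => h.
  under eq_bigr => j _ do rewrite mulrCA.
  rewrite -mulr_sumr; apply: (@le_trans _ _ ((1 / 8) ^+ k * (Cb 20 * bet ^+ (n.+1 - k)))).
    by apply: ler_wpM2l h; rewrite exprn_ge0 // divr_ge0.
  rewrite mulrCA -[leRHS]mulrA; apply: (ler_wpM2l C0).
  have -> : bet ^+ n.+1 * (7 / 10) ^+ k = (7 / 10 * bet) ^+ k * bet ^+ (n.+1 - k).
    rewrite [X in _ = X * _](exprMn _ (7 / 10) bet) -[RHS]mulrA -[X in _ = _ * X](exprD bet).
    by rewrite subnKC // mulrC.
  apply: ler_wpM2r; first by rewrite exprn_ge0 // ltW.
  by rewrite lerXn2r // nnegrE; lra.
rewrite -mulr_sumr.
have g : \sum_(k < n.+2) (7 / 10) ^+ k <= 4 :> R.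
  rewrite -(big_mkord predT (fun k => (7 / 10 : R) ^+ k)).
  have h := @geometric_tail_le R (7 / 10) 0 n.+2 ltac:(lra) ltac:(lra).
  apply: le_trans h _; rewrite expr0 ler_pdivrMr; lra.
apply: (@le_trans _ _ (Cb 20 * bet ^+ n.+1 * 4)).
  by apply: ler_wpM2l g; rewrite mulr_ge0 // exprn_ge0 // ltW.
rewrite -mulrA; apply: (ler_wpM2l C0).
rewrite exprSr -mulrA -[leRHS]mulr1; apply: ler_wpM2l; last by lra.
by rewrite exprn_ge0 // ltW.
Qed.

Definition energy_const : R := osc_const R * Cb 20 * Cb 1.

Lemma energy_const_ge0 : 0 <= energy_const.
Proof. exact: mulr_ge0 (mulr_ge0 (osc_const_ge0 R) (Cb_ge0 20)) (Cb_ge0 1). Qed.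

Lemma energy_le n e : (n < N)%N -> e = (2 ^ (H - n.+1))%N ->
  \sum_(a < (10 * L).+1) \sum_(b < (10 * L).+1) wt a * wt b *
    (\sum_(tau < 2 ^ H) \sum_(q < 64 * 2 ^ n)
       (cellmass a b e tau (2 * q) - cellmass a b e tau (2 * q).+1) ^+ 2)
  <= energy_const * L%:R ^+ 2 * 2 ^+ H * bet ^+ n.
Proof.
move=> nN ee; apply: le_trans (energy_le_osc nN ee) _.
pose ep : R := 2 ^+ (N - n.+1).
have eE : e%:R = L%:R * ep.
  by rewrite ee !natrX -exprD; congr (_ ^+ _); lia.
have ep1 : 1 <= ep by rewrite exprn_ege1 // ler1n.
have b0 := bet_gt0.
have c0 : 0 <= osc_const R * L%:R ^+ 2 * (L%:R * ep).
  apply: mulr_ge0 (mulr_ge0 (osc_const_ge0 R) (sqr_ge0 _)) _.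
  by rewrite mulr_ge0 // (le_trans _ ep1).
have gL i j : gap i j ^+ 3 <= L%:R.
  apply: (@le_trans _ _ ((2 * 2 ^+ N) ^+ 3)).
    by rewrite lerXn2r ?nnegrE ?gap_le // ?mulr_ge0 ?exprn_ge0 // /gap le_max normr_ge0.
  rewrite natrX exprMn -exprM -exprD ler_eXn2l ?ltr1n //; lia.
have gJ i j : gap i j <= 20 * (2 ^+ n.+1 * ep).
  rewrite -exprD; have -> : (n.+1 + (N - n.+1) = N)%N by lia.
  by have := gap_le i j; have := pow2_gt0 N; lra.
have osc i j : lam_plane_sum L e%:R (x1 i - x1 j) (x2 i - x2 j) (x3 i - x3 j) <=
   osc_const R * L%:R ^+ 2 * (L%:R * ep) *
   (\sum_(k < n.+2) (1 / 8) ^+ k * (gap i j <= 20 * (2 ^+ k * ep))%R%:R).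
  apply: le_trans (ler_norm _) _; rewrite eE.
  apply: lam_plane_sum_shells => //.
  - by rewrite expn_gt0.
  - by rewrite /gap le_max lexx.
  - by rewrite /gap !le_max lexx orbT.
  - by rewrite /gap !le_max lexx !orbT.
  - rewrite /gap; case: (leP `|x1 i - x1 j| _) => _; last by constructor 1.
    by case: (leP `|x2 i - x2 j| _) => _; [constructor 3 | constructor 2].
apply: (@le_trans _ _ (2 ^+ n * (\sum_i mu i * (osc_const R * L%:R ^+ 2 * (L%:R * ep) *
    (Cb 20 * bet ^+ n))))).
  apply: ler_wpM2l; first by rewrite exprn_ge0.
  apply: ler_sum => i _.
  under eq_bigr => j _ do rewrite -mulrA.
  rewrite -mulr_sumr; apply: (ler_wpM2l (mu_ge0 i)).
  apply: le_trans (ler_wpM2l c0 (shells_mass i nN)).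
  rewrite mulr_sumr; apply: ler_sum => j _.
  by rewrite [leRHS]mulrCA; apply: (ler_wpM2l (mu_ge0 j)).
rewrite -mulr_suml.
have K0 : 0 <= osc_const R * L%:R ^+ 2 * (L%:R * ep) * (Cb 20 * bet ^+ n).
  by apply: (mulr_ge0 c0); rewrite mulr_ge0 ?Cb_ge0 // exprn_ge0 // ltW.
apply: le_trans (ler_wpM2l _ (ler_wpM2r K0 mass_le)) _; first by rewrite exprn_ge0.
have Hn : 2 ^+ n * (L%:R * ep) <= 2 ^+ H.
  rewrite natrX -!exprD ler_eXn2l ?ltr1n //; lia.
have -> : 2 ^+ n * (Cb 1 * (osc_const R * L%:R ^+ 2 * (L%:R * ep) * (Cb 20 * bet ^+ n))) =
   energy_const * L%:R ^+ 2 * bet ^+ n * (2 ^+ n * (L%:R * ep)).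
  by rewrite /energy_const; ring.
have -> : energy_const * L%:R ^+ 2 * 2 ^+ H * bet ^+ n =
   energy_const * L%:R ^+ 2 * bet ^+ n * 2 ^+ H by ring.
apply: ler_wpM2l Hn.
apply: mulr_ge0 (mulr_ge0 energy_const_ge0 (sqr_ge0 _)) _.
by rewrite exprn_ge0 // ltW.
Qed.

(** * Mass of the slab around a plane, for points whose second coordinate dominates *)

Variable kap : R.
Hypotheses (kap_gt0 : 0 < kap) (kapX : forall i, kap * 2 ^+ N <= x2 i).
Hypothesis X2_ge8 : forall i, 8 <= x2 i.
Hypothesis X13 : forall i, `|x1 i| <= x2 i + 1 /\ `|x3 i| <= x2 i + 1.

(* The cell of the finest grid which contains the plane form = 0. *)
Definition mid (tau : nat) : nat := ((off - tau) %/ L)%N.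
Definition central (a b tau : nat) (i : I) : bool :=
  (mid tau * L + tau <= vcode a b i)%N && (vcode a b i < (mid tau).+1 * L + tau)%N.

Lemma mid_bounds tau : (tau < 2 ^ H)%N ->
  (mid tau * L + tau <= off)%N /\ (off < mid tau * L + L + tau)%N.
Proof.
move=> h; have t : (tau <= off)%N.
  by rewrite expnD; apply: leq_trans (ltnW h) _; rewrite leq_pmull.
have d := divn_eq (off - tau) L; have := ltn_pmod (off - tau) (_ : 0 < L)%N.
rewrite expn_gt0 => /(_ isT) m; rewrite /mid; lia.
Qed.

Lemma weight_ge (x : R) : `|x| <= 3 -> 49 <= weight x.
Proof.
rewrite ler_norml => /andP[h1 h2]; have h3 : x ^+ 2 <= 9 by nra.
rewrite /weight max_r; last by lra.
have -> : 49 = 7 ^+ 2 :> R by ring.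
by rewrite lerXn2r ?nnegrE //; lra.
Qed.

Lemma L_ge16 : 16 <= L%:R :> R.
Proof.
have -> : 16 = (2 ^ 4)%:R :> R by [].
by rewrite ler_nat leq_exp2l // leq_addl.
Qed.

Lemma x2_le_L i : 2 * x2 i <= L%:R.
Proof.
have := x2_le i; rewrite ler_norml => /andP[_ h].
have : 2 * 2 ^+ N <= L%:R :> R by rewrite -exprS natrX ler_eXn2l ?ltr1n //; lia.
lra.
Qed.

(** For fixed [b] the form is a progression in [a] of step [x2 i] <= L/2, and the central cell has
    length [L]: about L / x2 consecutive slopes hit it. As [x2] dominates and |B| <= 1/2, these
    slopes lie in [-3, 3], where the weight is at least 49. *)
Lemma central_hits (b : 'I_(10 * L).+1) i tau : (tau < 2 ^ H)%N ->
  `|node R L b| <= L%:R / 2 ->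
  L%:R / 2 ^+ N <= \sum_(a < (10 * L).+1) wt a * (central a b tau i)%:R.
Proof.
move=> ht hb; have [m1 m2] := mid_bounds ht.
have L0 := L_gt0; have L16 := L_ge16; have x8 := X2_ge8 i; have xL := x2_le_L i.
have x0 : 0 < x2 i by lra.
have [b1 b3] := X13 i.
(* Lower end of the central cell as a value of the form; [A0] below is the first node at which the
   form reaches it. *)
pose al : R := (mid tau * L + tau)%:R - off%:R.
have al1 : al <= 0 by rewrite subr_le0 ler_nat.
have al2 : - L%:R < al.
  by rewrite /al; move: m2; rewrite -(ltr_nat R) !natrD; lra.
pose c := L%:R * x1 i + node R L b * x3 i.
have c_le : `|c| <= L%:R * (x2 i + 1) + L%:R / 2 * (x2 i + 1).
  apply: le_trans (ler_normD _ _) _; rewrite !normrM (gtr0_norm L0).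
  by rewrite lerD // ler_pM // ltW.
pose A0 := Num.ceil ((al - c) / x2 i).
have := ceil_itv ((al - c) / x2 i); rewrite -/A0 rmorphB /= => /andP[].
rewrite ltr_pdivlMr // ler_pdivrMr // => A1 A2.
pose k := Num.trunc (L%:R / x2 i).
have /andP[] : k%:R <= L%:R / x2 i < k.+1%:R by apply: truncn_itv; rewrite divr_ge0 // ltW.
rewrite ler_pdivlMr // ltr_pdivrMr // -natr1 => k1 k2.
have cb : - (L%:R * (x2 i + 1) + L%:R / 2 * (x2 i + 1)) <= c <=
   L%:R * (x2 i + 1) + L%:R / 2 * (x2 i + 1) by rewrite -ler_norml.
case/andP: cb => c1 c2.
have A0lo : - 2 * L%:R - 1 <= A0%:~R :> R.
  rewrite -(ler_pM2r x0); nra.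
have A0hi : A0%:~R + k%:R <= 3 * L%:R :> R.
  rewrite -(ler_pM2r x0); nra.
have A0nn : 0 <= A0 + (5 * L)%:Z by rewrite -(ler0z R) rmorphD /= -[(5 * L)%:Z%:~R]pmulrn natrM; lra.
pose a0 := absz (A0 + (5 * L)%:Z).
have a0E : a0%:R = A0%:~R + 5 * L%:R :> R.
  by rewrite /a0 pmulrn gez0_abs // rmorphD /= -[(5 * L)%:Z%:~R]pmulrn natrM.
have a0k : (a0 + k <= (10 * L).+1)%N.
  by rewrite -(ler_nat R) natrD a0E -[leRHS]natr1 natrM; lra.
apply: le_trans (@sum_ge_block R _ a0 k 49 (fun a => wt a * (central a b tau i)%:R) a0k _ _).
- have p := pow2_gt0 N; have := x2_le i; rewrite ler_norml => /andP[_ xN].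
  rewrite ler_pdivrMr //; nra.
- by move=> a; rewrite mulr_ge0 ?wt_ge0.
move=> a /andP[ha1 ha2].
have aL : (a < (10 * L).+1)%N by apply: leq_trans ha2 a0k.
have ha1' : a0%:R <= a%:R :> R by rewrite ler_nat.
have ha2' : a%:R + 1 <= a0%:R + k%:R :> R by rewrite natr1 -natrD ler_nat.
have nodeE : node R L a = a%:R - 5 * L%:R by [].
have n1 : A0%:~R <= node R L a by rewrite nodeE; lra.
have n2 : node R L a + 1 <= A0%:~R + k%:R by rewrite nodeE; lra.
have -> : central a b tau i.
  have := vcodeE (Ordinal aL) b i; rewrite /= => vE.
  have e2 : ((mid tau).+1 * L + tau)%:R = al + off%:R + L%:R :> R.
    by rewrite /al subrK mulSn -addnA addnC natrD.
  have e1 : (mid tau * L + tau)%:R = al + off%:R :> R by rewrite /al subrK.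
  have fE : form a b i = c + node R L a * x2 i by rewrite /form /c; ring.
  clear - vE e1 e2 fE n1 n2 A1 A2 k1 x0.
  apply/andP; split; [rewrite -(ler_nat R) | rewrite -(ltr_nat R)]; rewrite vE fE ?e1 ?e2.
    by rewrite lerD2r; nra.
  by rewrite [ltRHS]addrAC ltrD2r; nra.
rewrite mulr1; apply: weight_ge; rewrite normrM normfV (gtr0_norm L0) ler_pdivrMr //.
by rewrite ler_norml; apply/andP; split; lra.
Qed.

Lemma central_mass tau : (tau < 2 ^ H)%N ->
  (\sum_i mu i) * (L%:R ^+ 2 / 2 ^+ N) <=
  \sum_(a < (10 * L).+1) \sum_(b < (10 * L).+1) wt a * wt b *
     cellmass a b L tau (mid tau).
Proof.
move=> ht; have L0 := L_gt0.
have -> : \sum_(a < (10 * L).+1) \sum_(b < (10 * L).+1) wt a * wt b *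
     cellmass a b L tau (mid tau) =
   \sum_i mu i * \sum_(b < (10 * L).+1) wt b *
      \sum_(a < (10 * L).+1) wt a * (central a b tau i)%:R.
  transitivity (\sum_(a < (10 * L).+1) \sum_(b < (10 * L).+1) \sum_i
     mu i * (wt b * (wt a * (central a b tau i)%:R))).
    apply: eq_bigr => a _; apply: eq_bigr => b _; rewrite mulr_sumr; apply: eq_bigr => i _.
    by rewrite /central; ring.
  rewrite exchange_big; under eq_bigr => b _ do rewrite exchange_big.
  rewrite exchange_big; apply: eq_bigr => i _; rewrite mulr_sumr; apply: eq_bigr => b _.
  by rewrite mulr_sumr mulr_sumr.
rewrite mulr_suml; apply: ler_sum => i _; apply: (ler_wpM2l (mu_ge0 i)).
have l0 : (0 < l)%N by rewrite addnS.
have L2 : L = (2 ^ l.-1 * 2)%N by rewrite -expnSr prednK.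
(* As L = 2 * 2^(l-1), the block of [L] indices from 9 * 2^(l-1) on is centred at 5 L: its nodes
   have modulus at most L/2. *)
have blk : (9 * 2 ^ l.-1 + L <= (10 * L).+1)%N by rewrite L2; lia.
have bo (b : nat) : (9 * 2 ^ l.-1 <= b < 9 * 2 ^ l.-1 + L)%N -> (b < (10 * L).+1)%N.
  by move=> /andP[_ h]; exact: leq_trans h blk.
apply: le_trans (_ : L%:R * (L%:R / 2 ^+ N) <= _).
  by rewrite expr2 mulrA.
apply: le_trans (@sum_ge_block R _ _ L _ (fun b => wt b *
      \sum_(a < (10 * L).+1) wt a * (central a b tau i)%:R) blk _ _) => //.
- by move=> b; rewrite mulr_ge0 ?wt_ge0 // sumr_ge0 // => a _; rewrite mulr_ge0 ?wt_ge0.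
move=> b hb; have bL := bo b hb; case/andP: hb => hb1 hb2.
have nb : `|node R L (Ordinal bL)| <= L%:R / 2.
  move: hb1 hb2; rewrite /node /= -(ler_nat R) -(ltr_nat R) natrD natrM.
  have : L%:R = (2 ^ l.-1)%:R * 2 :> R by rewrite [in LHS]L2 natrM.
  move: (2 ^ l.-1)%:R => z zE *; rewrite ler_norml; apply/andP; split; lra.
have h := @central_hits (Ordinal bL) i tau ht nb.
rewrite -[leLHS]mul1r; apply: ler_pM => //; first by rewrite divr_ge0 ?exprn_ge0 ?ltW.
apply: le_trans (weight_ge _); first by lra.
rewrite normrM normfV (gtr0_norm L0) ler_pdivrMr //; move: nb => /=; lra.
Qed.

(* [om i j] and [eta i j] measure the distance from j to the line through 0 and i. *)
Definition om i j : R := x3 i * x2 j - x2 i * x3 j.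
Definition eta i j : R := x1 i * x2 j - x1 j * x2 i.

Lemma central_form (a b : 'I_(10 * L).+1) tau i : (tau < 2 ^ H)%N ->
  central a b tau i -> `|form a b i| <= L%:R.
Proof.
move=> ht; have [m1 m2] := mid_bounds ht; rewrite /central => /andP[].
rewrite (mulSn (mid tau)) => h1 h2.
have := vcodeE a b i; move: h1 h2 m1 m2; move: (vcode a b i) => v h1 h2 m1 m2 vE.
have k1 : (v <= off + L)%N by lia.
have k2 : (off <= v + L)%N by lia.
move: k1 k2; rewrite -!(ler_nat R) (natrD _ off L) (natrD _ v L) vE ler_norml => k1 k2.
by apply/andP; split; lra.
Qed.

(** * Pairs of points in one slab *)

Lemma pair_count (b : 'I_(10 * L).+1) i (tau : nat) : (tau < 2 ^ H)%N ->
  \sum_(a < (10 * L).+1) wt a * (central a b tau i)%:R <= 256 * (3 * L%:R / (kap * 2 ^+ N)).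
Proof.
move=> ht; have L0 := L_gt0; have x8 := X2_ge8 i; have xL := x2_le_L i.
have x0 : 0 < x2 i by lra.
apply: (@le_trans _ _ (\sum_(a < (10 * L).+1) 256 *
  (`|(L%:R * x1 i + node R L b * x3 i - 5 * L%:R * x2 i) + a%:R * x2 i| <= L%:R)%R%:R)).
  apply: ler_sum => a _; case: (boolP (central a b tau i)) => h; last first.
    by rewrite mulr0 mulr_ge0.
  have -> : (L%:R * x1 i + node R L b * x3 i - 5 * L%:R * x2 i) + a%:R * x2 i = form a b i.
    by rewrite /form /node; ring.
  by rewrite (central_form ht h) !mulr1 /wt weight_le.
rewrite -mulr_sumr; apply: ler_wpM2l => //.
apply: le_trans (count_progression_pos _ _ x0 (ltW L0)) _.
apply: (@le_trans _ _ (3 * L%:R / x2 i)).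
  rewrite -[X in _ + X](divff (lt0r_neq0 x0)) -mulrDl ler_pM2r ?invr_gt0 //; lra.
apply: ler_wpM2l; first by rewrite mulr_ge0 // ltW.
by rewrite lef_pV2 ?posrE ?kapX // mulr_gt0 // exprn_gt0.
Qed.

(** Eliminating [a] from the two forms, form i * x2 j - form j * x2 i = L * eta + node b * om. If
    both points are central, this is at most 2 L 2^N, a condition on [b] alone. *)
Definition bcount i j : R :=
  \sum_(b < (10 * L).+1) (`|L%:R * eta i j + node R L b * om i j| <= 2 * L%:R * 2 ^+ N)%R%:R.

Lemma pair_le i j tau : (tau < 2 ^ H)%N ->
  \sum_(a < (10 * L).+1) \sum_(b < (10 * L).+1) wt a * wt b *
     ((central a b tau i)%:R * (central a b tau j)%:R) <=
  256 * (256 * (3 * L%:R / (kap * 2 ^+ N))) * bcount i j.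
Proof.
move=> ht; have L0 := L_gt0; rewrite exchange_big mulr_sumr; apply: ler_sum => b _.
apply: (@le_trans _ _ (256 * (\sum_(a < (10 * L).+1) wt a * (central a b tau i)%:R) *
   (`|L%:R * eta i j + node R L b * om i j| <= 2 * L%:R * 2 ^+ N)%R%:R)); last first.
  by rewrite ler_wpM2r // ler_pM2l // pair_count.
rewrite mulr_sumr mulr_suml; apply: ler_sum => a _.
case: (boolP (central a b tau i)) => hi; last by rewrite !(mulr0, mul0r).
case: (boolP (central a b tau j)) => hj; last first.
  by rewrite !(mulr0, mulr1) mulr_ge0 // mulr_ge0 // wt_ge0.
have fi := central_form ht hi; have fj := central_form ht hj.
have -> : `|L%:R * eta i j + node R L b * om i j| <= 2 * L%:R * 2 ^+ N.
  have -> : L%:R * eta i j + node R L b * om i j =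
     form a b i * x2 j - form a b j * x2 i by rewrite /eta /om /form; ring.
  apply: le_trans (ler_normB _ _) _; rewrite !normrM.
  have p1 : `|form a b i| * `|x2 j| <= L%:R * 2 ^+ N by rewrite ler_pM // x2_le.
  have p2 : `|form a b j| * `|x2 i| <= L%:R * 2 ^+ N by rewrite ler_pM // x2_le.
  lra.
rewrite !mulr1 mulrC; apply: ler_wpM2r; first exact: wt_ge0.
exact: weight_le.
Qed.

Lemma bcount_trivial i j : bcount i j <= 11 * L%:R.
Proof.
apply: (@le_trans _ _ (\sum_(b < (10 * L).+1) 1)).
  by apply: ler_sum => b _; rewrite lern1 leq_b1.
rewrite sumr_const card_ord -[leLHS]natr1 natrM; have := L_ge16; lra.
Qed.

Lemma bcount_eq0 i j : 5 * `|om i j| + 2 * 2 ^+ N < `|eta i j| -> bcount i j = 0.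
Proof.
move=> h; have L0 := L_gt0; rewrite /bcount big1 // => b _.
apply/eqP; rewrite pnatr_eq0 eqb0 -ltNge.
have := lerB_normD (L%:R * eta i j) (node R L b * om i j).
rewrite !normrM (gtr0_norm L0).
have : `|node R L b| * `|om i j| <= 5 * L%:R * `|om i j| by rewrite ler_wpM2r // node_bound.
have : L%:R * (5 * `|om i j| + 2 * 2 ^+ N) < L%:R * `|eta i j| by rewrite ltr_pM2l.
lra.
Qed.

Lemma om_le i j : `|om i j| <= 2 * 4 ^+ N.
Proof.
have -> : 4 ^+ N = 2 ^+ N * 2 ^+ N :> R by rewrite -exprMn; congr (_ ^+ _); ring.
apply: le_trans (ler_normB _ _) _; rewrite !normrM.
have p1 : `|x3 i| * `|x2 j| <= 2 ^+ N * 2 ^+ N by rewrite ler_pM // ?x2_le ?x3_le.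
have p2 : `|x2 i| * `|x3 j| <= 2 ^+ N * 2 ^+ N by rewrite ler_pM // ?x2_le ?x3_le.
lra.
Qed.

(** A progression of step [om]: the additional hit is absorbed because |om| <= 2 * 4^N <= L *
    2^N. *)
Lemma bcount_le i j : 0 < `|om i j| -> bcount i j <= 5 * L%:R * 2 ^+ N / `|om i j|.
Proof.
move=> o0; have L0 := L_gt0; have p := pow2_gt0 N.
have -> : bcount i j = \sum_(b < (10 * L).+1)
  (`|(L%:R * eta i j - 5 * L%:R * om i j) + b%:R * om i j| <= 2 * L%:R * 2 ^+ N)%R%:R.
  apply: eq_bigr => b _; congr (nat_of_bool (`|_| <= _))%:R; rewrite /node; ring.
apply: le_trans (count_progression _ _ _ _) _; first by rewrite -normr_gt0.
  by rewrite !mulr_ge0 // ltW.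
rewrite -[X in _ + X](divff (lt0r_neq0 o0)) -mulrDl ler_pM2r ?invr_gt0 //.
have o1 : `|om i j| <= L%:R * 2 ^+ N.
  apply: le_trans (om_le i j) _.
  have -> : 4 ^+ N = 2 ^+ N * 2 ^+ N :> R by rewrite -exprMn; congr (_ ^+ _); ring.
  by rewrite mulrA ler_pM2r // -exprS natrX ler_eXn2l ?ltr1n //; lia.
lra.
Qed.

Lemma shell_index (y : R) (j0 : nat) : (j0 <= N)%N -> 2 ^+ N < y -> y <= 2 ^+ (2 * N - j0) ->
  exists2 J, (j0 <= J < N)%N & 2 ^+ (2 * N - J.+1) < y <= 2 ^+ (2 * N - J).
Proof.
move=> jN y1; have [m mE] : exists m, (N - j0 = m)%N by exists (N - j0)%N.
elim: m j0 jN mE => [|m IH] j0 jN mE y2.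
  have e : (2 * N - j0 = N)%N by lia.
  by move: y2; rewrite e leNgt y1.
case: (lerP y (2 ^+ (2 * N - j0.+1))) => h.
  have [||J /andP[a b] c] := IH j0.+1 _ _ h; try (clear -jN mE; lia).
  by exists J => //; clear -a b; lia.
by exists j0; [lia | rewrite h y2].
Qed.

(** [om] and [eta] are comparable to 2^N times distances from the line through 0 and [i], so the
    radius is of order 2^(N-J). The 7 = 5 + 2 comes from [bcount_eq0] with 2^N <= 2^(2N-J). *)
Definition tube i j J : bool :=
  (`|om i j| <= 2 ^+ (2 * N - J)) && (`|eta i j| <= 7 * 2 ^+ (2 * N - J)).

(** Each pair is charged to one tube: J = N and the trivial count if |om| <= 2^N, otherwise the J
    with |om| between 2^(2N-J-1) and 2^(2N-J), where [bcount_le] applies. *)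
Lemma bcount_shells i j j0 : (j0 <= N)%N -> `|om i j| <= 2 ^+ (2 * N - j0) ->
  2 ^+ N / L%:R * bcount i j <=
  \sum_(j0 <= J < N.+1) 11 * 2 ^+ J.+1 * (tube i j J)%:R.
Proof.
move=> jN oj; have L0 := L_gt0; have p := pow2_gt0 N.
have T0 J : 0 <= 11 * 2 ^+ J.+1 * (tube i j J)%:R :> R.
  by rewrite mulr_ge0 // mulr_ge0 // exprn_ge0.
have pick J : (j0 <= J < N.+1)%N -> tube i j J ->
    11 * 2 ^+ J.+1 <= \sum_(j0 <= J < N.+1) 11 * 2 ^+ J.+1 * (tube i j J)%:R :> R.
  move=> hJ tJ; rewrite (bigD1_seq J) ?mem_index_iota ?iota_uniq //= tJ mulr1.
  by rewrite lerDl sumr_ge0.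
case: (ltrP (5 * `|om i j| + 2 * 2 ^+ N) `|eta i j|) => he.
  by rewrite bcount_eq0 // mulr0 sumr_ge0.
case: (lerP `|om i j| (2 ^+ N)) => ho.
  have e : (2 * N - N = N)%N by clear; lia.
  apply: le_trans (pick N _ _); last 2 first.
  - by rewrite jN ltnSn.
  - by rewrite /tube e ho; lra.
  apply: (@le_trans _ _ (2 ^+ N / L%:R * (11 * L%:R))).
    by rewrite ler_wpM2l ?bcount_trivial // divr_ge0 ?ltW.
  have -> : 2 ^+ N / L%:R * (11 * L%:R) = 11 * 2 ^+ N :> R by field; rewrite lt0r_neq0.
  by rewrite exprS; lra.
have [J hJ /andP[o1 o2]] := shell_index jN ho oj.
have q : 2 ^+ N <= 2 ^+ (2 * N - J) :> R.
  by rewrite ler_eXn2l ?ltr1n //; clear -hJ; lia.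
apply: le_trans (pick J _ _); last 2 first.
- by clear -hJ; lia.
- by rewrite /tube o2; lra.
have o0 : 0 < `|om i j| by lra.
apply: (@le_trans _ _ (2 ^+ N / L%:R * (5 * L%:R * 2 ^+ N / `|om i j|))).
  by rewrite ler_wpM2l ?bcount_le // divr_ge0 ?ltW.
have -> : 2 ^+ N / L%:R * (5 * L%:R * 2 ^+ N / `|om i j|) = 5 * (2 ^+ N * 2 ^+ N) / `|om i j|.
  by field; rewrite !lt0r_neq0.
rewrite ler_pdivrMr //.
have -> : 2 ^+ N * 2 ^+ N = 2 ^+ J.+1 * 2 ^+ (2 * N - J.+1) :> R.
  by rewrite -!exprD; congr (_ ^+ _); clear -hJ; lia.
have : 2 ^+ J.+1 * 2 ^+ (2 * N - J.+1) <= 2 ^+ J.+1 * `|om i j|.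
  by rewrite ler_wpM2l ?exprn_ge0 // ltW.
have : 0 <= 2 ^+ J.+1 * `|om i j| by rewrite mulr_ge0 // exprn_ge0.
lra.
Qed.

Variable rk : nat.
Hypothesis rk_ge : 7 / kap + 2 <= rk%:R.

(** The tube is covered by 2^J + 1 balls centred on the line at the heights k * 2^h. In the radius,
    7 / kap bounds the distance to the line ([eta] divided by [x2 i]), and 2 bounds the slopes x1/x2
    and x3/x2 over a height 2^h. *)
Lemma tube_mass i J : (J <= N)%N ->
  \sum_j mu j * (tube i j J)%:R <= 2 ^+ J.+1 * (Cb rk * bet ^+ J).
Proof.
move=> JN; set h := (N - J)%N.
have JE : (N - h = J)%N by rewrite /h subKn.
have x8 := X2_ge8 i; have x0 : 0 < x2 i by lra.
have [b1 b3] := X13 i; have p := pow2_gt0 h.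
have NE : 2 ^+ N = 2 ^+ J * 2 ^+ h :> R by rewrite -exprD subnKC.
have NE2 : 2 ^+ (2 * N - J) = 2 ^+ N * 2 ^+ h :> R.
  by rewrite -exprD; congr (_ ^+ _); rewrite /h; clear -JN; lia.
pose ballk k j := [&& `|x1 j - k%:R * 2 ^+ h * (x1 i / x2 i)| <= rk%:R * 2 ^+ h,
   `|x2 j - k%:R * 2 ^+ h| <= rk%:R * 2 ^+ h &
   `|x3 j - k%:R * 2 ^+ h * (x3 i / x2 i)| <= rk%:R * 2 ^+ h].
have rk2 : 2 <= rk%:R :> R.
  by apply: le_trans rk_ge; rewrite lerDr divr_ge0 // ltW.
have ratio (y : R) : `|y| <= x2 i + 1 -> `|y / x2 i| <= 2.
  by move=> hy; rewrite normrM normfV (gtr0_norm x0) ler_pdivrMr //; lra.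
have cover j : tube i j J -> exists k : 'I_(2 ^ J).+1, ballk k j.
  move=> /andP[t3 t1].
  have xj := x2_le j; rewrite ler_norml in xj; case/andP: xj => _ xj.
  have xj8 := X2_ge8 j.
  have q0 : 0 <= x2 j / 2 ^+ h by rewrite divr_ge0 ?(ltW p) //; lra.
  have /andP[k1 k2] := truncn_itv q0.
  have kJ : (Num.trunc (x2 j / 2 ^+ h) < (2 ^ J).+1)%N.
    rewrite ltnS -(ler_nat R); apply: le_trans k1 _.
    by rewrite ler_pdivrMr // natrX -NE.
  exists (Ordinal kJ) => /=; move: k1 k2; rewrite /ballk /=.
  move: (Num.trunc _) => k; rewrite ler_pdivlMr // ltr_pdivrMr // -[k.+1%:R]natr1 mulrDl mul1r => k1 k2.
  have d2 : `|x2 j - k%:R * 2 ^+ h| <= 2 ^+ h by rewrite ler_norml; apply/andP; split; lra.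
  have side (yi yj u : R) : 0 <= u -> u <= 7 -> `|yi| <= x2 i + 1 ->
      `|yi * x2 j - yj * x2 i| <= u * 2 ^+ (2 * N - J) ->
      `|yj - k%:R * 2 ^+ h * (yi / x2 i)| <= rk%:R * 2 ^+ h.
    move=> u0 u7 hy hh.
    have h1 : `|x2 j * (yi / x2 i) - yj| <= 7 / kap * 2 ^+ h.
      have xK : yi * x2 j = (x2 j * (yi / x2 i)) * x2 i by field; rewrite lt0r_neq0.
      move: hh; rewrite xK -mulrBl normrM (gtr0_norm x0) NE2 => hh.
      rewrite mulrAC ler_pdivlMr // -(ler_pM2r (pow2_gt0 N)).
      apply: (@le_trans _ _ (`|x2 j * (yi / x2 i) - yj| * x2 i)).
        by rewrite -mulrA ler_wpM2l.
      apply: le_trans hh _; rewrite -mulrA [2 ^+ h * _]mulrC.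
      by rewrite ler_wpM2r // mulr_ge0 ?exprn_ge0.
    have h2 : `|(x2 j - k%:R * 2 ^+ h) * (yi / x2 i)| <= 2 ^+ h * 2.
      by rewrite normrM ler_pM // ratio.
    have -> : yj - k%:R * 2 ^+ h * (yi / x2 i) =
      (x2 j - k%:R * 2 ^+ h) * (yi / x2 i) - (x2 j * (yi / x2 i) - yj) by ring.
    apply: le_trans (ler_normB _ _) _; apply: le_trans (lerD h2 h1) _.
    have : (7 / kap + 2) * 2 ^+ h <= rk%:R * 2 ^+ h by rewrite ler_pM2r.
    lra.
  apply/and3P; split.
  - by apply: (side _ _ 7).
  - by apply: le_trans d2 _; rewrite ler_peMl ?(ltW p) //; lra.
  - apply: (side _ _ 1) => //; first by lra.
    by move: t3; rewrite mul1r /om (mulrC (x2 i)).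
have p2 : 0 <= Cb rk * bet ^+ J by rewrite mulr_ge0 ?Cb_ge0 // exprn_ge0 // ltW // bet_gt0.
apply: (@le_trans _ _ (\sum_(k < (2 ^ J).+1) Cb rk * bet ^+ J)); last first.
  rewrite sumr_const card_ord -[leLHS]mulr_natl; apply: (ler_wpM2r p2).
  by rewrite -natrX ler_nat expnS mul2n -addnn -add1n leq_add2r expn_gt0.
apply: (@le_trans _ _ (\sum_(k < (2 ^ J).+1) \sum_j mu j * (ballk k j)%:R)).
  rewrite exchange_big; apply: ler_sum => j _; rewrite -mulr_sumr.
  apply: (ler_wpM2l (mu_ge0 j)); case: (boolP (tube i j J)) => [/cover[k hk]|_]; last exact: sumr_ge0.
  by rewrite (bigD1 k) //= hk lerDl sumr_ge0.
apply: ler_sum => k _.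
have hN : (h <= N)%N by rewrite /h leq_subr.
have B := @ball rk h (k%:R * 2 ^+ h * (x1 i / x2 i)) (k%:R * 2 ^+ h)
   (k%:R * 2 ^+ h * (x3 i / x2 i)) hN; rewrite JE in B; apply: le_trans _ B.
rewrite [leRHS]big_mkcond; apply: ler_sum => j _; rewrite -/(x1 j) -/(x2 j) -/(x3 j) -/(ballk k j).
by case: (ballk k j); rewrite ?mulr1 ?mulr0.
Qed.

Definition Wmax : R := 256.

Definition pair_const : R :=
  Wmax * (Wmax * (3 / kap)) * Cb 1 * (44 * Cb rk / (1 - chi)).

Definition pairmass (a b tau j0 : nat) : R :=
  \sum_i \sum_j mu i * mu j * (`|om i j| <= 2 ^+ (2 * N - j0))%R%:R *
    ((central a b tau i)%:R * (central a b tau j)%:R).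

(** At level J one factor 2^J counts the slopes [b], another the balls in the tube; since 4 * [bet]
    = chi^3, the term is of order chi^(3J) and the series converges. *)
Lemma close_pairs i j0 : (j0 <= N)%N ->
  \sum_j mu j * ((`|om i j| <= 2 ^+ (2 * N - j0))%R%:R * (2 ^+ N / L%:R * bcount i j)) <=
  44 * Cb rk / (1 - chi) * chi ^+ j0.
Proof.
move=> jN; have b0 := bet_gt0; have c1 := chi_lt1; have c9 := chi_ge.
apply: (@le_trans _ _ (\sum_j mu j *
   (\sum_(j0 <= J < N.+1) 11 * 2 ^+ J.+1 * (tube i j J)%:R))).
  apply: ler_sum => j _; apply: (ler_wpM2l (mu_ge0 j)).
  case: (lerP `|om i j| (2 ^+ (2 * N - j0))) => h; last first.
    by rewrite mul0r sumr_ge0 // => J _; rewrite mulr_ge0 // mulr_ge0 // exprn_ge0.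
  by rewrite mul1r; exact: bcount_shells.
under eq_bigr => j _ do rewrite mulr_sumr.
rewrite exchange_big /=.
apply: (@le_trans _ _ (\sum_(j0 <= J < N.+1) 44 * Cb rk * chi ^+ J)).
  rewrite !big_nat; apply: ler_sum => J /andP[_ hJ].
  under eq_bigr => j _ do rewrite mulrCA.
  rewrite -mulr_sumr; apply: (@le_trans _ _ (11 * 2 ^+ J.+1 * (2 ^+ J.+1 * (Cb rk * bet ^+ J)))).
    by apply: ler_wpM2l; [rewrite mulr_ge0 // exprn_ge0 | exact: tube_mass].
  have -> : 11 * 2 ^+ J.+1 * (2 ^+ J.+1 * (Cb rk * bet ^+ J)) =
     44 * Cb rk * (2 ^+ J * 2 ^+ J * bet ^+ J) by rewrite exprS; ring.
  apply: ler_wpM2l; first by rewrite mulr_ge0 // Cb_ge0.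
  rewrite -!exprMn; have -> : 2 * 2 * bet = chi ^+ 3 by field.
  rewrite lerXn2r ?nnegrE ?exprn_ge0 //; try lra.
  by rewrite exprS -[leRHS]mulr1 ler_pM2l ?exprn_ile1 //; lra.
rewrite -mulr_sumr -[leRHS]mulrA; apply: ler_wpM2l.
  by rewrite mulr_ge0 // Cb_ge0.
by rewrite mulrC; apply: geometric_tail_le; lra.
Qed.

Lemma pairmass_le j0 tau : (j0 <= N)%N -> (tau < 2 ^ H)%N ->
  \sum_(a < (10 * L).+1) \sum_(b < (10 * L).+1) wt a * wt b *
     (4 ^+ N * pairmass a b tau j0) <= pair_const * chi ^+ j0 * L%:R ^+ 2.
Proof.
move=> jN ht; have L0 := L_gt0; have p := pow2_gt0 N; have c1 := chi_lt1; have c9 := chi_ge.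
have W0 : 0 < Wmax by rewrite /Wmax.
pose G : R := Wmax * (Wmax * (3 / kap)) * L%:R ^+ 2.
have G0 : 0 <= G.
  have k0 : 0 <= 3 / kap by rewrite divr_ge0 // ltW.
  exact: mulr_ge0 (mulr_ge0 (ltW W0) (mulr_ge0 (ltW W0) k0)) (sqr_ge0 _).
apply: (@le_trans _ _ (\sum_i mu i * \sum_j mu j *
   ((`|om i j| <= 2 ^+ (2 * N - j0))%R%:R * (G * (2 ^+ N / L%:R * bcount i j))))).
  have -> : \sum_(a < (10 * L).+1) \sum_(b < (10 * L).+1) wt a * wt b *
     (4 ^+ N * pairmass a b tau j0) = \sum_i mu i * \sum_j mu j *
   ((`|om i j| <= 2 ^+ (2 * N - j0))%R%:R * (4 ^+ N *
    \sum_(a < (10 * L).+1) \sum_(b < (10 * L).+1) wt a * wt b *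
     ((central a b tau i)%:R * (central a b tau j)%:R))).
    transitivity (\sum_(a < (10 * L).+1) \sum_(b < (10 * L).+1) \sum_i \sum_j
       mu i * (mu j * ((`|om i j| <= 2 ^+ (2 * N - j0))%R%:R * (4 ^+ N *
        (wt a * wt b * ((central a b tau i)%:R * (central a b tau j)%:R)))))).
      apply: eq_bigr => a _; apply: eq_bigr => b _; rewrite !mulr_sumr; apply: eq_bigr => i _.
      by rewrite !mulr_sumr; apply: eq_bigr => j _; ring.
    under eq_bigr => a _ do rewrite exchange_big.
    rewrite exchange_big; apply: eq_bigr => i _.
    under eq_bigr => a _ do rewrite exchange_big.
    rewrite exchange_big mulr_sumr; apply: eq_bigr => j _.
    rewrite !mulr_sumr; apply: eq_bigr => a _.
    by rewrite !mulr_sumr.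
  apply: ler_sum => i _; apply: (ler_wpM2l (mu_ge0 i)); apply: ler_sum => j _.
  apply: (ler_wpM2l (mu_ge0 j)); apply: ler_wpM2l => //.
  apply: (@le_trans _ _ (4 ^+ N * (Wmax * (Wmax * (3 * L%:R / (kap * 2 ^+ N))) * bcount i j))).
    by apply: ler_wpM2l; [rewrite exprn_ge0 | exact: pair_le].
  have -> : 4 ^+ N = 2 ^+ N * 2 ^+ N :> R by rewrite -exprMn; congr (_ ^+ _); ring.
  rewrite /G; move: Wmax W0 => W _.
  apply: le_of_eq; field.
  by rewrite !lt0r_neq0.
apply: (@le_trans _ _ (\sum_i mu i * (G * (44 * Cb rk / (1 - chi) * chi ^+ j0)))).
  apply: ler_sum => i _; apply: (ler_wpM2l (mu_ge0 i)).
  apply: le_trans (ler_wpM2l G0 (close_pairs i jN)).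
  rewrite mulr_sumr; apply: ler_sum => j _.
  by apply: le_of_eq; ring.
rewrite -mulr_suml.
have K0 : 0 <= G * (44 * Cb rk / (1 - chi) * chi ^+ j0).
  apply: (mulr_ge0 G0); apply: mulr_ge0; last by rewrite exprn_ge0 //; lra.
  by apply: divr_ge0; [rewrite mulr_ge0 // Cb_ge0 | lra].
apply: le_trans (ler_wpM2r K0 mass_le) _.
rewrite /G /pair_const; move: Wmax => W.
by apply: le_of_eq; ring.
Qed.

(** The factor 4/chi^2 is balanced: times [bet] it leaves chi, so the mean is summable over n, and a
    bound T^2 on the total forces every density jump at level n to be at most chi^n T. *)
Definition tailsum (n1 a b tau : nat) : R :=
  \sum_(n1 <= n < N) (4 / chi ^+ 2) ^+ n *
     \sum_(q < 64 * 2 ^ n) (cellmass a b (2 ^ (H - n.+1)) tau (2 * q) -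
                            cellmass a b (2 ^ (H - n.+1)) tau (2 * q).+1) ^+ 2.

Lemma tailsum_le n1 :
  \sum_(a < (10 * L).+1) \sum_(b < (10 * L).+1) wt a * wt b *
    (\sum_(tau < 2 ^ H) tailsum n1 a b tau) <=
  energy_const * (chi ^+ n1 / (1 - chi)) * L%:R ^+ 2 * 2 ^+ H.
Proof.
have c1 := chi_lt1; have c9 := chi_ge; have c0 : 0 < chi by lra.
have b0 := bet_gt0.
have -> : \sum_(a < (10 * L).+1) \sum_(b < (10 * L).+1) wt a * wt b *
    (\sum_(tau < 2 ^ H) tailsum n1 a b tau) =
  \sum_(n1 <= n < N) (4 / chi ^+ 2) ^+ n *
   \sum_(a < (10 * L).+1) \sum_(b < (10 * L).+1) wt a * wt b *
    (\sum_(tau < 2 ^ H) \sum_(q < 64 * 2 ^ n)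
       (cellmass a b (2 ^ (H - n.+1)) tau (2 * q) -
        cellmass a b (2 ^ (H - n.+1)) tau (2 * q).+1) ^+ 2).
  under [RHS]eq_bigr => n _ do rewrite mulr_sumr.
  rewrite [RHS]exchange_big; apply: eq_bigr => a _.
  under [RHS]eq_bigr => n _ do rewrite mulr_sumr.
  rewrite [RHS]exchange_big; apply: eq_bigr => b _.
  under [RHS]eq_bigr => n _ do rewrite mulrCA mulr_sumr.
  rewrite -mulr_sumr; congr (_ * _); rewrite exchange_big; apply: eq_bigr => tau _.
  by [].
apply: (@le_trans _ _ (\sum_(n1 <= n < N) (energy_const * L%:R ^+ 2 * 2 ^+ H) * chi ^+ n)).
  rewrite !big_nat; apply: ler_sum => n /andP[_ nN].
  have k0 : 0 <= (4 / chi ^+ 2) ^+ n by rewrite exprn_ge0 // divr_ge0 // sqr_ge0.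
  apply: le_trans (ler_wpM2l k0 (energy_le nN erefl)) _.
  rewrite mulrCA -exprMn; have -> // : 4 / chi ^+ 2 * bet = chi.
  by field; rewrite lt0r_neq0.
rewrite -mulr_sumr.
have -> : energy_const * (chi ^+ n1 / (1 - chi)) * L%:R ^+ 2 * 2 ^+ H =
   energy_const * L%:R ^+ 2 * 2 ^+ H * (chi ^+ n1 / (1 - chi)) by ring.
apply: ler_wpM2l; last by apply: geometric_tail_le => //; lra.
by apply: mulr_ge0 (mulr_ge0 energy_const_ge0 (sqr_ge0 _)) _; rewrite exprn_ge0.
Qed.

(** * Choice of the slopes and of the grid by averaging *)

Definition wsq : R := wtot R ^+ 2.

Lemma wsq_gt0 : 0 < wsq. Proof. exact: exprn_gt0 (wtot_gt0 R). Qed.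

Lemma weights_total : \sum_(a < (10 * L).+1) \sum_(b < (10 * L).+1) wt a * wt b <=
  wsq * L%:R ^+ 2.
Proof.
have -> : \sum_(a < (10 * L).+1) \sum_(b < (10 * L).+1) wt a * wt b =
  (\sum_(a < (10 * L).+1) wt a) * (\sum_(b < (10 * L).+1) wt b).
  by rewrite mulr_suml; apply: eq_bigr => a _; rewrite mulr_sumr.
have h : \sum_(a < (10 * L).+1) wt a <= wtot R * L%:R.
  by apply: weight_sum_le; rewrite expn_gt0.
have h0 : 0 <= \sum_(a < (10 * L).+1) wt a by apply: sumr_ge0 => a _; exact: wt_ge0.
by rewrite /wsq -exprMn expr2; apply: ler_pM.
Qed.

Lemma sum_offsets_const (x : R) : \sum_(tau < 2 ^ H) x = x * 2 ^+ H.
Proof. by rewrite sumr_const card_ord -[LHS]mulr_natr [X in _ * X = _]natrX. Qed.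

(** First moments: if every choice failed, the weighted sum of [F] would be nonpositive, whereas it
    is at least (c - c/2 - c/8 - c/8) L^2 2^H. The coefficients fit the later uses: from p > c2, the
    pair term gives 4^N pairmass < p^2 and the tail term gives tailsum <= (p (1 - chi) / 4)^2. *)
Lemma exists_good_parameters (c : R) (j0 n1 : nat) :
  0 < c -> c <= \sum_i mu i -> (j0 <= N)%N ->
  let c2 := c / (2 * wsq) in
  let bb := 16 / (c2 * (1 - chi) ^+ 2) in
  c2^-1 * (pair_const * chi ^+ j0) <= c / 8 ->
  bb * (energy_const * (chi ^+ n1 / (1 - chi))) <= c / 8 ->
  exists a b : 'I_(10 * L).+1, exists2 tau, (tau < 2 ^ H)%N &
    let p := 2 ^+ N * cellmass a b L tau (mid tau) in
    c2 + c2^-1 * (4 ^+ N * pairmass a b tau j0) + bb * tailsum n1 a b tau < p.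
Proof.
move=> c0 cmu jN c2 bb Hp Ht; have L0 := L_gt0; have pH := pow2_gt0 H; have pN := pow2_gt0 N.
have w0 := wsq_gt0.
have c20 : 0 < c2 by rewrite divr_gt0 // mulr_gt0.
pose F (a b : 'I_(10 * L).+1) (tau : 'I_(2 ^ H)) : R :=
  2 ^+ N * cellmass a b L tau (mid tau) -
  (c2 + c2^-1 * (4 ^+ N * pairmass a b tau j0) + bb * tailsum n1 a b tau).
case: (boolP [exists a, [exists b, [exists tau, 0 < F a b tau]]]) => [|noF].
  case/existsP => a /existsP[b /existsP[tau Fp]].
  by exists a, b; exists tau; [exact: ltn_ord | rewrite /= -subr_gt0].
have Fle a b tau : F a b tau <= 0.
  move: noF; rewrite negb_exists => /forallP/(_ a); rewrite negb_exists => /forallP/(_ b).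
  by rewrite negb_exists => /forallP/(_ tau); rewrite -leNgt.
pose S f : R := \sum_(a < (10 * L).+1) \sum_(b < (10 * L).+1) wt a * wt b *
   \sum_(tau < 2 ^ H) f a b tau.
have SF : S F <= 0.
  apply: sumr_le0 => a _; apply: sumr_le0 => b _.
  by apply: mulr_ge0_le0; [rewrite mulr_ge0 // wt_ge0 | exact: sumr_le0].
have Sswap (f : 'I_(10 * L).+1 -> 'I_(10 * L).+1 -> 'I_(2 ^ H) -> R) :
   S f = \sum_(tau < 2 ^ H) \sum_(a < (10 * L).+1) \sum_(b < (10 * L).+1) wt a * wt b * f a b tau.
  rewrite [RHS]exchange_big; apply: eq_bigr => a _.
  by rewrite [RHS]exchange_big; apply: eq_bigr => b _; rewrite mulr_sumr.
have S1 : c * L%:R ^+ 2 * 2 ^+ H <= S (fun a b tau => 2 ^+ N * cellmass a b L tau (mid tau)).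
  rewrite Sswap; apply: (@le_trans _ _ (\sum_(tau < 2 ^ H) c * L%:R ^+ 2)).
    by rewrite sum_offsets_const.
  apply: ler_sum => tau _.
  apply: (@le_trans _ _ (2 ^+ N * ((\sum_i mu i) * (L%:R ^+ 2 / 2 ^+ N)))).
    have -> : 2 ^+ N * ((\sum_i mu i) * (L%:R ^+ 2 / 2 ^+ N)) = (\sum_i mu i) * L%:R ^+ 2.
      by field; rewrite lt0r_neq0.
    by rewrite ler_wpM2r // sqr_ge0.
  apply: le_trans (ler_wpM2l (ltW pN) (central_mass (ltn_ord tau))) _.
  rewrite mulr_sumr; apply: ler_sum => a _; rewrite mulr_sumr; apply: ler_sum => b _.
  by rewrite mulrCA.
have S2 : S (fun a b tau => c2) <= c / 2 * L%:R ^+ 2 * 2 ^+ H.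
  apply: (@le_trans _ _ ((wsq * L%:R ^+ 2) * (2 ^+ H * c2))).
    have k0 : 0 <= 2 ^+ H * c2 by rewrite mulr_ge0 // ltW.
    apply: le_trans (ler_wpM2r k0 weights_total).
    rewrite mulr_suml; apply: ler_sum => a _; rewrite mulr_suml; apply: ler_sum => b _.
    by rewrite sum_offsets_const (mulrC c2).
  by apply: le_of_eq; rewrite /c2; field; rewrite lt0r_neq0.
have S3 : S (fun a b tau => c2^-1 * (4 ^+ N * pairmass a b tau j0)) <= c / 8 * L%:R ^+ 2 * 2 ^+ H.
  rewrite Sswap; apply: (@le_trans _ _ (\sum_(tau < 2 ^ H) c / 8 * L%:R ^+ 2)); last first.
    by rewrite sum_offsets_const.
  apply: ler_sum => tau _.
  apply: le_trans (ler_wpM2r (sqr_ge0 _) Hp); rewrite -mulrA.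
  have k0 : 0 <= c2^-1 by rewrite invr_ge0 ltW.
  apply: le_trans (ler_wpM2l k0 (pairmass_le jN (ltn_ord tau))).
  rewrite mulr_sumr; apply: ler_sum => a _; rewrite mulr_sumr; apply: ler_sum => b _.
  by rewrite mulrCA.
have S4 : S (fun a b tau => bb * tailsum n1 a b tau) <= c / 8 * L%:R ^+ 2 * 2 ^+ H.
  have k0 : 0 <= bb.
    by apply: divr_ge0 => //; apply: mulr_ge0 (ltW c20) (sqr_ge0 _).
  have kH : 0 <= L%:R ^+ 2 * 2 ^+ H :> R by apply: mulr_ge0 (sqr_ge0 _) (ltW pH).
  rewrite -[leRHS]mulrA; apply: le_trans (ler_wpM2r kH Ht); rewrite -[leRHS]mulrA.
  rewrite [X in _ <= bb * X]mulrA.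
  apply: le_trans (ler_wpM2l k0 (tailsum_le n1)).
  rewrite mulr_sumr; apply: ler_sum => a _; rewrite mulr_sumr; apply: ler_sum => b _.
  by rewrite -mulr_sumr mulrCA.
have SE : S F = S (fun a b tau => 2 ^+ N * cellmass a b L tau (mid tau)) -
   S (fun a b tau => c2) - S (fun a b tau => c2^-1 * (4 ^+ N * pairmass a b tau j0)) -
   S (fun a b tau => bb * tailsum n1 a b tau).
  rewrite /S -!sumrB; apply: eq_bigr => a _; rewrite -!sumrB; apply: eq_bigr => b _.
  rewrite -!mulrBr -!sumrB; congr (_ * _); apply: eq_bigr => tau _; rewrite /F.
  by ring.
have pos : 0 < c * L%:R ^+ 2 * 2 ^+ H by rewrite mulr_gt0 // mulr_gt0 // exprn_gt0.
by clear -SF S1 S2 S3 S4 SE pos; lra.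
Qed.

Lemma pairmass_ge0 a b tau j0 : 0 <= pairmass a b tau j0.
Proof.
apply: sumr_ge0 => i _; apply: sumr_ge0 => j _.
exact: mulr_ge0 (mulr_ge0 (mulr_ge0 (mu_ge0 i) (mu_ge0 j)) (ler0n _ _)) (mulr_ge0 (ler0n _ _) (ler0n _ _)).
Qed.

Lemma tail_weight_ge0 n : 0 <= (4 / chi ^+ 2) ^+ n.
Proof. by rewrite exprn_ge0 // divr_ge0 // sqr_ge0. Qed.

Lemma tailsum_ge0 n1 a b tau : 0 <= tailsum n1 a b tau.
Proof.
apply: sumr_ge0 => n _; apply: mulr_ge0 (tail_weight_ge0 n) _.
by apply: sumr_ge0 => q _; exact: sqr_ge0.
Qed.

(* Otherwise [pairmass] would be the square of the mass of the central cell. *)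
Lemma far_central_pair (a b : 'I_(10 * L).+1) tau j0 (c2 : R) : 0 < c2 ->
  c2 < 2 ^+ N * cellmass a b L tau (mid tau) ->
  c2^-1 * (4 ^+ N * pairmass a b tau j0) < 2 ^+ N * cellmass a b L tau (mid tau) ->
  exists i j, [/\ central a b tau i, central a b tau j & 2 ^+ (2 * N - j0) < `|om i j|].
Proof.
move=> c0; set m0 := cellmass _ _ _ _ _ => h1 h2.
pose P := [exists i, [exists j, [&& central a b tau i, central a b tau j & 2 ^+ (2 * N - j0) < `|om i j|]]].
case: (boolP P) => [/existsP[i /existsP[j /and3P[*]]]|nex]; first by exists i, j.
exfalso.
have e : pairmass a b tau j0 = m0 ^+ 2.
  rewrite expr2 /m0 /cellmass mulr_suml; apply: eq_bigr => i _.
  rewrite mulr_sumr; apply: eq_bigr => j _.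
  rewrite -/(central a b tau i) -/(central a b tau j).
  case: (boolP (central a b tau i)) => ci; last by rewrite !(mul0r, mulr0).
  case: (boolP (central a b tau j)) => cj; last by rewrite !(mul0r, mulr0).
  have -> : `|om i j| <= 2 ^+ (2 * N - j0); last by rewrite !mulr1.
  rewrite leNgt; apply/negP => h; move/negP: nex; apply.
  by apply/existsP; exists i; apply/existsP; exists j; rewrite ci cj.
move: h2; rewrite e; have -> : 4 ^+ N * m0 ^+ 2 = (2 ^+ N * m0) * (2 ^+ N * m0).
  have -> : 4 ^+ N = 2 ^+ N * 2 ^+ N :> R by rewrite -exprMn; congr (_ ^+ _); ring.
  by ring.
move: (2 ^+ N * m0) h1 => p h1.
have p0 : 0 < p by lra.
(* p^2 / c2 < p would mean p < c2. *)
by rewrite mulrA gtr_pMl // mulrC ltr_pdivrMr // mul1r; lra.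
Qed.

(** The central cell and any other cell under the same ancestor at level [n1] both have densities
    within p/4 of the ancestor's, so the other density is at least p/2. *)
Lemma descendants_pos (a b : 'I_(10 * L).+1) tau n1 (c2 : R) : (n1 <= N)%N -> 0 < c2 ->
  let p := 2 ^+ N * cellmass a b L tau (mid tau) in
  (mid tau < 64 * 2 ^ N)%N -> c2 < p ->
  16 / (c2 * (1 - chi) ^+ 2) * tailsum n1 a b tau < p ->
  forall q, (q < 64 * 2 ^ N)%N -> (q %/ 2 ^ (N - n1) = mid tau %/ 2 ^ (N - n1))%N ->
  0 < cellmass a b L tau q.
Proof.
move=> nN c0 p midN cp tp q qN qE.
have x1' : 0 < 1 - chi by rewrite subr_gt0.
have chi0 : 0 < chi by have := chi_ge; lra.
have p0 : 0 < p by lra.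
(* Chosen so that the sum of the jumps chi^n * T is at most p/4. *)
pose T := p * (1 - chi) / 4.
have T0 : 0 <= T by rewrite divr_ge0 // mulr_ge0 // ltW.
pose m n q := cellmass a b (2 ^ (H - n)) tau q.
have mS n q' : (n < N)%N -> m n q' = m n.+1 (2 * q')%N + m n.+1 (2 * q').+1.
  move=> nn; rewrite /m -cellmass_split; congr cellmass.
  by rewrite -expnS; congr (2 ^ _)%N; clear -nn; lia.
have tT : tailsum n1 a b tau <= T ^+ 2.
  have k0 : 0 < c2 * (1 - chi) ^+ 2 / 16 by rewrite divr_gt0 // mulr_gt0 // exprn_gt0.
  have : tailsum n1 a b tau < c2 * (1 - chi) ^+ 2 / 16 * p.
    have -> : tailsum n1 a b tau = c2 * (1 - chi) ^+ 2 / 16 *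
       (16 / (c2 * (1 - chi) ^+ 2) * tailsum n1 a b tau).
      by field; rewrite !lt0r_neq0.
    by rewrite ltr_pM2l.
  move/ltW => h; apply: le_trans h _.
  have -> : T ^+ 2 = p * (p * ((1 - chi) ^+ 2 / 16)) by rewrite /T; field.
  rewrite [leLHS]mulrC ler_pM2l // -mulrA ler_wpM2r ?(ltW cp) //.
  by rewrite divr_ge0 // sqr_ge0.
have mD n q' : (n1 <= n < N)%N -> (q' < 64 * 2 ^ n)%N ->
    2 ^+ n * `|m n.+1 (2 * q')%N - m n.+1 (2 * q').+1| <= chi ^+ n * T.
  move=> nn qq; set D := _ - _.
  have h : (4 / chi ^+ 2) ^+ n * D ^+ 2 <= T ^+ 2.
    apply: le_trans tT; rewrite /tailsum (bigD1_seq n) ?mem_index_iota ?iota_uniq //=.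
    rewrite -[leLHS]addr0 lerD //; last first.
      apply: sumr_ge0 => n' _; apply: mulr_ge0 (tail_weight_ge0 n') _.
      by apply: sumr_ge0 => q'' _; exact: sqr_ge0.
    apply: (ler_wpM2l (tail_weight_ge0 n)).
    rewrite (bigD1 (Ordinal qq)) //= -[leLHS]addr0 lerD // sumr_ge0 // => q'' _.
    exact: sqr_ge0.
  have cn : 0 < chi ^+ n by rewrite exprn_gt0.
  have e : (4 / chi ^+ 2) ^+ n * D ^+ 2 = (2 ^+ n * `|D| / chi ^+ n) ^+ 2.
    rewrite !expr_div_n [(_ * _) ^+ 2]exprMn real_normK ?num_real //.
    rewrite -!exprM (mulnC 2 n) ![in RHS]exprM.
    have -> : 2 ^+ n ^+ 2 = 4 ^+ n :> R by rewrite -exprM mulnC exprM; congr (_ ^+ _); ring.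
    by rewrite mulrAC -exprM mulnC.
  rewrite e in h.
  rewrite -ler_pdivrMl // mulrC -(ler_pXn2r (_ : 0 < 2)%N) ?nnegrE //.
  by rewrite divr_ge0 ?(ltW cn) // mulr_ge0 // exprn_ge0.
have D1 := cell_density_descent nN mS mD qN.
have D2 := cell_density_descent nN mS mD midN.
have eN : m N = cellmass a b L tau by rewrite /m addKn.
have g : (\sum_(n1 <= n < N) chi ^+ n) * T <= p / 4.
  have : \sum_(n1 <= n < N) chi ^+ n <= 1 / (1 - chi).
    apply: le_trans (geometric_tail_le _ _ (ltW chi0) chi_lt1) _.
    by rewrite ler_pM2r ?invr_gt0 // exprn_ile1 // ltW.
  move=> /(ler_wpM2r T0) h; apply: le_trans h _.
  by apply: le_of_eq; rewrite /T; field; rewrite lt0r_neq0.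
rewrite qE eN in D1; rewrite eN -/p in D2.
have := pos_of_close (le_trans D1 g) (le_trans D2 g) p0.
by rewrite pmulr_rgt0 // exprn_gt0.
Qed.

Lemma cellmass_witness a b e tau q : 0 < cellmass a b e tau q ->
  exists k, (q * e + tau <= vcode a b k)%N && (vcode a b k < q.+1 * e + tau)%N.
Proof.
move=> h; apply/existsP; apply: contraLR h => /existsPn h.
rewrite /cellmass big1 ?ltxx // => k _.
by rewrite (negbTE (h k)) mulr0.
Qed.

(** The ancestor is an interval of length 2^(N-n1) * L that contains the value 0 of the form; on one
    side of 0 it extends by at least half its length, which determines the sign [s]. *)
Lemma cells_cover (a b : 'I_(10 * L).+1) tau n1 : (n1 <= N)%N -> (tau < 2 ^ H)%N ->
  (forall q, (q < 64 * 2 ^ N)%N -> (q %/ 2 ^ (N - n1) = mid tau %/ 2 ^ (N - n1))%N ->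
    0 < cellmass a b L tau q) ->
  exists2 s : R, s = 1 \/ s = -1 &
   forall r : R, 0 <= r -> r < 2 ^+ (N - n1) / 2 ->
     exists k, `|form a b k - s * r * L%:R| <= L%:R.
Proof.
move=> nN ht hq; have [m1 m2] := mid_bounds ht; have L0 := L_gt0.
set M := (N - n1)%N in hq *; set Q := (mid tau %/ 2 ^ M)%N in hq.
have M0 : (0 < 2 ^ M)%N by rewrite expn_gt0.
have q1 : (Q * 2 ^ M <= mid tau)%N by rewrite leq_divM.
have q2 : (mid tau < Q.+1 * 2 ^ M)%N by rewrite ltn_ceil.
pose lo : R := (Q * 2 ^ M * L + tau)%:R.
pose hi : R := (Q.+1 * 2 ^ M * L + tau)%:R.
have lo_off : lo <= off%:R.
  by rewrite ler_nat (leq_trans _ m1) // leq_add2r leq_mul2r q1 orbT.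
have off_hi : off%:R < hi.
  rewrite ltr_nat (leq_trans m2) // leq_add2r -[X in (_ + X)%N]mul1n -mulnDl addn1.
  by rewrite leq_mul2r q2 orbT.
have hilo : hi = lo + 2 ^+ M * L%:R.
  by rewrite /hi /lo mulSn mulnDl -addnA addnC natrD natrM natrX.
have hit (t : R) : lo <= off%:R + t -> off%:R + t < hi -> exists k, `|form a b k - t| <= L%:R.
  set y := off%:R + t => y1 y2.
  have y0 : 0 <= (y - tau%:R) / L%:R.
    by rewrite divr_ge0 ?(ltW L0) // subr_ge0 (le_trans _ y1) // /lo ler_nat leq_addl.
  have /andP[] := truncn_itv y0.
  move: (Num.trunc _) => q; rewrite ler_pdivlMr // ltr_pdivrMr // -!natrM => k1 k2.
  have Q1 : (Q * 2 ^ M <= q)%N.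
    rewrite -ltnS -(ltn_pmul2r (_ : 0 < L)%N) ?expn_gt0 // -(ltr_nat R).
    by apply: le_lt_trans k2; rewrite lerBrDr -natrD.
  have Q2 : (q < Q.+1 * 2 ^ M)%N.
    rewrite -(ltn_pmul2r (_ : 0 < L)%N) ?expn_gt0 // -(ltr_nat R).
    by apply: le_lt_trans k1 _; rewrite ltrBlDr -natrD.
  have qQ : (q %/ 2 ^ M = Q)%N.
    apply/eqP; rewrite eqn_leq -ltnS ltn_divLR // Q2 /= leq_divRL //.
  have qN : (q < 64 * 2 ^ N)%N.
    have MN : (2 ^ M <= 2 ^ N)%N by rewrite leq_exp2l // leq_subr.
    have mN : (mid tau <= 32 * 2 ^ N)%N.
      rewrite -(leq_pmul2r (_ : 0 < L)%N) ?expn_gt0 // -mulnA -expnD.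
      by rewrite (leq_trans (leq_trans (leq_addr tau _) m1)) // expnD.
    have : (0 < 2 ^ N)%N by rewrite expn_gt0.
    have : (q < Q * 2 ^ M + 2 ^ M)%N by rewrite addnC -mulSn.
    by clear -q1 MN mN; lia.
  have [k /andP[v1 v2]] := cellmass_witness (hq q qN qQ).
  exists k; have vE := vcodeE a b k.
  have f1 : (q * L)%:R + tau%:R <= form a b k + off%:R.
    by rewrite -vE -natrD ler_nat.
  have f2 : form a b k + off%:R < (q * L)%:R + L%:R + tau%:R.
    by rewrite -vE -!natrD ltr_nat (leq_trans v2) // mulSn (addnC L).
  move: k1 k2; rewrite (mulSn q L) (natrD _ L (q * L)%N) /y.
  move: (form a b k) f1 f2 => f f1 f2 k1 k2; rewrite ler_norml; apply/andP; split; lra.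
have half0 : 0 < 2 ^+ M * L%:R :> R by rewrite mulr_gt0 // exprn_gt0.
case: (lerP (off%:R + 2 ^+ M * L%:R / 2) hi) => hh.
  exists 1 => [|r r0 rM]; first by left.
  have rL : r * L%:R < 2 ^+ M / 2 * L%:R by rewrite ltr_pM2r.
  have rL0 : 0 <= r * L%:R by rewrite mulr_ge0 // ltW.
  by apply: hit; rewrite mul1r; lra.
exists (-1) => [|r r0 rM]; first by right.
have rL : r * L%:R < 2 ^+ M / 2 * L%:R by rewrite ltr_pM2r.
have rL0 : 0 <= r * L%:R by rewrite mulr_ge0 // ltW.
by apply: hit; rewrite mulN1r mulNr; lra.
Qed.

Lemma plane_through_cloud (c : R) (j0 n1 : nat) :
  0 < c -> c <= \sum_i mu i -> (j0 <= N)%N -> (n1 <= N)%N ->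
  let c2 := c / (2 * wsq) in
  c2^-1 * (pair_const * chi ^+ j0) <= c / 8 ->
  16 / (c2 * (1 - chi) ^+ 2) * (energy_const * (chi ^+ n1 / (1 - chi))) <= c / 8 ->
  exists A B s : R, [/\ `|A| <= 5, `|B| <= 5, s = 1 \/ s = -1,
    exists i j, [/\ `|x1 i + A * x2 i + B * x3 i| <= 1, `|x1 j + A * x2 j + B * x3 j| <= 1
       & 2 ^+ (2 * N - j0) < `|om i j|] &
    forall r, 0 <= r -> r < 2 ^+ (N - n1) / 2 ->
      exists k, `|x1 k + A * x2 k + B * x3 k - s * r| <= 1].
Proof.
move=> c0 cmu jN nN c2 Hp Ht; have L0 := L_gt0.
have [a [b [tau ht /= good]]] := exists_good_parameters c0 cmu jN Hp Ht.
have c20 : 0 < c2 by rewrite divr_gt0 // mulr_gt0 // wsq_gt0.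
have x1' : 0 < 1 - chi by rewrite subr_gt0.
have g1 : 0 <= c2^-1 * (4 ^+ N * pairmass a b tau j0).
  by rewrite mulr_ge0 ?invr_ge0 ?(ltW c20) // mulr_ge0 ?exprn_ge0 // pairmass_ge0.
have g2 : 0 <= 16 / (c2 * (1 - chi) ^+ 2) * tailsum n1 a b tau.
  apply: mulr_ge0 (tailsum_ge0 _ _ _ _); apply: divr_ge0 => //.
  exact: mulr_ge0 (ltW c20) (sqr_ge0 _).
have [gx gy gz] := summands_lt c20 g1 g2 good.
have [m1 m2] := mid_bounds ht.
have midN : (mid tau < 64 * 2 ^ N)%N.
  rewrite -(ltn_pmul2r (_ : 0 < L)%N) ?expn_gt0 // -mulnA -expnD.
  apply: leq_ltn_trans (leq_trans (leq_addr tau _) m1) _.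
  by rewrite expnD ltn_pmul2r // expn_gt0.
have [i [j [ci cj oij]]] : exists i j, [/\ central a b tau i, central a b tau j &
    2 ^+ (2 * N - j0) < `|om i j|].
  exact: (@far_central_pair _ _ _ _ c2).
have pos := @descendants_pos a b tau n1 c2 nN c20 midN gx gz.
have [s hs hr] := cells_cover nN ht pos.
have formE k : form a b k = L%:R *
    (x1 k + node R L a / L%:R * x2 k + node R L b / L%:R * x3 k).
  by rewrite /form; field; rewrite lt0r_neq0.
have fle k z : `|form a b k - z * L%:R| <= L%:R ->
    `|x1 k + node R L a / L%:R * x2 k + node R L b / L%:R * x3 k - z| <= 1.
  by rewrite formE [z * _]mulrC -mulrBr normrM gtr0_norm // ger_pMr.
exists (node R L a / L%:R), (node R L b / L%:R), s; split => //.
- by rewrite normrM normfV (gtr0_norm L0) ler_pdivrMr // node_bound.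
- by rewrite normrM normfV (gtr0_norm L0) ler_pdivrMr // node_bound.
- exists i, j; split => //.
    by have := fle i 0; rewrite mul0r !subr0; apply; exact: central_form ht ci.
  by have := fle j 0; rewrite mul0r !subr0; apply; exact: central_form ht cj.
by move=> r r0 rM; have [k hk] := hr r r0 rM; exists k; exact: fle.
Qed.

End Core.

(** * Discrete Frostman measures *)

From mathcomp Require Import boolp.

(* Each point in turn receives as much mass as its cells allow, which saturates one of them;
   saturated cells stay saturated. *)
Lemma frostman_greedy (R : realFieldType) (I : finType) (T : eqType)
    (code : nat -> I -> T) (b : nat -> R) (N : nat) : (forall n, 0 <= b n) ->
  forall s : seq I, exists mu : I -> R, [/\ forall i, 0 <= mu i,
    forall n, (n <= N)%N -> forall q, \sum_(i | code n i == q) mu i <= b n &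
    forall i, i \in s -> exists2 n, (n <= N)%N &
      \sum_(j | code n j == code n i) mu j = b n].
Proof.
move=> b0; elim=> [|i s [mu [mu0 muN mus]]].
  exists (fun=> 0); split => // n _ q; by rewrite big1.
pose g (n : 'I_N.+1) := b n - \sum_(j | code n j == code n i) mu j.
pose n0 := [arg min_(n < ord0) g n]%O.
have n0P n : g n0 <= g n by rewrite /n0; case: arg_minP => // k _; apply.
have g0 n : 0 <= g n by rewrite subr_ge0; apply: muN; rewrite -ltnS.
pose mu' j := mu j + g n0 * (j == i)%:R.
have sumE n q : \sum_(j | code n j == q) mu' j =
    \sum_(j | code n j == q) mu j + g n0 * (code n i == q)%:R.
  rewrite big_split /=; congr (_ + _); rewrite -mulr_sumr; congr (_ * _).
  rewrite big_mkcond (bigD1 i) //= eqxx big1 ?addr0; first by case: eqP.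
  by move=> j /negbTE ->; case: ifP.
have muN' n : (n <= N)%N -> forall q, \sum_(j | code n j == q) mu' j <= b n.
  move=> nN q; rewrite sumE; case: eqP => [<-|_]; last by rewrite mulr0 addr0 muN.
  rewrite mulr1; have := n0P (Ordinal (nN : (n < N.+1)%N)); rewrite /g /=; lra.
exists mu'; split => //.
  by move=> j; rewrite addr_ge0 // mulr_ge0.
move=> j; rewrite inE => /orP[/eqP ->|/mus[n nN e]].
  exists n0; first by rewrite -ltnS.
  rewrite sumE eqxx mulr1 /g; lra.
exists n => //; apply/eqP; rewrite eq_le muN' //= sumE e lerDl mulr_ge0 //.
Qed.

(* The coarsest saturated cells of the points are pairwise disjoint. *)
Lemma frostman_tree (R : realFieldType) (I : finType) (T : eqType)
    (code : nat -> I -> T) (b : nat -> R) (N : nat) : (forall n, 0 <= b n) ->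
  (forall m n i j, (m <= n)%N -> (n <= N)%N -> code n i = code n j -> code m i = code m j) ->
  exists mu : I -> R, [/\ forall i, 0 <= mu i,
    forall n, (n <= N)%N -> forall q, \sum_(i | code n i == q) mu i <= b n &
    exists l : seq (nat * T),
      (forall i, exists2 p, p \in l & (p.1 <= N)%N /\ code p.1 i = p.2) /\
      \sum_(p <- l) b p.1 <= \sum_i mu i].
Proof.
move=> b0 refine; have [mu [mu0 muN sat]] := frostman_greedy code N b0 (enum I).
exists mu; split => //.
pose P i n := (n <= N)%N && (\sum_(j | code n j == code n i) mu j == b n).
have exP i : exists n, P i n.
  have [|n nN e] := sat i; first by rewrite mem_enum.
  by exists n; rewrite /P nN e eqxx.
pose lev i := ex_minn (exP i).
have levP i : P i (lev i) by rewrite /lev; case: ex_minnP.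
have lev_min i n : P i n -> (lev i <= n)%N by rewrite /lev; case: ex_minnP => k _; apply.
pose l := undup [seq (lev i, code (lev i) i) | i <- enum I].
have inl i : (lev i, code (lev i) i) \in l by rewrite mem_undup map_f // mem_enum.
exists l; split.
  by move=> i; exists (lev i, code (lev i) i) => //=; case/andP: (levP i).
have lP p : p \in l -> exists i, p = (lev i, code (lev i) i).
  by rewrite mem_undup => /mapP[i _ ->]; exists i.
have uniq_block p j : p \in l -> code p.1 j = p.2 -> p = (lev j, code (lev j) j).
  move=> /lP[i ->] /= e.
  have /andP[iN /eqP is_sat] := levP i.
  have h1 : (lev j <= lev i)%N.
    by apply: lev_min; rewrite /P iN e is_sat eqxx.
  have h2 : (lev i <= lev j)%N.
    have /andP[jN /eqP js] := levP j.
    apply: lev_min; rewrite /P jN.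
    by rewrite -(refine _ _ j i h1 iN e) js eqxx.
  have -> : lev i = lev j by apply/eqP; rewrite eqn_leq h1 h2.
  by congr (_, _); have -> : lev j = lev i by apply/eqP; rewrite eqn_leq h1 h2.
apply: (@le_trans _ _ (\sum_(p <- l) \sum_j mu j * (code p.1 j == p.2)%:R)).
  rewrite big_seq [leRHS]big_seq; apply: ler_sum => p pl.
  have [i pE] := lP p pl; rewrite pE /=; have /andP[_ /eqP <-] := levP i.
  rewrite [leLHS]big_mkcond; apply: ler_sum => j _.
  by case: eqP; rewrite ?mulr1 ?mulr0.
rewrite exchange_big; apply: ler_sum => j _; rewrite -mulr_sumr -[leRHS]mulr1.
apply: ler_wpM2l => //.
apply: (@le_trans _ _ (\sum_(p <- l) (p == (lev j, code (lev j) j))%:R)).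
  rewrite big_seq [leRHS]big_seq; apply: ler_sum => p pl.
  case: (eqVneq (code p.1 j) p.2) => // e; by rewrite {1}(uniq_block p j pl e) eqxx.
rewrite -natr_sum lern1.
have -> : (\sum_(p <- l) (p == (lev j, code (lev j) j)) = count_mem (lev j, code (lev j) j) l)%N.
  by rewrite -sum1_count [RHS]big_mkcond; apply: eq_bigr => p _ /=; case: (p == _).
by rewrite count_uniq_mem ?undup_uniq // leq_b1.
Qed.

Lemma finite_representatives (T : Type) (F : finType) (E : T -> Prop) (g : T -> F) :
  exists (I : finType) (pt : I -> T), (forall i, E (pt i)) /\
    forall x, E x -> exists i, g (pt i) = g x.
Proof.
pose P (y : F) := `[< exists2 x, E x & g x = y >].
have ex (y : {y : F | P y}) : exists2 x, E x & g x = val y by case: y => y Py; exact/asboolP.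
pose pt y := s2val (cid2 (ex y)).
exists {y : F | P y}, pt; split; first by move=> y; exact: (s2valP (cid2 (ex y))).
move=> x Ex; have Px : P (g x) by apply/asboolP; exists x.
by exists (exist _ (g x) Px); rewrite /pt (s2valP' (cid2 (ex _))).
Qed.

(** * Dyadic codes of coordinates *)

Section GridCodes.
Variable R : archiRealFieldType.

Lemma floor_refine (m n : nat) (x y : R) : (m <= n)%N ->
  Num.floor (2 ^+ n * x) = Num.floor (2 ^+ n * y) ->
  Num.floor (2 ^+ m * x) = Num.floor (2 ^+ m * y).
Proof.
move=> mn; wlog le : x y / Num.floor (2 ^+ m * x) <= Num.floor (2 ^+ m * y).
  move=> W e; case/orP: (le_total (Num.floor (2 ^+ m * x)) (Num.floor (2 ^+ m * y))) => h.
    exact: W.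
  by apply/esym; exact: W.
move=> e; apply/eqP; rewrite eq_le le /= leNgt; apply/negP => lt.
have pmn : 0 < 2 ^+ (n - m) :> R by rewrite exprn_gt0.
have E (z : R) : 2 ^+ n * z = 2 ^+ (n - m) * (2 ^+ m * z).
  by rewrite mulrA -exprD subnK.
pose k := Num.floor (2 ^+ m * y).
have kx : 2 ^+ m * x < k%:~R.
  have /andP[_ h] := floor_itv (2 ^+ m * x); apply: lt_le_trans h _.
  by rewrite ler_int lezD1.
have ky : k%:~R <= 2 ^+ m * y by exact: floor_le_tmp.
have : Num.floor (2 ^+ n * x) < ((2 ^ (n - m))%:Z * k).
  rewrite floor_lt_int rmorphM /= -[(2 ^ (n - m))%:Z%:~R]pmulrn natrX E ltr_pM2l //.
have : (2 ^ (n - m))%:Z * k <= Num.floor (2 ^+ n * y).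
  by rewrite floor_ge_int rmorphM /= -[(2 ^ (n - m))%:Z%:~R]pmulrn natrX E ler_pM2l.
by rewrite e => a b; have := le_lt_trans a b; rewrite ltxx.
Qed.

Lemma floor_abs_le (N : nat) (x : R) : `|x| <= 1 ->
  (`|Num.floor (2 ^+ N * x)| <= 2 ^ N)%N.
Proof.
rewrite ler_norml => /andP[x1 x2]; have p : 0 < 2 ^+ N :> R by rewrite exprn_gt0.
have h1 : Num.floor (2 ^+ N * x) <= (2 ^ N)%:Z.
  rewrite -(ler_int R) -pmulrn natrX; apply: le_trans (floor_le_tmp _) _.
  by rewrite -[leRHS]mulr1 ler_pM2l.
have h2 : - (2 ^ N)%:Z <= Num.floor (2 ^+ N * x).
  rewrite floor_ge_int rmorphN /= -pmulrn natrX -[leLHS]mulr1 mulNr -mulrN ler_pM2l //.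
lia.
Qed.

(** In units of 2^h the coordinate lies in a half-open window of length 2r + 1, the extra 1 covering
    the rounding at scale N; such a window meets at most 2r + 2 unit intervals. *)
Lemma close_code (n h N r : nat) (f c : R) : (n + h = N)%N ->
  `|(Num.floor (2 ^+ N * f))%:~R - c| <= r%:R * 2 ^+ h ->
  exists t : 'I_(2 * r + 2), Num.floor (2 ^+ n * f) = Num.floor (c / 2 ^+ h) - r%:Z + t%:Z.
Proof.
move=> NE; have ph : 0 < 2 ^+ h :> R by rewrite exprn_gt0.
have ph1 : 1 <= 2 ^+ h :> R by rewrite exprn_ege1 // ler1n.
have E : 2 ^+ N * f = (2 ^+ n * f) * 2 ^+ h by rewrite -NE exprD mulrAC.
have /andP[f1 f2] := floor_itv (2 ^+ N * f).
rewrite rmorphD /= in f2; rewrite ler_norml => /andP[c1 c2].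
pose u := 2 ^+ n * f; pose d := c / 2 ^+ h.
have dE : c = d * 2 ^+ h by rewrite divfK // lt0r_neq0.
have u1 : d - r%:R <= u.
  by rewrite -(ler_pM2r ph) mulrBl -E -dE; lra.
have u2 : u < d + r%:R + 1.
  rewrite -(ltr_pM2r ph) !mulrDl -E -dE; lra.
have /andP[g1 g2] := floor_itv u; have /andP[d1 d2] := floor_itv d.
rewrite !rmorphD /= in g2 d2.
have k1 : Num.floor d - r%:Z < Num.floor u + 1.
  by rewrite -(ltr_int R) rmorphB rmorphD /= -pmulrn; lra.
have k2 : Num.floor u < Num.floor d + r%:Z + 2%:Z.
  by rewrite -(ltr_int R) !rmorphD /= -!pmulrn; lra.
rewrite -/u -/d; move: k1 k2; move: (Num.floor u) (Num.floor d) => fu fd k1 k2.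
have tlt : (absz (fu - fd + r%:Z)%R < 2 * r + 2)%N by clear -k1 k2; lia.
by exists (Ordinal tlt) => /=; clear -k1 k2; lia.
Qed.

Lemma geometric_small (x C del : R) : 0 < x -> x < 1 -> 0 < del ->
  exists n0, forall n, (n0 <= n)%N -> C * x ^+ n <= del.
Proof.
move=> x0 x1 d0.
have y0 : 0 < x^-1 - 1 by rewrite subr_gt0 invf_gt1.
have bern n : 1 + n%:R * (x^-1 - 1) <= x^-1 ^+ n.
  elim: n => [|n IH]; first by rewrite mul0r addr0 expr0.
  rewrite exprS -[n.+1%:R]natr1.
  have n0 : 0 <= n%:R :> R by [].
  have h : x^-1 * (1 + n%:R * (x^-1 - 1)) <= x^-1 * x^-1 ^+ n by rewrite ler_pM2l // invr_gt0.
  apply: le_trans h; move: (x^-1) y0 => z y0.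
  have : 0 <= n%:R * (z - 1) * (z - 1) by rewrite !mulr_ge0 // ltW.
  lra.
pose n0 := (Num.trunc (`|C| / del / (x^-1 - 1))).+1.
exists n0 => n hn.
have z0 : 0 <= `|C| / del / (x^-1 - 1) by rewrite divr_ge0 ?(ltW y0) // divr_ge0 // ltW.
have /andP[_ h] := truncn_itv z0.
have hn' : n0%:R <= n%:R :> R by rewrite ler_nat.
have h2 : `|C| / del / (x^-1 - 1) < n%:R by apply: lt_le_trans hn'.
rewrite ltr_pdivrMr // ltr_pdivrMr // in h2.
have xn : 0 < x ^+ n by rewrite exprn_gt0.
apply: (@le_trans _ _ (`|C| * x ^+ n)); first by rewrite ler_pM2r // ler_norm.
rewrite -ler_pdivlMr //; apply: le_trans (ltW h2) _.
rewrite mulrC ler_pM2l // -exprVn; apply: le_trans (bern n); lra.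
Qed.

End GridCodes.

(** * Determinants of triples *)

Section Determinant3.
Variable R : archiRealFieldType.

Definition det3 (x1 x2 x3 y1 y2 y3 z1 z2 z3 : R) : R :=
  x1 * (y2 * z3 - y3 * z2) - x2 * (y1 * z3 - y3 * z1) + x3 * (y1 * z2 - y2 * z1).

Lemma prod3_lip (a b c a' b' c' del : R) :
  `|b| <= 1 -> `|c| <= 1 -> `|a'| <= 1 -> `|b'| <= 1 ->
  `|a - a'| <= del -> `|b - b'| <= del -> `|c - c'| <= del ->
  `|a * (b * c) - a' * (b' * c')| <= 3 * del.
Proof.
move=> b1 c1 a1' b1' da db dc.
have -> : a * (b * c) - a' * (b' * c') =
  (a - a') * (b * c) + a' * ((b - b') * c) + a' * (b' * (c - c')) by ring.
have h1 : `|(a - a') * (b * c)| <= del * (1 * 1) by rewrite !normrM !ler_pM ?mulr_ge0.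
have h2 : `|a' * ((b - b') * c)| <= 1 * (del * 1) by rewrite !normrM !ler_pM ?mulr_ge0.
have h3 : `|a' * (b' * (c - c'))| <= 1 * (1 * del) by rewrite !normrM !ler_pM ?mulr_ge0.
apply: le_trans (ler_normD _ _) _; apply: le_trans (lerD (ler_normD _ _) (lexx _)) _.
lra.
Qed.

Lemma det3_lip (x1 x2 x3 y1 y2 y3 z1 z2 z3 x1' x2' x3' y1' y2' y3' z1' z2' z3' del : R) :
  [/\ `|x1| <= 1, `|x2| <= 1 & `|x3| <= 1] -> [/\ `|y1| <= 1, `|y2| <= 1 & `|y3| <= 1] ->
  [/\ `|z1| <= 1, `|z2| <= 1 & `|z3| <= 1] ->
  [/\ `|x1'| <= 1, `|x2'| <= 1 & `|x3'| <= 1] -> [/\ `|y1'| <= 1, `|y2'| <= 1 & `|y3'| <= 1] ->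
  [/\ `|x1 - x1'| <= del, `|x2 - x2'| <= del & `|x3 - x3'| <= del] ->
  [/\ `|y1 - y1'| <= del, `|y2 - y2'| <= del & `|y3 - y3'| <= del] ->
  [/\ `|z1 - z1'| <= del, `|z2 - z2'| <= del & `|z3 - z3'| <= del] ->
  `|det3 x1 x2 x3 y1 y2 y3 z1 z2 z3 - det3 x1' x2' x3' y1' y2' y3' z1' z2' z3'| <= 18 * del.
Proof.
move=> [? ? ?] [? ? ?] [? ? ?] [? ? ?] [? ? ?] [? ? ?] [? ? ?] [? ? ?].
have t1 : `|x1 * (y2 * z3) - x1' * (y2' * z3')| <= 3 * del by apply: prod3_lip.
have t2 : `|x1 * (y3 * z2) - x1' * (y3' * z2')| <= 3 * del by apply: prod3_lip.
have t3 : `|x2 * (y1 * z3) - x2' * (y1' * z3')| <= 3 * del by apply: prod3_lip.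
have t4 : `|x2 * (y3 * z1) - x2' * (y3' * z1')| <= 3 * del by apply: prod3_lip.
have t5 : `|x3 * (y1 * z2) - x3' * (y1' * z2')| <= 3 * del by apply: prod3_lip.
have t6 : `|x3 * (y2 * z1) - x3' * (y2' * z1')| <= 3 * del by apply: prod3_lip.
rewrite /det3 !mulrBr.
move: t1 t2 t3 t4 t5 t6; clear.
move: (x1 * (y2 * z3)) (x1' * (y2' * z3')) (x1 * (y3 * z2)) (x1' * (y3' * z2'))
  (x2 * (y1 * z3)) (x2' * (y1' * z3')) (x2 * (y3 * z1)) (x2' * (y3' * z1'))
  (x3 * (y1 * z2)) (x3' * (y1' * z2')) (x3 * (y2 * z1)) (x3' * (y2' * z1')).
move=> a1 b1 a2 b2 a3 b3 a4 b4 a5 b5 a6 b6; clear.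
rewrite !ler_norml => /andP[? ?] /andP[? ?] /andP[? ?] /andP[? ?] /andP[? ?] /andP[? ?].
by apply/andP; split; lra.
Qed.

(** Adding multiples of the second and third coordinates to the first preserves the determinant,
    which is then expanded along the new first coordinate. *)
Lemma det3_via_plane (x1 x2 x3 y1 y2 y3 z1 z2 z3 a b : R) :
  det3 x1 x2 x3 y1 y2 y3 z1 z2 z3 =
  (x1 + a * x2 + b * x3) * (y2 * z3 - y3 * z2) - (y1 + a * y2 + b * y3) * (x2 * z3 - x3 * z2)
  + (z1 + a * z2 + b * z3) * (x2 * y3 - x3 * y2).
Proof. by rewrite /det3; ring. Qed.

Lemma minor_le (u v w z : R) : `|u| <= 1 -> `|v| <= 1 -> `|w| <= 1 -> `|z| <= 1 ->
  `|u * v - w * z| <= 2.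
Proof.
move=> *; have h1 : `|u * v| <= 1 * 1 by rewrite normrM ler_pM.
have h2 : `|w * z| <= 1 * 1 by rewrite normrM ler_pM.
by apply: le_trans (ler_normB _ _) _; lra.
Qed.

End Determinant3.

(** * Values of determinants in three dimensions *)

Section ThreeDimensions.
Variables (R : archiRealFieldType) (T : Type) (E : T -> Prop) (f1 f2 f3 : T -> R).

Definition grid_code (n : nat) (x : T) : int * int * int :=
  (Num.floor (2 ^+ n * f1 x), Num.floor (2 ^+ n * f2 x), Num.floor (2 ^+ n * f3 x)).

Lemma grid_code_refine m n x y : (m <= n)%N -> grid_code n x = grid_code n y ->
  grid_code m x = grid_code m y.
Proof.
move=> mn [e1 e2 e3]; rewrite /grid_code.
by rewrite (floor_refine mn e1) (floor_refine mn e2) (floor_refine mn e3).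
Qed.

Hypothesis f_le1 : forall x, E x -> [/\ `|f1 x| <= 1, `|f2 x| <= 1 & `|f3 x| <= 1].

Lemma grid_representatives (N : nat) : exists (I : finType) (pt : I -> T),
  (forall i, E (pt i)) /\ forall x, E x -> exists i, grid_code N (pt i) = grid_code N x.
Proof.
pose F : finType := ('I_(2 ^ N + 2 ^ N).+1 * 'I_(2 ^ N + 2 ^ N).+1 * 'I_(2 ^ N + 2 ^ N).+1)%type.
pose h (f : T -> R) x : 'I_(2 ^ N + 2 ^ N).+1 :=
  inord (absz (Num.floor (2 ^+ N * f x) + (2 ^ N)%:Z)%R).
pose g x : F := (h f1 x, h f2 x, h f3 x).
have hinj (f : T -> R) x y : `|f x| <= 1 -> `|f y| <= 1 -> h f x = h f y ->
    Num.floor (2 ^+ N * f x) = Num.floor (2 ^+ N * f y).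
  move=> /(floor_abs_le N) fx /(floor_abs_le N) fy /(congr1 val) /=.
  move: fx fy; rewrite /h; move: (Num.floor _) (Num.floor _) => u v fx fy.
  by rewrite !inordK; lia.
have [I [pt [Ept ptP]]] := finite_representatives E g.
exists I, pt; split => // x Ex; have [i [e1 e2 e3]] := ptP x Ex.
exists i; have [a1 a2 a3] := f_le1 (Ept i); have [b1 b2 b3] := f_le1 Ex.
by rewrite /grid_code (hinj f1 _ _ a1 b1 e1) (hinj f2 _ _ a2 b2 e2) (hinj f3 _ _ a3 b3 e3).
Qed.

Variables (chi c kap0 : R).
Hypotheses (chi_ge : 9 / 10 <= chi) (chi_lt1 : chi < 1) (c_gt0 : 0 < c) (kap0_gt0 : 0 < kap0).
Hypothesis f2_dom : forall x, E x -> [/\ kap0 <= f2 x, `|f1 x| <= f2 x & `|f3 x| <= f2 x].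
Hypothesis content : forall l : seq (nat * (int * int * int)),
  (forall x, E x -> exists2 p, p \in l & grid_code p.1 x = p.2) ->
  c <= \sum_(p <- l) (chi ^+ 3 / 4) ^+ p.1.

Definition ball_const (r : nat) : R := ((2 * r + 2) ^ 3)%N%:R.

(** The saturated cells of [frostman_tree] cover the representatives, hence all of [E], and
    [content] bounds the mass below. A ball meets at most (2r+2)^3 cells of its scale. *)
Lemma discrete_frostman (N : nat) : exists (I : finType) (pt : I -> T) (mu : I -> R),
  [/\ forall i, E (pt i), forall i, 0 <= mu i, c <= \sum_i mu i &
   forall (r h : nat) (c1 c2 c3 : R), (h <= N)%N ->
  \sum_(i | [&& `|(Num.floor (2 ^+ N * f1 (pt i)))%:~R - c1| <= r%:R * 2 ^+ h,
      `|(Num.floor (2 ^+ N * f2 (pt i)))%:~R - c2| <= r%:R * 2 ^+ h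
      & `|(Num.floor (2 ^+ N * f3 (pt i)))%:~R - c3| <= r%:R * 2 ^+ h]) mu i
    <= ball_const r * (chi ^+ 3 / 4) ^+ (N - h)].
Proof.
have chi0 : 0 <= chi by have := chi_ge; lra.
have b0 n : 0 <= (chi ^+ 3 / 4) ^+ n.
  by rewrite exprn_ge0 // divr_ge0 // exprn_ge0.
have [I [pt [Ept ptP]]] := grid_representatives N.
have [mu [mu0 muN [l [cov le]]]] := @frostman_tree R I _ (fun n i => grid_code n (pt i))
  (fun n => (chi ^+ 3 / 4) ^+ n) N b0
  (fun m n i j mn _ e => grid_code_refine mn e).
exists I, pt, mu; split => //.
  apply: le_trans le; apply: content => x Ex.
  have [i e] := ptP x Ex; have [p pl [pN pE]] := cov i.
  by exists p => //; rewrite -pE; apply/esym; exact: grid_code_refine pN e.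
move=> r h c1 c2 c3 hN.
set n := (N - h)%N; have nh : (n + h = N)%N by rewrite subnK.
pose cell (t : 'I_(2 * r + 2) * 'I_(2 * r + 2) * 'I_(2 * r + 2)) : int * int * int :=
  (Num.floor (c1 / 2 ^+ h) - r%:Z + t.1.1%:Z, Num.floor (c2 / 2 ^+ h) - r%:Z + t.1.2%:Z,
   Num.floor (c3 / 2 ^+ h) - r%:Z + t.2%:Z).
apply: (@le_trans _ _ (\sum_t \sum_(i | grid_code n (pt i) == cell t) mu i)).
  under [leRHS]eq_bigr => t _ do rewrite big_mkcond.
  rewrite exchange_big big_mkcond; apply: ler_sum => i _ /=.
  have s0 : 0 <= \sum_t (if grid_code n (pt i) == cell t then mu i else 0).
    by apply: sumr_ge0 => t _; case: ifP.
  case: and3P => // -[/(close_code nh)[t1 e1] /(close_code nh)[t2 e2] /(close_code nh)[t3 e3]].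
  rewrite (bigD1 (t1, t2, t3)) //= ifT; last by rewrite /grid_code /cell e1 e2 e3.
  by rewrite lerDl; apply: sumr_ge0 => t _; case: ifP.
apply: (@le_trans _ _ (\sum_(t : 'I_(2 * r + 2) * 'I_(2 * r + 2) * 'I_(2 * r + 2)) (chi ^+ 3 / 4) ^+ n)).
  by apply: ler_sum => t _; apply: muN; rewrite /n leq_subr.
rewrite sumr_const !card_prod !card_ord -[leLHS]mulr_natl /ball_const.
by rewrite !expnS expn0 muln1 mulnA.
Qed.

Lemma floor_frac (N : nat) (x : R) :
  `|x - (Num.floor (2 ^+ N * x))%:~R / 2 ^+ N| <= (1 / 2) ^+ N.
Proof.
have p : 0 < 2 ^+ N :> R by rewrite exprn_gt0.
have /andP[h1 h2] := floor_itv (2 ^+ N * x); rewrite rmorphD /= in h2.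
rewrite expr_div_n expr1n -(ler_pM2r p) -[X in _ * X <= _](gtr0_norm p) -normrM.
rewrite mulrBl divfK ?lt0r_neq0 // divfK ?lt0r_neq0 // mulrC.
by rewrite ler_norml; apply/andP; split; lra.
Qed.

Lemma floor_frac_le1 (N : nat) (x : R) : `|x| <= 1 ->
  `|(Num.floor (2 ^+ N * x))%:~R / 2 ^+ N| <= 1 :> R.
Proof.
move=> /(floor_abs_le N) h; have p : 0 < 2 ^+ N :> R by rewrite exprn_gt0.
by rewrite normrM normfV (gtr0_norm p) ler_pdivrMr // mul1r int_abs_le.
Qed.

Lemma floor_dominated (N : nat) (x y : R) : `|x| <= y ->
  `|(Num.floor (2 ^+ N * x))%:~R| <= (Num.floor (2 ^+ N * y))%:~R + 1 :> R.
Proof.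
rewrite ler_norml => /andP[h1 h2]; have p : 0 < 2 ^+ N :> R by rewrite exprn_gt0.
have /andP[a1 a2] := floor_itv (2 ^+ N * x); have /andP[b1 b2] := floor_itv (2 ^+ N * y).
have m1 : 2 ^+ N * x <= 2 ^+ N * y by rewrite ler_pM2l.
have m2 : 2 ^+ N * (- y) <= 2 ^+ N * x by rewrite ler_pM2l.
move: a1 a2 b1 b2; move: (Num.floor (2 ^+ N * x)) (Num.floor (2 ^+ N * y)) => u v a1 a2 b1 b2.
have k1 : u < v + 1 by rewrite -(ltr_int R); apply: le_lt_trans b2; lra.
have k2 : - v - 2%:Z < u.
  rewrite -(ltr_int R) rmorphB rmorphN /= -pmulrn; rewrite !rmorphD /= in a2 b2.
  by lra.
rewrite -[1]/(1%:~R) -rmorphD -intr_norm ler_int; clear -k1 k2; lia.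
Qed.

(** [j0] and [n1] depend only on the Frostman constants, so [ell] is fixed before [eps]; only the
    scale [N] follows [eps]. *)
Lemma det3_values : exists2 ell : R, 0 < ell & forall r, 0 <= r -> r <= ell ->
  forall eps, 0 < eps -> exists x y z, [/\ E x, E y, E z &
    `| `|det3 (f1 x) (f2 x) (f3 x) (f1 y) (f2 y) (f3 y) (f1 z) (f2 z) (f3 z)| - r| <= eps].
Proof.
have c9 := chi_ge; have c1 := chi_lt1; have chi0 : 0 < chi by lra.
(* Half of [kap0] leaves room for rounding the second coordinate down. *)
pose kap := kap0 / 2; have kap_gt0 : 0 < kap by rewrite divr_gt0.
pose rk := (Num.trunc (7 / kap + 2)).+1.
have rk_ge : 7 / kap + 2 <= rk%:R.
  have h : 0 <= 7 / kap + 2 by rewrite addr_ge0 // divr_ge0 // ltW.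
  by have /andP[_ /ltW] := truncn_itv h.
pose c2 := c / (2 * wsq R).
have c8 : 0 < c / 8 by rewrite divr_gt0.
have [j0 hj0] := geometric_small (c2^-1 * pair_const chi ball_const kap rk) chi0 c1 c8.
have [n1 hn1] := geometric_small
  (16 / (c2 * (1 - chi) ^+ 2) * (energy_const ball_const / (1 - chi))) chi0 c1 c8.
(* The minor is at least 2^-j0 and the form reaches values up to 2^-n1 / 2; a 4 in place of 2 gives
   strict inequality. *)
pose ell : R := (1 / 2) ^+ j0 * (1 / 2) ^+ n1 / 4.
have half0 n : 0 < (1 / 2) ^+ n :> R by rewrite exprn_gt0 // divr_gt0.
exists ell; first by rewrite divr_gt0 // mulr_gt0.
move=> r r0 rl eps eps0.
have hlf0 : 0 < 1 / 2 :> R by rewrite divr_gt0.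
have hlf1 : 1 / 2 < 1 :> R by lra.
have [N1 hN1] := geometric_small 8 hlf0 hlf1 kap_gt0.
have [N2 hN2] := geometric_small 24 hlf0 hlf1 eps0.
(* [N1] ensures kap * 2^N >= 8; [N2] makes the total error 24 * 2^-N at most [eps], where 24 = 18 +
   3 * 2: rounding of the nine coordinates, and three products of a form error with a 2 x 2
   minor. *)
pose N := (j0 + n1 + N1 + N2)%N.
have jN : (j0 <= N)%N by rewrite /N -!addnA leq_addr.
have nN : (n1 <= N)%N by rewrite /N; clear; lia.
have kapN : 8 * (1 / 2) ^+ N <= kap by apply: hN1; rewrite /N; clear; lia.
have epsN : 24 * (1 / 2) ^+ N <= eps by apply: hN2; rewrite /N leq_addl.
have pN : 0 < 2 ^+ N :> R by rewrite exprn_gt0.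
have hpN : (1 / 2) ^+ N * 2 ^+ N = 1 :> R.
  by rewrite -exprMn mul1r mulVf ?expr1n // pnatr_eq0.
have kap8 : 8 <= kap * 2 ^+ N.
  by move: kapN; rewrite -(ler_pM2r pN) -mulrA hpN mulr1.
have [I [pt [mu [Ept mu0 cmu ball]]]] := discrete_frostman N.
pose X1 i := Num.floor (2 ^+ N * f1 (pt i)).
pose X2 i := Num.floor (2 ^+ N * f2 (pt i)).
pose X3 i := Num.floor (2 ^+ N * f3 (pt i)).
have Xb i : [/\ (`|X1 i| <= 2 ^ N)%N, (`|X2 i| <= 2 ^ N)%N & (`|X3 i| <= 2 ^ N)%N].
  by have [? ? ?] := f_le1 (Ept i); split; apply: floor_abs_le.
have kapX i : kap * 2 ^+ N <= (X2 i)%:~R.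
  have [h _ _] := f2_dom (Ept i).
  have /andP[_ h2] := floor_itv (2 ^+ N * f2 (pt i)); rewrite rmorphD /= -/(X2 i) in h2.
  have : 2 ^+ N * (2 * kap) <= 2 ^+ N * f2 (pt i).
    by rewrite ler_pM2l // /kap mulrCA divff ?mulr1 // pnatr_eq0.
  lra.
have X8 i : 8 <= (X2 i)%:~R :> R by apply: le_trans kap8 _; exact: kapX.
have X13 i : `|(X1 i)%:~R| <= (X2 i)%:~R + 1 :> R /\ `|(X3 i)%:~R| <= (X2 i)%:~R + 1 :> R.
  by have [_ h1 h3] := f2_dom (Ept i); split; apply: floor_dominated.
have Hp : c2^-1 * (pair_const chi ball_const kap rk * chi ^+ j0) <= c / 8.
  by rewrite mulrA; apply: hj0.
have Ht : 16 / (c2 * (1 - chi) ^+ 2) * (energy_const ball_const * (chi ^+ n1 / (1 - chi))) <= c / 8.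
  rewrite [X in _ * X](_ : _ = energy_const ball_const / (1 - chi) * chi ^+ n1); last by rewrite mulrA mulrAC.
  by rewrite mulrA; apply: hn1.
have [A [B [s [_ _ s1 [i [j [Fi Fj oij]]] hit]]]] :=
  @plane_through_cloud R I mu X1 X2 X3 chi ball_const N chi_ge chi_lt1 mu0 Xb ball kap
   kap_gt0 kapX X8 X13 rk rk_ge c j0 n1 c_gt0 cmu jN nN Hp Ht.
pose g (X : I -> int) i := (X i)%:~R / 2 ^+ N : R.
pose m := g X2 i * g X3 j - g X3 i * g X2 j.
have mE : `|m| = `|om R X2 X3 i j| / 4 ^+ N.
  have -> : 4 ^+ N = 2 ^+ N * 2 ^+ N :> R by rewrite -exprMn; congr (_ ^+ _); ring.
  rewrite -[X in _ = _ / X](gtr0_norm (mulr_gt0 pN pN)) -normfV -normrM -normrN; congr `|_|.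
  by rewrite /m /om /g; field; rewrite lt0r_neq0.
have mlow : (1 / 2) ^+ j0 <= `|m|.
  rewrite mE ler_pdivlMr ?exprn_gt0 //; apply: le_trans (ltW oij).
  have -> : 4 ^+ N = 2 ^+ j0 * 2 ^+ (2 * N - j0) :> R.
    rewrite -exprD subnKC; last by rewrite (leq_trans jN) // leq_pmull.
    by rewrite exprM; congr (_ ^+ _); ring.
  by rewrite mulrA -exprMn mul1r mulVf ?pnatr_eq0 // expr1n mul1r.
have m0 : 0 < `|m| by apply: lt_le_trans (half0 j0) mlow.
(* The value of the form, in lattice units, whose product with the minor [m] has modulus [r]. *)
pose rho := 2 ^+ N * (r / `|m|).
have rho0 : 0 <= rho by rewrite mulr_ge0 ?divr_ge0 // ltW.
have rho1 : rho < 2 ^+ (N - n1) / 2.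
  have h : r / `|m| <= (1 / 2) ^+ n1 / 4.
    rewrite ler_pdivrMr //; apply: le_trans rl _.
    have : (1 / 2) ^+ n1 / 4 * (1 / 2) ^+ j0 <= (1 / 2) ^+ n1 / 4 * `|m|.
      by rewrite ler_wpM2l // divr_ge0 // ltW.
    by rewrite /ell => h; apply: le_trans h; apply: le_of_eq; ring.
  have E2 : 2 ^+ N = 2 ^+ (N - n1) * 2 ^+ n1 :> R by rewrite -exprD subnK.
  apply: (@le_lt_trans _ _ (2 ^+ N * ((1 / 2) ^+ n1 / 4))); first by rewrite ler_pM2l.
  have e : 2 ^+ n1 * (1 / 2) ^+ n1 = 1 :> R by rewrite -exprMn mul1r divff ?expr1n // pnatr_eq0.
  rewrite mulrA E2 -(mulrA _ (2 ^+ n1)) e mulr1.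
  have : 0 < 2 ^+ (N - n1) :> R by rewrite exprn_gt0.
  by move=> z0; rewrite ltr_pM2l // ltf_pV2 ?posrE // ltr_nat.
have [k Fk] := hit rho rho0 rho1.
have gf (f : T -> R) (X : I -> int) (t : I) : X t = Num.floor (2 ^+ N * f (pt t)) ->
    `|f (pt t) - g X t| <= (1 / 2) ^+ N by move=> e; rewrite /g e; exact: floor_frac.
have g1 (f : T -> R) (X : I -> int) (t : I) : X t = Num.floor (2 ^+ N * f (pt t)) ->
    `|f (pt t)| <= 1 -> `|g X t| <= 1 by move=> e h; rewrite /g e; exact: floor_frac_le1.
have G1 t : [/\ `|g X1 t| <= 1, `|g X2 t| <= 1 & `|g X3 t| <= 1].
  have [a1 a2 a3] := f_le1 (Ept t).
  by split; [apply: (g1 f1) | apply: (g1 f2) | apply: (g1 f3)].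
have GF t : [/\ `|f1 (pt t) - g X1 t| <= (1 / 2) ^+ N, `|f2 (pt t) - g X2 t| <= (1 / 2) ^+ N &
    `|f3 (pt t) - g X3 t| <= (1 / 2) ^+ N] by split; apply: gf.
exists (pt i), (pt j), (pt k); split => //.
have lip := det3_lip (f_le1 (Ept i)) (f_le1 (Ept j)) (f_le1 (Ept k)) (G1 i) (G1 j) (GF i) (GF j) (GF k).
pose Fg t := g X1 t + A * g X2 t + B * g X3 t.
have FgE t : Fg t = ((X1 t)%:~R + A * (X2 t)%:~R + B * (X3 t)%:~R) / 2 ^+ N.
  by rewrite /Fg /g; ring.
have Fsmall t z : `|(X1 t)%:~R + A * (X2 t)%:~R + B * (X3 t)%:~R - z| <= 1 ->
    `|Fg t - z / 2 ^+ N| <= (1 / 2) ^+ N.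
  move=> h; rewrite FgE -mulrBl normrM normfV (gtr0_norm pN) ler_pdivrMr //.
  by rewrite hpN.
have Fi' : `|Fg i| <= (1 / 2) ^+ N by have := Fsmall i 0; rewrite mul0r !subr0; apply.
have Fj' : `|Fg j| <= (1 / 2) ^+ N by have := Fsmall j 0; rewrite mul0r !subr0; apply.
have Fk' := Fsmall k _ Fk.
have dE := det3_via_plane (g X1 i) (g X2 i) (g X3 i) (g X1 j) (g X2 j) (g X3 j)
  (g X1 k) (g X2 k) (g X3 k) A B.
rewrite -/(Fg i) -/(Fg j) -/(Fg k) -/m in dE.
pose v := s * rho / 2 ^+ N * m.
have vE : `|v| = r.
  have sn : `|s| = 1 by case: s1 => ->; rewrite ?normrN1 ?normr1.
  rewrite /v normrM normrM normrM sn mul1r normfV (gtr0_norm pN) (ger0_norm rho0) /rho.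
  by field; rewrite !lt0r_neq0.
have [G1i1 G1i2 G1i3] := G1 i; have [G1j1 G1j2 G1j3] := G1 j; have [G1k1 G1k2 G1k3] := G1 k.
have t1 : `|Fg i * (g X2 j * g X3 k - g X3 j * g X2 k)| <= (1 / 2) ^+ N * 2.
  by rewrite normrM ler_pM // minor_le.
have t2 : `|Fg j * (g X2 i * g X3 k - g X3 i * g X2 k)| <= (1 / 2) ^+ N * 2.
  by rewrite normrM ler_pM // minor_le.
have t3 : `|(Fg k - s * rho / 2 ^+ N) * m| <= (1 / 2) ^+ N * 2.
  by rewrite normrM ler_pM // minor_le.
rewrite mulrBl -/v in t3.
apply: le_trans epsN; move: lip; rewrite dE -vE; clear -t1 t2 t3.
move: (det3 _ _ _ _ _ _ _ _ _) t1 t2 t3 => d.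
move: (Fg i * _) (Fg j * _) (Fg k * m) v => a b e w t1 t2 t3 lip.
apply: le_trans (ler_dist_dist _ _) _.
rewrite !ler_norml in t1 t2 t3 lip *.
by move: t1 t2 t3 lip => /andP[? ?] /andP[? ?] /andP[? ?] /andP[? ?]; apply/andP; split; lra.
Qed.

End ThreeDimensions.

(** * Reduction to three dimensions *)

Section Fat.
Variable R : archiRealFieldType.

Definition small_cells (d : nat) (D : R) (I : Type) (n : I -> nat) (U : I -> 'cV[R]_d -> Prop) :=
  forall i x y, U i x -> U i y -> forall k, `|x k 0 - y k 0| <= D / 2 ^+ n i.

(* Positive Hausdorff content of exponent s, where b = 2^-s; letting D vary makes the notion
   invariant under linear isomorphisms. *)
Definition fat (d : nat) (b : R) (E : 'cV[R]_d -> Prop) :=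
  forall D : R, 0 < D -> exists2 c, 0 < c & forall (I : finType) (n : I -> nat)
    (U : I -> 'cV[R]_d -> Prop), small_cells D n U -> (forall x, E x -> exists i, U i x) ->
    c <= \sum_i b ^+ n i.

Definition coord_bounded (d : nat) (M : R) (E : 'cV[R]_d -> Prop) :=
  forall x, E x -> forall k, `|x k 0| <= M.

Definition det_of (d : nat) (x : 'I_d -> 'cV[R]_d) : R := \det (\matrix_(i, j) x j i 0).

Definition volumes_dense (d : nat) (E : 'cV[R]_d -> Prop) :=
  exists2 ell : R, 0 < ell & forall r, 0 <= r -> r <= ell -> forall eps, 0 < eps ->
    exists x : 'I_d -> 'cV[R]_d, (forall j, E (x j)) /\ `| `|det_of x| - r| <= eps.

(** The origin alone is covered by one cell of arbitrarily small cost b^n. *)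
Lemma fat_nonzero d b (E : 'cV[R]_d -> Prop) : 0 < b -> b < 1 -> fat b E ->
  exists2 x, E x & x != 0.
Proof.
move=> b0 b1 /(_ 1 ltr01)[c c0 hc]; apply: contrapT => nex.
have c2 : 0 < c / 2 by rewrite divr_gt0.
have [n0 h] := geometric_small 1 b0 b1 c2.
have := hc unit (fun=> n0) (fun _ x => x = 0).
have -> : \sum_(i : unit) b ^+ n0 = b ^+ n0 by rewrite big_const card_unit /= addr0.
have := h n0 (leqnn _); rewrite mul1r => hb H.
have : c <= b ^+ n0.
  apply: H.
    move=> i x y -> -> k; rewrite subrr normr0 divr_ge0 // exprn_ge0 //.
  by move=> x Ex; exists tt; apply/eqP; apply: contrapT => /negP x0; apply: nex; exists x.
lra.
Qed.

Lemma mulmx_coord_le (d : nat) (C : 'M[R]_d) (kap M : R) (x : 'cV[R]_d) :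
  0 <= M -> (forall i j, `|C i j| <= kap) -> (forall k, `|x k 0| <= M) ->
  forall k, `|(C *m x) k 0| <= d%:R * (kap * M).
Proof.
move=> M0 hC hx k; rewrite mxE; apply: le_trans (ler_norm_sum _ _ _) _.
apply: (@le_trans _ _ (\sum_(j < d) kap * M)).
  by apply: ler_sum => j _; rewrite normrM ler_pM.
by rewrite sumr_const card_ord mulr_natl.
Qed.

Lemma mx_bound (d : nat) (C : 'M[R]_d) : exists2 kap : R, 0 < kap & forall i j, `|C i j| <= kap.
Proof.
exists (1 + \sum_i \sum_j `|C i j|).
  by rewrite ltr_pwDl // sumr_ge0 // => i _; rewrite sumr_ge0.
move=> i j; rewrite (bigD1 i) //= (bigD1 j) //=.
have h1 : 0 <= \sum_(i0 | i0 != i) \sum_j0 `|C i0 j0| by apply: sumr_ge0 => ? _; apply: sumr_ge0.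
have h2 : 0 <= \sum_(i0 | i0 != j) `|C i i0| by apply: sumr_ge0.
lra.
Qed.

Lemma normalizing_mx (d : nat) (x : 'cV[R]_(1 + d)) : x != 0 ->
  exists (P : 'M[R]_(1 + d)) (a : R), [/\ P \in unitmx, a != 0 &
    P *m x = col_mx a%:M 0].
Proof.
move=> x0; have r1 : \rank x = 1%N.
  by apply/eqP; rewrite eqn_leq rank_leq_col lt0n mxrank_eq0.
exists (invmx (col_ebase x)), (row_ebase x 0 0); split.
- by rewrite unitmx_inv col_ebase_unit.
- have := row_ebase_unit x; rewrite unitmxE det_mx11 unitfE //.
rewrite -[X in _ *m X]mulmx_ebase r1 -mulmxA mulKmx ?col_ebase_unit //.
apply/matrixP => i j; rewrite !mxE big_ord1 !mxE ord1.
case: splitP => k ->.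
  by rewrite !ord1 mxE eqxx /= mulr1n mul1r.
by rewrite andbF mul0r mxE.
Qed.

(** * Projection along a point of the set *)

Section Slice.
Variables (d : nat) (E : 'cV[R]_(1 + d) -> Prop) (P : 'M[R]_(1 + d)).
Hypothesis Pu : P \in unitmx.

(** A projection rather than a section: in the application [P] sends a point of [E] to the first
    axis, and that axis is forgotten. *)
Definition slice (z : 'cV[R]_d) : Prop := exists2 y, E y & z = dsubmx (P *m y).

Lemma slice_bounded M : 0 <= M -> coord_bounded M E ->
  exists2 M', 0 <= M' & coord_bounded M' slice /\
    (forall y, E y -> forall k, `|(P *m y) k 0| <= M').
Proof.
move=> M0 bE; have [kap k0 hk] := mx_bound P.
exists ((1 + d)%:R * (kap * M)); first by rewrite !mulr_ge0 // ltW.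
have h y : E y -> forall k, `|(P *m y) k 0| <= (1 + d)%:R * (kap * M).
  by move=> Ey; apply: mulmx_coord_le => //; exact: bE.
by split => // z [y Ey ->] k; rewrite mxE; apply: h.
Qed.

(** Over a cell of size 2^-n the bounded set is cut into 2 * M2 * 2^n layers of thickness 2^-n, so a
    cover of the projection with cost sum of (2b)^n lifts to a cover of [E] with cost a constant
    times it: the exponent drops by one. *)
Lemma slice_fat b M : 0 <= b -> 0 <= M -> coord_bounded M E -> fat b E -> fat (2 * b) slice.
Proof.
move=> b0 M0 bE fE D D0.
have [M' M'0 [_ hP]] := slice_bounded M0 bE.
have [kap k0 hk] := mx_bound (invmx P).
pose D1 := (1 + d)%:R * (kap * (D + 1)).
have D10 : 0 < D1 by rewrite mulr_gt0 ?ltr0n // mulr_gt0 // ltr_wpDl // ltW.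
have [c c0 hc] := fE D1 D10.
pose M2 := (Num.trunc M').+1.
have M'2 : M' < M2%:R by have /andP[] := truncn_itv M'0.
have M20 : 0 < (2 * M2 + 1)%:R :> R by rewrite ltr0n addn1.
exists (c / (2 * M2 + 1)%:R); first by rewrite divr_gt0.
move=> I n U sU cov.
pose J (i : I) := 'I_((2 * M2) * 2 ^ n i).
pose n' (p : {i : I & J i}) := n (tag p).
pose U' (p : {i : I & J i}) y := [/\ U (tag p) (dsubmx (P *m y)),
  (tagged p)%:R / 2 ^+ n (tag p) <= (P *m y) 0 0 + M2%:R &
  (P *m y) 0 0 + M2%:R <= ((tagged p)%:R + 1) / 2 ^+ n (tag p)].
have sU' : small_cells D1 n' U'.
  move=> [i j] y y' /= [u1 v1 w1] [u2 v2 w2] k; rewrite /n' /=.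
  have p : 0 < 2 ^+ n i :> R by rewrite exprn_gt0.
  have -> : y k 0 - y' k 0 = (invmx P *m (P *m (y - y'))) k 0 by rewrite mulKmx // !mxE.
  have hz l : `|(P *m (y - y')) l 0| <= (D + 1) / 2 ^+ n i.
    rewrite mulmxBr; move: u1 v1 w1 u2 v2 w2; move: (P *m y) (P *m y') => z z' u1 v1 w1 u2 v2 w2.
    have -> : (z - z') l 0 = z l 0 - z' l 0 by rewrite !mxE.
    have t0 : 0 <= D / 2 ^+ n i by rewrite divr_ge0 ?ltW.
    rewrite -(splitK l); case: (split l) => k' /=.
      rewrite (_ : lshift d k' = 0); last by rewrite (ord1 k'); exact: val_inj.
      move: v1 w1 v2 w2; rewrite !mulrDl !mul1r => v1 w1 v2 w2.
      by rewrite ler_norml; apply/andP; split; lra.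
    have := sU i _ _ u1 u2 k'; rewrite !mxE => h; apply: le_trans h _.
    by rewrite ler_pM2r ?invr_gt0 // lerDl.
  have e0 : 0 <= (D + 1) / 2 ^+ n i by rewrite divr_ge0 ?ltW // ltr_wpDl // ltW.
  have := mulmx_coord_le e0 hk hz k.
  by rewrite /D1 !mulrA.
have cov' x : E x -> exists p, U' p x.
  move=> Ex; have [i Ui] := cov (dsubmx (P *m x)) ltac:(by exists x).
  have p : 0 < 2 ^+ n i :> R by rewrite exprn_gt0.
  have := hP x Ex 0; rewrite ler_norml => /andP[x1 x2].
  have y0 : 0 <= ((P *m x) 0 0 + M2%:R) * 2 ^+ n i by rewrite mulr_ge0 ?(ltW p) //; lra.
  have /andP[t1 t2] := truncn_itv y0.
  have tJ : (Num.trunc (((P *m x) 0 0 + M2%:R) * 2 ^+ n i)%R < (2 * M2) * 2 ^ n i)%N.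
    rewrite -(ltr_nat R); apply: le_lt_trans t1 _.
    by rewrite !natrM natrX ltr_pM2r //; lra.
  exists (Tagged J (Ordinal tJ)); rewrite /U' /=; split => //.
    by rewrite ler_pdivrMr.
  by rewrite ler_pdivlMr // natr1 ltW.
have := hc _ n' U' sU' cov'.
rewrite ler_pdivrMr // => h; apply: le_trans h _.
rewrite [leLHS](_ : _ = \sum_i \sum_(j : J i) b ^+ n i); last first.
  by rewrite (sig_big_dep _ _ (fun i (j : J i) => b ^+ n i)).
rewrite mulr_suml; apply: ler_sum => i _.
have pb : 0 <= 2 ^+ n i * b ^+ n i by rewrite mulr_ge0 ?exprn_ge0.
rewrite sumr_const card_ord -[leLHS]mulr_natl [X in X * _ <= _]natrM natrX exprMn -mulrA mulrC.
by rewrite ler_wpM2l // ler_nat leq_addr.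
Qed.

Variables (x : 'cV[R]_(1 + d)) (a : R).
Hypotheses (Ex : E x) (a0 : a != 0) (Px : P *m x = col_mx a%:M 0).

Definition extend (y : 'I_d -> 'cV[R]_(1 + d)) (k : 'I_(1 + d)) : 'cV[R]_(1 + d) :=
  match split k with inl _ => x | inr j => y j end.

(** After multiplication by [P] the matrix is block upper triangular, because its first column is
    (a, 0). *)
Lemma det_extend y : \det P * det_of (extend y) = a * det_of (fun j => dsubmx (P *m y j)).
Proof.
rewrite /det_of -det_mulmx.
pose Y : 'M[R]_(1 + d, d) := \matrix_(i, j) y j i 0.
have -> : \matrix_(i, j) extend y j i 0 = row_mx x Y.
  apply/matrixP => i j; rewrite !mxE /extend; case: (split j) => k; last by rewrite mxE.
  by rewrite (ord1 k).
have -> : \matrix_(i, j) dsubmx (P *m y j) i 0 = dsubmx (P *m Y).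
  apply/matrixP => i j; rewrite !mxE; apply: eq_bigr => k _; by rewrite !mxE.
rewrite mul_mx_row Px -[P *m Y]vsubmxK -block_mxEh det_ublock.
by rewrite det_scalar1 col_mxKd.
Qed.

Lemma slice_volumes : volumes_dense slice -> volumes_dense E.
Proof.
move=> [ell ell0 h].
have dP : \det P != 0 by rewrite -unitfE -unitmxE.
pose q := `|a / \det P|; have q0 : 0 < q by rewrite normr_gt0 mulf_neq0 // invr_eq0.
exists (q * ell) => [|r r0 rl eps eps0]; first by rewrite mulr_gt0.
have r0' : 0 <= r / q by rewrite divr_ge0 // ltW.
have rl' : r / q <= ell by rewrite ler_pdivrMr // mulrC.
have e0' : 0 < eps / q by rewrite divr_gt0.
have [z [zS hz]] := h (r / q) r0' rl' (eps / q) e0'.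
have /choice[y yP] : forall j, exists y, E y /\ z j = dsubmx (P *m y).
  by move=> j; have [y Ey ->] := zS j; exists y.
exists (extend y); split.
  by move=> j; rewrite /extend; case: (split j) => // k; case: (yP k).
have -> : det_of (extend y) = a / \det P * det_of z.
  have -> : z = (fun j => dsubmx (P *m y j)) by apply: funext => j; case: (yP j).
  by apply: (mulfI dP); rewrite det_extend; field.
rewrite normrM -/q.
have -> : q * `|det_of z| - r = q * (`|det_of z| - r / q) by field; rewrite lt0r_neq0.
by rewrite normrM (gtr0_norm q0) mulrC -ler_pdivlMr.
Qed.

End Slice.

(** * Restriction to a cone around a coordinate axis *)

Section Localization.
Variables (E : 'cV[R]_3 -> Prop) (b : R).
Hypotheses (b0 : 0 < b) (b1 : b < 1) (fE : fat b E).

Definition sgb (s : bool) : R := if s then 1 else -1.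

(** Coordinate [p.1], with sign [p.2], dominates and stays away from 0; it will play the part of the
    second coordinate in [det3_values]. *)
Definition piece (m : R) (p : 'I_3 * bool) (x : 'cV[R]_3) : Prop :=
  [/\ E x, m <= sgb p.2 * x p.1 0 & forall k, `|x k 0| <= sgb p.2 * x p.1 0].

Lemma piece_cover m x : E x -> (exists p, piece m p x) \/ (forall k, `|x k 0| <= m).
Proof.
move=> Ex; pose i := [arg max_(i > ord0) `|x i 0|]%O.
have hi k : `|x k 0| <= `|x i 0| by rewrite /i; case: arg_maxP => // j _; apply.
case: (lerP m `|x i 0|) => hm; last by right => k; apply: le_trans (hi k) (ltW hm).
left; exists (i, 0 <= x i 0); rewrite /piece /sgb /=.
have e : (if 0 <= x i 0 then 1 else -1) * x i 0 = `|x i 0|.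
  by case: (ger0P (x i 0)) => _; rewrite ?mul1r ?mulN1r.
by rewrite e.
Qed.

(** Otherwise each of the six pieces has a cover of cost below c/12. The rest lies in a cube of side
    2m <= D / 2^n0, one cell of cost at most c/2, and the total is below c. Covers are functions on
    [nat], so that all six can be chosen in one type. *)
Lemma fat_piece (D : R) : 2 <= D -> exists (m c : R) (p : 'I_3 * bool), [/\ 0 < m, 0 < c &
  forall k (n : nat -> nat) (U : nat -> 'cV[R]_3 -> Prop),
    small_cells D (fun i : 'I_k => n i) (fun i => U i) ->
    (forall x, piece m p x -> exists i : 'I_k, U i x) -> c <= \sum_(i < k) b ^+ n i].
Proof.
move=> D2; have D0 : 0 < D by lra.
have [c c0 hc] := fE D0.
have c2 : 0 < c / 2 by rewrite divr_gt0.
have [n0 hn0] := geometric_small 1 b0 b1 c2.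
have bn0 : b ^+ n0 <= c / 2 by have := hn0 n0 (leqnn _); rewrite mul1r.
pose m : R := 1 / 2 ^+ n0; have m0 : 0 < m by rewrite divr_gt0 // exprn_gt0.
exists m, (c / 12).
apply: contrapT => nex.
have /choice[F hF] : forall p, exists F : nat * (nat -> nat) * (nat -> 'cV[R]_3 -> Prop),
   [/\ small_cells D (fun i : 'I_F.1.1 => F.1.2 i) (fun i => F.2 i),
     (forall x, piece m p x -> exists i : 'I_F.1.1, F.2 i x) &
     \sum_(i < F.1.1) b ^+ F.1.2 i < c / 12].
  move=> p; apply: contrapT => np; apply: nex; exists p; split => //.
    by rewrite divr_gt0.
  move=> k n U sU cU; rewrite leNgt; apply/negP => h.
  by apply: np; exists (k, n, U).
pose J := (unit + {p : 'I_3 * bool & 'I_(F p).1.1})%type.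
pose n (j : J) := match j with inl _ => n0 | inr q => (F (tag q)).1.2 (tagged q) end.
pose U (j : J) := match j with inl _ => fun x : 'cV[R]_3 => forall k, `|x k 0| <= m
   | inr q => (F (tag q)).2 (tagged q) end.
have sU : small_cells D n U.
  move=> [t|q] x y.
    move=> /= hx hy k; apply: le_trans (ler_normB _ _) _.
    have h1 := hx k; have h2 := hy k; apply: le_trans (lerD h1 h2) _.
    by rewrite /m -mulrDl ler_pM2r ?invr_gt0 ?exprn_gt0.
  by have [s _ _] := hF (tag q); exact: s.
have cU x : E x -> exists j, U j x.
  move=> /(piece_cover m)[[p pp]|h]; last by exists (inl tt).
  have [_ cov _] := hF p; have [i Ui] := cov x pp.
  by exists (inr (Tagged (fun p => 'I_(F p).1.1) i)).
have := hc _ n U sU cU; rewrite big_sumType /=.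
have -> : \sum_(i : unit) b ^+ n0 = b ^+ n0 by rewrite big_const card_unit /= addr0.
rewrite [X in _ + X](_ : _ = \sum_p \sum_(i < (F p).1.1) b ^+ (F p).1.2 i); last first.
  by rewrite (sig_big_dep _ _ (fun p (i : 'I_(F p).1.1) => b ^+ (F p).1.2 i)).
have : \sum_p \sum_(i < (F p).1.1) b ^+ (F p).1.2 i < c / 2.
  apply: (@lt_le_trans _ _ (\sum_(p : 'I_3 * bool) c / 12)).
    apply: ltr_sum => [|p _]; last by have [_ _] := hF p.
    by rewrite /index_enum -enumT; have := mem_enum predT (ord0 : 'I_3, true); case: (enum _).
  by rewrite sumr_const card_prod card_ord card_bool -[leLHS]mulr_natl /=; lra.
lra.
Qed.

End Localization.

Definition o0 : 'I_3 := @Ordinal 3 0 isT.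
Definition o1 : 'I_3 := @Ordinal 3 1 isT.
Definition o2 : 'I_3 := @Ordinal 3 2 isT.

Lemma det_of3 (X : 'I_3 -> 'cV[R]_3) : det_of X =
  det3 (X o0 o0 0) (X o0 o1 0) (X o0 o2 0) (X o1 o0 0) (X o1 o1 0) (X o1 o2 0)
    (X o2 o0 0) (X o2 o1 0) (X o2 o2 0).
Proof.
rewrite /det_of (expand_det_row _ ord0) !big_ord_recl big_ord0 /cofactor.
rewrite !(expand_det_row _ ord0) !big_ord_recl !big_ord0 /cofactor !det_mx11 !mxE /=.
pose f m n := X (inord m) (inord n) 0.
have E a b : X a b 0 = f (val a) (val b) by rewrite /f !inord_val.
by rewrite !E /= /bump /= /det3; ring.
Qed.

Lemma ord3_cases (k : 'I_3) : [\/ k = o0, k = o1 | k = o2].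
Proof.
case: k => -[|[|[|//]]] h; [constructor 1 | constructor 2 | constructor 3]; exact: val_inj.
Qed.

Definition others (i : 'I_3) : 'I_3 * 'I_3 :=
  if i == o0 then (o1, o2) else if i == o1 then (o0, o2) else (o0, o1).

Lemma det3_others (X : 'I_3 -> 'cV[R]_3) (i : 'I_3) :
  `|det3 (X o0 (others i).1 0) (X o0 i 0) (X o0 (others i).2 0)
    (X o1 (others i).1 0) (X o1 i 0) (X o1 (others i).2 0)
    (X o2 (others i).1 0) (X o2 i 0) (X o2 (others i).2 0)| = `|det_of X|.
Proof.
rewrite det_of3; have [->|->|->] := ord3_cases i; rewrite /others /=.
- by rewrite -normrN; congr `|_|; rewrite /det3; ring.
- by [].
by rewrite -normrN; congr `|_|; rewrite /det3; ring.
Qed.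

Lemma all_coords (P : 'I_3 -> Prop) i : P (others i).1 -> P i -> P (others i).2 -> forall k, P k.
Proof.
by have [->|->|->] := ord3_cases i => /= p1 p2 p3 k; have [->|->|->] := ord3_cases k.
Qed.

Lemma det3_scale (s x1 x2 x3 y1 y2 y3 z1 z2 z3 : R) :
  det3 (s * x1) (s * x2) (s * x3) (s * y1) (s * y2) (s * y3) (s * z1) (s * z2) (s * z3) =
  s ^+ 3 * det3 x1 x2 x3 y1 y2 y3 z1 z2 z3.
Proof. by rewrite /det3; ring. Qed.

Lemma volumes_dim3 (E : 'cV[R]_3 -> Prop) (b M : R) : 0 < b -> b < 1 / 4 ->
  coord_bounded M E -> fat b E -> volumes_dense E.
Proof.
move=> b0 b4 bE fE.
pose K := 2 + `|M|; have K0 : 0 < K by have := normr_ge0 M; rewrite /K; lra.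
have K2 : 2 <= K by have := normr_ge0 M; rewrite /K; lra.
have bK x : E x -> forall k, `|x k 0| <= K.
  by move=> Ex k; apply: le_trans (bE x Ex k) _; have := ler_norm M; rewrite /K; lra.
have b1 : b < 1 by lra.
have [m [c [[i s] [m0 c0 hc]]]] := fat_piece b0 b1 fE K2.
(* By Bernoulli, (1 - y)^3 >= 1 - 3y, which is 4b for y = (1 - 4b)/3; hence b <= chi^3 / 4. *)
pose chi := Num.max (9 / 10) (1 - (1 - 4 * b) / 3).
have chi9 : 9 / 10 <= chi by rewrite /chi le_max lexx.
have chi1 : chi < 1 by rewrite /chi gt_max; apply/andP; split; lra.
have bchi : b <= chi ^+ 3 / 4.
  have h : 1 - (1 - 4 * b) / 3 <= chi by rewrite /chi le_max lexx orbT.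
  have h0 : 0 <= 1 - (1 - 4 * b) / 3 by lra.
  have h3 : (1 - (1 - 4 * b) / 3) ^+ 3 <= chi ^+ 3.
    by rewrite lerXn2r ?nnegrE //; lra.
  have h4 : 1 - 3 * ((1 - 4 * b) / 3) <= (1 - (1 - 4 * b) / 3) ^+ 3.
    have y1 : (1 - 4 * b) / 3 <= 1 by lra.
    move: y1; move: ((1 - 4 * b) / 3) => y y1.
    have -> : (1 - y) ^+ 3 = 1 - 3 * y + y ^+ 2 * (3 - y) by ring.
    by rewrite lerDl mulr_ge0 ?sqr_ge0 //; lra.
  lra.
(* Scales all coordinates into [-1, 1] and makes the dominating one positive. *)
pose sc := sgb s / K; have sgn1 : `|sgb s| = 1 by rewrite /sgb; case: s {hc sc}; rewrite ?normrN1 ?normr1.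
have scn : `|sc| = 1 / K by rewrite /sc normrM sgn1 normfV gtr0_norm.
pose f1 (x : 'cV[R]_3) := sc * x (others i).1 0.
pose f2 (x : 'cV[R]_3) := sc * x i 0.
pose f3 (x : 'cV[R]_3) := sc * x (others i).2 0.
have le1 x k : piece E m (i, s) x -> `|sc * x k 0| <= 1.
  by move=> [Ex _ _]; rewrite normrM scn mul1r mulrC ler_pdivrMr // mul1r bK.
have f_le1 x : piece E m (i, s) x -> [/\ `|f1 x| <= 1, `|f2 x| <= 1 & `|f3 x| <= 1].
  by move=> px; split; apply: le1.
have kap0 : 0 < m / K by rewrite divr_gt0.
have f2_dom x : piece E m (i, s) x -> [/\ m / K <= f2 x, `|f1 x| <= f2 x & `|f3 x| <= f2 x].
  move=> [_ h1 h2]; have e : f2 x = (sgb s * x i 0) / K by rewrite /f2 /sc mulrAC.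
  rewrite e; split; first by rewrite ler_pM2r ?invr_gt0.
    by rewrite /f1 normrM scn mul1r mulrC ler_pM2r ?invr_gt0 //; exact: h2.
  by rewrite /f3 normrM scn mul1r mulrC ler_pM2r ?invr_gt0 //; exact: h2.
have content (l : seq (nat * (int * int * int))) :
    (forall x, piece E m (i, s) x -> exists2 p, p \in l & grid_code f1 f2 f3 p.1 x = p.2) ->
    c <= \sum_(p <- l) (chi ^+ 3 / 4) ^+ p.1.
  move=> cov; pose p0 : nat * (int * int * int) := (0%N, (0, 0, 0)).
  have := hc (size l) (fun j => (nth p0 l j).1)
    (fun j x => grid_code f1 f2 f3 (nth p0 l j).1 x = (nth p0 l j).2).
  move=> h; apply: le_trans (h _ _) _.
  - move=> j x y /= hx hy k.
    have e : grid_code f1 f2 f3 (nth p0 l j).1 x = grid_code f1 f2 f3 (nth p0 l j).1 y.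
      by rewrite hx hy.
    move: e; move: (nth p0 l j).1 => n [e1 e2 e3].
    have pn : 0 < 2 ^+ n :> R by rewrite exprn_gt0.
    have close (q : 'I_3) : Num.floor (2 ^+ n * (sc * x q 0)) = Num.floor (2 ^+ n * (sc * y q 0)) ->
        `|x q 0 - y q 0| <= K / 2 ^+ n.
      move=> e; have /andP[u1 u2] := floor_itv (2 ^+ n * (sc * x q 0)).
      have /andP[v1 v2] := floor_itv (2 ^+ n * (sc * y q 0)).
      rewrite -e !rmorphD /= in u2 v1 v2.
      have : `|2 ^+ n * (sc * (x q 0 - y q 0))| <= 1.
        rewrite !mulrBr ler_norml; move: u1 u2 v1 v2; move: (Num.floor _)%:~R => z.
        by move=> u1 u2 v1 v2; apply/andP; split; lra.
      rewrite normrM normrM scn (gtr0_norm pn) => hh.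
      have eD (D : R) : 2 ^+ n * (1 / K * D) = D * 2 ^+ n / K by ring.
      by rewrite eD ler_pdivrMr // mul1r in hh; rewrite ler_pdivlMr.
    by move: k; apply: (@all_coords _ i); apply: close.
  - move=> x px; have [p pl e] := cov x px.
    have hi : (index p l < size l)%N by rewrite index_mem.
    by exists (Ordinal hi); rewrite /= nth_index.
  rewrite (big_nth p0) big_mkord; apply: ler_sum => j _.
  by rewrite lerXn2r ?nnegrE ?(ltW b0) // (le_trans (ltW b0)).
have [ell ell0 hell] := det3_values f_le1 chi9 chi1 c0 kap0 f2_dom content.
have K3 : 0 < K ^+ 3 by rewrite exprn_gt0.
exists (K ^+ 3 * ell) => [|r r0 rl eps eps0]; first by rewrite mulr_gt0.
have r0' : 0 <= r / K ^+ 3 by rewrite divr_ge0 // ltW.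
have rl' : r / K ^+ 3 <= ell by rewrite ler_pdivrMr // mulrC.
have e0' : 0 < eps / K ^+ 3 by rewrite divr_gt0.
have [x [y [z [px py pz]]]] := hell _ r0' rl' _ e0'.
pose X (j : 'I_3) := if j == o0 then x else if j == o1 then y else z.
rewrite /f1 /f2 /f3 det3_scale normrM normrX scn.
have := det3_others X i; rewrite /X /= => ->; rewrite -/X.
move=> h; exists X; split.
  by move=> j; rewrite /X; case: (_ == _); [case: px | case: (_ == _); [case: py | case: pz]].
move: h; move: `|det_of X| => D h.
have -> : D - r = K ^+ 3 * ((1 / K) ^+ 3 * D - r / K ^+ 3) by field; rewrite lt0r_neq0.
by rewrite normrM (gtr0_norm K3) mulrC -ler_pdivlMr.
Qed.

(** Each projection along a nonzero point of the set doubles [b], and the bound 2^-(k+2) doubles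
    with it; at k = 0 it is 1/4. *)
Lemma volumes_fat (k : nat) : forall (E : 'cV[R]_(k + 3) -> Prop) (b M : R),
  0 < b -> b < (1 / 2) ^+ (k + 2) -> 0 <= M -> coord_bounded M E -> fat b E -> volumes_dense E.
Proof.
elim: k => [|k IH] E b M b0 bk M0 bE fE.
  apply: (@volumes_dim3 E b M) => //.
  by rewrite add0n expr2 in bk; lra.
have b1 : b < 1 by apply: lt_le_trans bk _; rewrite exprn_ile1 //; lra.
have [x Ex x0] := fat_nonzero b0 b1 fE.
have [P [a [Pu a0 Px]]] := @normalizing_mx (k + 3) x x0.
apply: (@slice_volumes (k + 3) E P Pu x a Ex a0 Px).
have [M' M'0 [bS _]] := @slice_bounded (k + 3) E P M M0 bE.
apply: (IH _ (2 * b) M') => //.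
- by rewrite mulr_gt0.
- by rewrite addSn exprS in bk; move: bk; move: ((1 / 2) ^+ (k + 2)) => z bk; lra.
by apply: (@slice_fat (k + 3) E P Pu b M) => //; exact: ltW.
Qed.

Lemma volumes_dense_of_fat (d : nat) (E : 'cV[R]_d -> Prop) (b M : R) : (3 <= d)%N ->
  0 < b -> b < (1 / 2) ^+ d.-1 -> 0 <= M -> coord_bounded M E -> fat b E -> volumes_dense E.
Proof.
move=> d3; have [k dE] : exists k, d = (k + 3)%N by exists (d - 3)%N; rewrite subnK.
subst d => b0 bd; apply: (@volumes_fat k E b M b0).
by move: bd; rewrite addn3 addn2.
Qed.

End Fat.

(** * Hausdorff dimension and compactness *)

From mathcomp Require Import perm.
From mathcomp Require Import all_classical all_reals all_analysis.
Import Order.TTheory GRing.Theory Num.Theory.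
Import numFieldNormedType.Exports.
Local Open Scope classical_set_scope.
Local Open Scope ring_scope.

Section HausdorffContent.
Variables (R : realType) (d : nat).
Local Notation V := 'cV[R]_d.

Lemma edist_le (x y : V) (t : R) : 0 <= t -> (forall k, `|x k 0 - y k 0| <= t) ->
  Defs.edist x y <= d%:R * t.
Proof.
move=> t0 h; rewrite /Defs.edist -[leRHS]ger0_norm ?mulr_ge0 // -sqrtr_sqr ler_wsqrtr //.
apply: (@le_trans _ _ (\sum_(i < d) t ^+ 2)).
  by apply: ler_sum => i _; rewrite -[leLHS]real_normK ?num_real // lerXn2r ?nnegrE.
rewrite sumr_const card_ord -[leLHS]mulr_natl [leRHS]exprMn ler_wpM2r ?sqr_ge0 //.
by rewrite -natrX ler_nat; case: (d) => // n; rewrite expnS expn1 leq_pmull.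
Qed.

Lemma ediam_le (U : set V) (t : R) : 0 <= t ->
  (forall x y, U x -> U y -> forall k, `|x k 0 - y k 0| <= t) ->
  (ediam U <= (d%:R * t)%:E)%E.
Proof.
move=> t0 h; apply: ge_ereal_sup => _ [x [y [Ux [Uy ->]]]].
by rewrite lee_fin; apply: edist_le => // k; exact: h.
Qed.

Lemma diam_pow0 s : diam_pow s (set0 : set V) = 0%E.
Proof. by rewrite /diam_pow; case: (pselect (@set0 V = set0)). Qed.

Lemma diam_pow_le (s K : R) (U : set V) : 0 <= s -> 0 <= K -> (ediam U <= K%:E)%E ->
  (diam_pow s U <= (K `^ s)%:E)%E.
Proof.
move=> s0 K0 UK; rewrite /diam_pow.
case: (pselect (U = set0)) => [Ue|Un0] /=; first by rewrite lee_fin powR_ge0.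
have [x Ux] : U !=set0 by apply/set0P/eqP.
have : (0%:E <= ediam U)%E.
  apply: (@le_trans _ _ (Defs.edist x x)%:E); first by rewrite lee_fin sqrtr_ge0.
  by apply: ereal_sup_ubound; exists x, x.
move: UK; case: (ediam U) => [r| |] //; rewrite !lee_fin => rK r0.
by rewrite ge0_ler_powR // nnegrE.
Qed.

Lemma diam_pow_ge0 (s : R) (U : set V) : (0 <= diam_pow s U)%E.
Proof.
rewrite /diam_pow; case: (pselect (U = set0)) => [//|_] /=; case: (ediam U) => [r| |] //.
by rewrite lee_fin powR_ge0.
Qed.

Lemma hcontent_ge0 s delta (E : set V) : (0 <= hcontent s delta E)%E.
Proof.
apply: le_ereal_inf_tmp => _ [U [_ _ ->]]; apply: nneseries_ge0 => n _ _.
exact: diam_pow_ge0.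
Qed.

(** The finite family is continued by empty sets, which [diam_pow] counts as 0. *)
Lemma finite_cover_content (s delta : R) (E : set V) (I : finType) (U : I -> set V)
    (rho : I -> R) : 0 <= s -> (forall i, 0 <= rho i) ->
  (forall i, (ediam (U i) <= (rho i)%:E)%E) -> (forall i, rho i <= delta) -> 0 <= delta ->
  (forall x, E x -> exists i, U i x) ->
  (hcontent s delta E <= (\sum_i rho i `^ s)%:E)%E.
Proof.
move=> s0 r0 dU rd d0 cov.
pose U' (k : nat) : set V := [set x | exists2 i, nat_of_ord (enum_rank i) = k & U i x].
have U'E i : U' (enum_rank i) = U i.
  apply/seteqP; split => x /=; last by exists i.
  by move=> [j /val_inj/enum_rank_inj ->].
have U'0 k : (#|I| <= k)%N -> U' k = set0.
  move=> hk; apply/seteqP; split => x //= [i ik _].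
  by move: hk; rewrite -ik leqNgt ltn_ord.
apply: ge_ereal_inf; exists (\sum_(0 <= k <oo) diam_pow s (U' k))%E.
  exists U'; split => //.
    by move=> x Ex; have [i Ui] := cov x Ex; exists (enum_rank i) => //; rewrite U'E.
  move=> k; case: (ltnP k #|I|) => hk.
    have -> : k = enum_rank (enum_val (Ordinal hk)) by rewrite enum_valK.
    by rewrite U'E; apply: le_trans (dU _) _; rewrite lee_fin.
  by rewrite U'0 //; apply: ge_ereal_sup => z [x [y [h _]]]; case: h.
rewrite (@nneseries_split _ _ 0 #|I|); last by move=> k _; exact: diam_pow_ge0.
rewrite add0n eseries0; last by move=> k hk _; rewrite U'0 ?diam_pow0.
rewrite adde0 big_mkord -sumEFin.
rewrite (reindex (fun i : I => enum_rank i)) /=; last first.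
  by exists enum_val => i _; rewrite ?enum_valK ?enum_rankK.
by apply: lee_sum => i _; rewrite U'E; apply: diam_pow_le.
Qed.

(** The content at scale [delta] bounds covers by small cells. A cover with a cell larger than
    [delta] has a term of level at most [M], worth at least b^M by itself; hence the minimum. *)
Lemma fat_of_content (s delta c0 : R) (E : set V) : (0 < d)%N -> 0 < s -> 0 < delta -> 0 < c0 ->
  (c0%:E <= hcontent s delta E)%E -> fat ((1 / 2) `^ s) E.
Proof.
move=> dd s0 de0 c00 hE D D0.
pose b : R := (1 / 2) `^ s.
have hlf : 0 <= 1 / 2 :> R by rewrite divr_ge0.
have b0 : 0 < b by rewrite powR_gt0 // divr_gt0.
have b1 : b <= 1.
  apply: (@le_trans _ _ (1 `^ s)); last by rewrite powR1.
  by rewrite ge0_ler_powR ?nnegrE ?(ltW s0) //; lra.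
pose K := d%:R * D; have K0 : 0 < K by rewrite mulr_gt0 // ltr0n.
have KsE n : (K / 2 ^+ n) `^ s = K `^ s * b ^+ n.
  have -> : K / 2 ^+ n = K * (1 / 2) ^+ n by rewrite expr_div_n expr1n mul1r.
  rewrite powRM ?(ltW K0) ?exprn_ge0 //; congr (_ * _).
  elim: n => [|n IH]; first by rewrite !expr0 powR1.
  by rewrite !exprS powRM ?exprn_ge0 // IH.
have Ks0 : 0 < K `^ s by rewrite powR_gt0.
have hlf0 : 0 < 1 / 2 :> R by rewrite divr_gt0.
have hlf1 : 1 / 2 < 1 :> R by lra.
have [M hM] := geometric_small K hlf0 hlf1 de0.
exists (Num.min (c0 / K `^ s) (b ^+ M)); first by rewrite lt_min divr_gt0 //= exprn_gt0.
move=> I n U sU cov.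
case: (boolP [forall i, K / 2 ^+ n i <= delta]) => [/forallP small|].
  have := @finite_cover_content s delta E I U (fun i => K / 2 ^+ n i) (ltW s0) _ _ small (ltW de0) cov.
  move=> h; have {}h := le_trans hE (h _ _).
  rewrite ge_min; apply/orP; left; rewrite ler_pdivrMr // mulrC mulr_sumr.
  rewrite -lee_fin; under eq_bigr => i _ do rewrite -KsE.
  apply: h => i; first by rewrite divr_ge0 ?(ltW K0) // exprn_ge0.
  rewrite /K -mulrA; apply: ediam_le; first by rewrite divr_ge0 ?(ltW D0) // exprn_ge0.
  by move=> x y Ux Uy k; exact: sU Ux Uy k.
rewrite negb_forall => /existsP[i]; rewrite -ltNge => hi.
rewrite ge_min; apply/orP; right.
have nM : (n i <= M)%N.
  rewrite leqNgt; apply/negP => h; have := hM (n i) (ltnW h).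
  by rewrite expr_div_n expr1n mul1r leNgt hi.
rewrite (bigD1 i) //= -[leLHS]addr0 lerD //.
  by rewrite ler_wiXn2l ?(ltW b0).
by apply: sumr_ge0 => j _; rewrite exprn_ge0 ?(ltW b0).
Qed.

Lemma content_of_hdim (s : R) (E : set V) : 0 <= s -> (s%:E < hdim E)%E ->
  exists delta c0 : R, [/\ 0 < delta, 0 < c0 & (c0%:E <= hcontent s delta E)%E].
Proof.
move=> s0 sE; have hm : hmeasure s E <> 0%E.
  move=> h; move: sE; rewrite ltNge => /negP; apply; apply: ereal_inf_lbound.
  by exists s.
apply: contrapT => nex; apply: hm; apply/eqP; rewrite eq_le; apply/andP; split.
  apply: ge_ereal_sup => _ [delta d0 ->].
  rewrite leNgt; apply/negP => hpos; apply: nex.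
  move: hpos; case hE : (hcontent s delta E) => [r| |] // hpos.
    by exists delta, r; split; rewrite ?hE // -lte_fin.
  (* The content may be infinite; any positive number is then a lower bound. *)
  by exists delta, 1; split; rewrite ?hE // leey.
apply: le_trans (hcontent_ge0 s 1 E) _; apply: ereal_sup_ubound.
by exists 1.
Qed.

End HausdorffContent.

(** * Closedness of the set of volumes *)

Section CompactClosing.
Variables (R : realType) (d : nat).
Local Notation V := 'cV[R]_d.

Lemma compact_coord_bounded (E : set V) : compact E ->
  exists2 M : R, 0 <= M & coord_bounded M E.
Proof.
move=> cE.
have /choice[M hM] : forall k : 'I_d, exists M : R, forall x, E x -> `|x k 0| <= M.
  move=> k; have cont : continuous (fun x : V => x k 0) by exact: coord_continuous.
  have /compact_bounded[M [_ h]] := continuous_compact (continuous_subspaceT cont) cE.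
  exists (M + 1) => x Ex; apply: (h (M + 1)); first by rewrite ltrDl.
  by exists x.
exists (\sum_k `|M k|); first by apply: sumr_ge0.
move=> x Ex k; apply: le_trans (hM k x Ex) _; apply: le_trans (ler_norm _) _.
by rewrite (bigD1 k) //= lerDl sumr_ge0.
Qed.

Definition pinned_det (x0 : V) (f : prod_topology (fun _ : 'I_d => V)) : R :=
  \det (\matrix_(i < d, j < d) (f j i 0 - x0 i 0)).

(** The Leibniz formula makes it a polynomial in coordinates of projections of the product. *)
Lemma pinned_det_continuous (x0 : V) : continuous (pinned_det x0).
Proof.
have -> : pinned_det x0 = (fun g =>
    \sum_(s : {perm 'I_d}) (-1) ^+ s * \prod_i (g (s i) i 0 - x0 i 0)).
  by apply/funext => g; apply: eq_bigr => s _; congr (_ * _); apply: eq_bigr => i _; rewrite mxE.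
apply: continuous_big => [|s _]; first exact: add_continuous.
have P : continuous (fun g : prod_topology (fun _ : 'I_d => V) => \prod_i (g (s i) i 0 - x0 i 0)).
  apply: continuous_big => [|i _ f]; first exact: mul_continuous.
  have FF := nbhs_filter (f : prod_topology (fun _ : 'I_d => V)).
  apply: cvgB; last exact: cvg_cst.
  have h1 : (fun g : prod_topology (fun _ : 'I_d => V) => g (s i)) @ f --> f (s i).
    exact: (@proj_continuous _ (fun _ : 'I_d => V) (s i) f).
  have h2 := @coord_continuous R d 1 i 0 (f (s i)).
  exact: (@continuous_comp (prod_topology (fun _ : 'I_d => V)) V R
    (fun g => g (s i)) (fun M => M i 0) f h1 h2).
move=> f; have FF := nbhs_filter (f : prod_topology (fun _ : 'I_d => V)).
apply: cvgM; [exact: cvg_cst | exact: P].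
Qed.

(** It is a continuous image of E^d, which is compact by Tychonoff. *)
Lemma vol_set_closed (x0 : V) (E : set V) : compact E -> closed (vol_set x0 E).
Proof.
move=> cE.
have cK : @compact (prod_topology (fun _ : 'I_d => V)) [set f | forall i, E (f i)].
  by apply: (@tychonoff _ (fun _ : 'I_d => V) (fun=> E)).
have -> : vol_set x0 E = (fun f => `|pinned_det x0 f|) @` [set f | forall i, E (f i)].
  apply/seteqP; split => r /=.
    by move=> [x [Ex ->]]; exists x.
  by move=> [x Ex <-]; exists x.
apply: compact_closed; first exact: Rhausdorff.
apply: continuous_compact cK; apply: continuous_subspaceT => f.
exact: (continuous_comp (@pinned_det_continuous x0 f) (@norm_continuous _ R _)).
Qed.

Lemma fat_translate (b : R) (E : set V) (x0 : V) : fat b E ->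
  fat b [set y | E (y + x0)].
Proof.
move=> fE D D0; have [c c0 hc] := fE D D0; exists c => // I n U sU cov.
apply: (hc I n (fun i x => U i (x - x0))).
  move=> i x y Ux Uy k; have := sU i _ _ Ux Uy k; rewrite !mxE.
  by have -> : x k 0 - x0 k 0 - (y k 0 - x0 k 0) = x k 0 - y k 0 by ring.
by move=> x Ex; apply: cov => /=; rewrite subrK.
Qed.

End CompactClosing.

Lemma powR_half_lt (R : realType) (d : nat) : (0 < d)%N ->
  (1 / 2 : R) `^ (d%:R - 1 + d%:R^-1) < (1 / 2) ^+ d.-1.
Proof.
move=> d0; have h0 : 0 < 1 / 2 :> R by rewrite divr_gt0.
have -> : (1 / 2 : R) ^+ d.-1 = (1 / 2) `^ (d%:R - 1).
  rewrite -powR_mulrn ?(ltW h0) //; congr (_ `^ _).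
  by case: d d0 => // n _; rewrite -natr1 addrK.
rewrite powRD; last by rewrite (gt_eqF h0) implybT.
rewrite -[ltRHS]mulr1 ltr_pM2l ?powR_gt0 //.
apply: (@lt_le_trans _ _ (1 `^ d%:R^-1)); last by rewrite powR1.
by rewrite gt0_ltr_powR ?invr_gt0 ?ltr0n ?nnegrE ?(ltW h0) //; lra.
Qed.

Unset Implicit Arguments. Set Strict Implicit. Set Printing Implicit Defensive.

Theorem theorem1p2 (R : realType) (d : nat) (hd : (3 <= d)%N)
  (E : set 'cV[R]_d) (hE : compact E)
  (hdimE : ((d%:R - 1 + d%:R^-1)%:E < hdim E)%E) (x0 : 'cV[R]_d) :
  interior (vol_set x0 E) !=set0.
Proof.
have d0 : (0 < d)%N by apply: leq_trans hd.
have dR : 0 < d%:R :> R by rewrite ltr0n.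
have dR1 : 1 <= d%:R :> R by rewrite ler1n.
pose s : R := d%:R - 1 + d%:R^-1.
have s0 : 0 < s by rewrite /s ltr_wpDl ?invr_gt0 // subr_ge0.
have [delta [c0 [delta0 c00 hc]]] := content_of_hdim (ltW s0) hdimE.
(* Translation brings the pin to the origin, where determinants need no subtraction. *)
have fE := @fat_translate _ _ _ _ x0 (fat_of_content d0 s0 delta0 c00 hc).
have [M M0 bE] := compact_coord_bounded hE.
have bE' : coord_bounded (M + \sum_k `|x0 k 0|) [set y | E (y + x0)].
  move=> y Ey k; have := bE _ Ey k; rewrite mxE => h.
  have -> : y k 0 = (y k 0 + x0 k 0) - x0 k 0 by ring.
  apply: le_trans (ler_normB _ _) _; apply: lerD => //.
  by rewrite (bigD1 k) //= lerDl sumr_ge0.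
have [ell ell0 hell] : volumes_dense [set y | E (y + x0)].
  have b0 : 0 < (1 / 2 : R) `^ s by rewrite powR_gt0 // divr_gt0.
  have M1 : 0 <= M + \sum_k `|x0 k 0| by rewrite addr_ge0 // sumr_ge0.
  exact: volumes_dense_of_fat hd b0 (powR_half_lt R d0) M1 bE' fE.
have cl : closed (vol_set x0 E) by exact: vol_set_closed.
have inV r : 0 <= r -> r <= ell -> vol_set x0 E r.
  (* A neighbourhood of [r] free of volumes would contradict density with tolerance e/2. *)
  move=> r0 rl; move: cl; rewrite closedE => /(_ r); apply => /nbhs_ballP[e /= e0 he].
  have [|x [Ex hx]] := hell r r0 rl (e / 2); first by rewrite divr_gt0.
  apply: (he `|det_of x|).
    by rewrite /ball /= distrC; apply: le_lt_trans hx _; rewrite ltr_pdivrMr // ltr_pMr // ltr1n.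
  exists (fun j => x j + x0); split; first exact: Ex.
  congr `|_|; congr (\det _); apply/matrixP => i j; rewrite !mxE; ring.
exists (ell / 2); apply/nbhs_ballP; exists (ell / 2) => /=; first by rewrite divr_gt0.
move=> r; rewrite /ball /= ltr_norml => /andP[h1 h2]; apply: inV; lra.
Qed.
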